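(* Let $H=L^2(\mathcal O)$ and assume that $\mathrm e^{sA}$ is positivity preserving for every $s\ge0$ (i.e. $x\in H$, $x\ge0$ implies $\mathrm e^{sA}x\ge0$). Let $0\le t<T$. Let $\bar b:\Omega\times[t,T]\times H\to H$ be $\mathrm{Prog}_{[t,T]}\otimes\mathscr B(H)/\mathscr B(H)$ measurable and such that, for some constant $C$ (suppressing the variable $\omega$), $$\|[\bar b(s,x_1)-\bar b(s,x_2)]_+\|_H\le C\|[x_1-x_2]_+\|_H\quad\text{for all }s\in[t,T],\ x_1,x_2\in H.$$ Let $\bar\sigma:\Omega\times[t,T]\to L_2(\Xi,H)$ be $\mathrm{Prog}_{[t,T]}/\mathscr B(L_2(\Xi,H))$ measurable. For $i=1,2$ let $f_i:\Omega\times[t,T]\to H$ be $\mathrm{Prog}_{[t,T]}/\mathscr B(H)$ measurable with $f_i\in L^1(t,T;H)$ $\mathbb P$-almost surely, and let $X_i$ be a mild solution of $$\mathrm dX(s)=[AX(s)+\bar b(s,X(s))+f_i(s)]\mathrm ds+\bar\sigma(s)\mathrm dW(s),\ s\in[t,T],\qquad X(t)=x_i\in L^2(\mathcal O).$$ Suppose that $x_1\ge x_2$ and $f_1(s)\ge f_2(s)$ for $s\in[t,T]$. Then $X_1(s)\ge X_2(s)$ for all $s\in[t,T]$.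
   Context: $\mathcal O\subset\mathbb R^d$, $d\in\mathbb N$, is a domain. For $x_1,x_2\in L^2(\mathcal O)$, $x_1\le x_2$ is understood almost everywhere, and $x_+(\xi)=\max\{x(\xi),0\}$. Inequalities between random elements of $H$ are understood $\mathbb P$-a.s. $A:\mathcal D(A)\subset H\to H$ is linear, densely defined and maximal dissipative and generates the $C_0$-semigroup of contractions $(\mathrm e^{sA})_{s\ge0}$. $\Xi$ is a real separable Hilbert space, $L_2(\Xi,H)$ the Hilbert--Schmidt operators, $W$ a cylindrical Wiener process in $\Xi$ on a complete probability space $(\Omega,\mathscr F,\mathbb P)$ with $W(t)=0$ a.s., with filtration $(\mathscr F^t_s)_{s\in[t,T]}$ generated by $W$ and the $\mathbb P$-null sets. $\mathrm{Prog}_{[t,T]}$ is the $\sigma$-field of progressively measurable subsets of $\Omega\times[t,T]$, and $\mathscr B(\cdot)$ denotes Borel $\sigma$-fields. A mild solution of $\mathrm dX=[AX+\bar b(s,X)+f_i]\mathrm ds+\bar\sigma\,\mathrm dW$, $X(t)=x_i$, is an $H$-valued progressively measurable process $X$ such that for every $s\in[t,T]$, $\mathbb P$-a.s., $\int_t^s\big(\|X(r)\|_H+\|\mathrm e^{(s-r)A}(\bar b(r,X(r))+f_i(r))\|_H+\|\mathrm e^{(s-r)A}\bar\sigma(r)\|_{L_2(\Xi,H)}^2\big)\mathrm dr<\infty$ and $X(s)=\mathrm e^{(s-t)A}x_i+\int_t^s\mathrm e^{(s-r)A}(\bar b(r,X(r))+f_i(r))\mathrm dr+\int_t^s\mathrm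 e^{(s-r)A}\bar\sigma(r)\mathrm dW(r)$. Uniqueness of mild solutions is not assumed. *)

(* Defs.v *)
From HB Require Import structures.
From mathcomp Require Import all_boot all_order all_algebra.
From mathcomp Require Import all_classical all_reals all_analysis.
From mathcomp Require Import measurable_realfun ring_quotient generic_quotient.
Set Implicit Arguments.
Unset Strict Implicit.
Unset Printing Implicit Defensive.
Import Order.TTheory GRing.Theory Num.Theory numFieldNormedType.Exports.
Local Open Scope classical_set_scope.
Local Open Scope ring_scope.

Section rV_measurable.
Context (R : realType) (n : nat).

Definition rV_cylinder : set_system 'rV[R]_n :=
  [set A | exists i (B : set R),
    measurable B /\ A = (fun x : 'rV[R]_n => x ord0 i) @^-1` B].

HB.instance Definition _ := @isMeasurable.Build default_measure_display
  'rV[R]_n <<s rV_cylinder >> (@sigma_algebra0 _ setT rV_cylinder)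
  (@sigma_algebraC _ rV_cylinder) (@sigma_algebra_bigcup _ setT rV_cylinder).

Lemma measurable_coord i : measurable_fun setT (fun x : 'rV[R]_n => x ord0 i).
Proof.
by move=> _ B mB; rewrite setTI; apply: sub_sigma_algebra; exists i, B.
Qed.

Lemma measurable_fun_rVP d (T : measurableType d) (f : T -> 'rV[R]_n) :
  (forall i, measurable_fun setT (fun t => f t ord0 i)) ->
  measurable_fun setT f.
Proof.
move=> mf _ A mA; rewrite setTI.
move: A mA; apply: smallest_sub => [|_ [i [B [mB ->]]]].
  split=> [|A mA|F mF].
  - by rewrite preimage_set0.
  - by rewrite setTD preimage_setC; apply: measurableC.
  - by rewrite preimage_bigcup; apply: bigcup_measurable => k _; exact: mF.
by have := mf i measurableT B mB; rewrite setTI.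
Qed.

End rV_measurable.

Lemma open_measurable_rV (R : realType) n (O : set 'rV[R]_n) :
  open O -> measurable O.
Proof.
move=> oO.
pose bx (c : 'rV[rat]_n * rat) : set 'rV[R]_n :=
  [set x | forall i, ball (ratr (c.1 ord0 i) : R) (ratr c.2) (x ord0 i)].
have mbx c : measurable (bx c).
  rewrite (_ : bx c = \bigcap_(i in [set: 'I_n])
     ((fun x : 'rV[R]_n => x ord0 i) @^-1`
        ball (ratr (c.1 ord0 i) : R) (ratr c.2))).
    apply: fin_bigcap_measurable => // i _.
    rewrite -[X in measurable X]setTI; apply: measurable_coord => //.
    apply: open_measurable; exact: ball_open.
  by apply/seteqP; split=> x /= h i; [move=> _|]; exact: h.
rewrite (_ : O = \bigcup_(c in [set c | bx c `<=` O]) bx c).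
  rewrite bigcup_mkcond; apply: countable_bigcupT_measurable => [//|c].
  by case: ifP.
apply/seteqP; split=> [x Ox|x [c /= cO]]; last exact: cO.
have /nbhs_ballP[e /= e0 xeO] : nbhs x O by exact: open_nbhs_nbhs.
have /rat_in_itvoo[q /itvP qe] : 0 < e / 2 by rewrite divr_gt0.
have q0 : 0 < ratr q :> R by rewrite qe.
have qe2 : ratr q < e / 2 by rewrite qe.
have /(_ _)/cid-/all_sig[c hc] (i : 'I_n) :
    exists p : rat, ball (ratr p : R) (ratr q) (x ord0 i).
  have : x ord0 i - ratr q < x ord0 i + ratr q.
    by rewrite ltrBlDr -addrA ltrDl addr_gt0.
  move=> /rat_in_itvoo[p /itvP pq]; exists p.
  by rewrite /ball/= ltr_distl ltrBlDr pq /= -ltrBlDr pq.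
exists (\row_i c i, q) => /=; last by move=> i; rewrite mxE.
move=> y hy; apply: xeO; split=> // i j; rewrite !ord1.
have := hy j; rewrite mxE => hyj.
have /ball_sym hxj := hc j.
apply: (le_ball (ltW _) (ball_triangle hxj hyj)).
by rewrite [ltRHS]splitr ltrD.
Qed.

Section lebesgue_rV.
Context (R : realType).

(* The vector with first coordinate [p.1] followed by those of [p.2]. *)
Definition consV n (p : R * 'rV[R]_n) : 'rV[R]_n.+1 :=
  \row_i (if unlift ord0 i is Some j then p.2 ord0 j else p.1).

Lemma measurable_consV n : measurable_fun setT (@consV n).
Proof.
apply: measurable_fun_rVP => i.
case: (unliftP ord0 i) => [j|] ->.
  under eq_fun do rewrite mxE liftK.
  exact: (measurableT_comp (@measurable_coord R n j) measurable_snd).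
under eq_fun do rewrite mxE unlift_none.
exact: measurable_fst.
Qed.

Lemma measurable_unconsV n :
  measurable_fun setT (fun x : 'rV[R]_n.+1 =>
    (x ord0 ord0, \row_j x ord0 (lift ord0 j) : 'rV[R]_n)).
Proof.
apply: measurable_fun_pair; first exact: measurable_coord.
apply: measurable_fun_rVP => i; under eq_fun do rewrite mxE.
exact: measurable_coord.
Qed.

Section step.
Variables (n : nat) (m : {sigma_finite_measure set 'rV[R]_n -> \bar R}).

Definition leb_step : set 'rV[R]_n.+1 -> \bar R :=
  pushforward (lebesgue_measure \x m)%E (@consV n).

Let leb_step0 : leb_step set0 = 0%E.
Proof. by rewrite /leb_step /pushforward preimage_set0 measure0. Qed.

Let leb_step_ge0 A : (0 <= leb_step A)%E.
Proof. by rewrite /leb_step /pushforward; exact: measure_ge0. Qed.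

Let leb_step_sigma_additive : semi_sigma_additive leb_step.
Proof.
have mpre B : measurable B -> measurable (@consV n @^-1` B).
  by move=> mB; rewrite -[X in measurable X]setTI; exact: measurable_consV.
move=> F mF tF mUF; rewrite /leb_step /pushforward preimage_bigcup.
apply: measure_semi_sigma_additive.
- by move=> k; exact: mpre.
- apply/trivIsetP => i j _ _ ij; rewrite -preimage_setI.
  by move/trivIsetP : tF => /(_ _ _ _ _ ij) ->//; rewrite preimage_set0.
- by rewrite -preimage_bigcup; exact: mpre.
Qed.

HB.instance Definition _ := isMeasure.Build _ _ _ leb_step
  leb_step0 leb_step_ge0 leb_step_sigma_additive.

Lemma leb_step_sigma_finite : sigma_finite setT leb_step.
Proof.
have /sigma_finiteP[F [TF ndF Foo]] := sigma_finiteT (@lebesgue_measure R).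
have /sigma_finiteP[G [TG ndG Goo]] := sigma_finiteT m.
pose u (x : 'rV[R]_n.+1) :=
  (x ord0 ord0, \row_j x ord0 (lift ord0 j) : 'rV[R]_n).
have uK : cancel (@consV n) u.
  move=> [a v]; rewrite /u mxE unlift_none; congr pair.
  by apply/rowP => j; rewrite !mxE liftK.
exists (fun k => u @^-1` (F k `*` G k)).
  apply/esym; rewrite -subTset => x _.
  have [k _ Fk] : (\bigcup_i F i) (u x).1 by rewrite -TF.
  have [l _ Gl] : (\bigcup_i G i) (u x).2 by rewrite -TG.
  exists (maxn k l) => //; split => /=.
  - by move: Fk; exact/subsetPset/ndF/leq_maxl.
  - by move: Gl; exact/subsetPset/ndG/leq_maxr.
move=> k; have [mF Fk] := Foo k; have [mG Gk] := Goo k; split.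
  rewrite -[X in measurable X]setTI; apply: measurable_unconsV => //.
  exact: measurableX.
rewrite /leb_step /pushforward -comp_preimage.
rewrite (_ : u \o @consV n = id); last by apply/funext => p; exact: uK.
by rewrite product_measure1E// lte_mul_pinfty// ge0_fin_numE.
Qed.

HB.instance Definition _ := Measure_isSigmaFinite.Build _ _ _ leb_step
  leb_step_sigma_finite.
End step.

(* Lebesgue measure on R^n, by splitting off the first coordinate. *)
Fixpoint lebesgue_rV n : {sigma_finite_measure set 'rV[R]_n -> \bar R} :=
  if n is k.+1 then leb_step (lebesgue_rV k) else dirac (0 : 'rV[R]_0).

Lemma lebesgue_rV_box n (B : 'I_n -> set R) : (forall i, measurable (B i)) ->
  lebesgue_rV n [set x | forall i, B i (x ord0 i)] =
    (\prod_(i < n) lebesgue_measure (B i))%E.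
Proof.
elim: n B => [|n IHn] B mB.
  by rewrite big_ord0 /= diracE mem_set// => -[].
pose D := [set x : 'rV[R]_n | forall i, B (lift ord0 i) (x ord0 i)].
have mD : measurable D.
  rewrite (_ : D = \bigcap_(i in [set: 'I_n])
     ((fun x : 'rV[R]_n => x ord0 i) @^-1` B (lift ord0 i))).
    apply: fin_bigcap_measurable => // i _.
    by rewrite -[X in measurable X]setTI; exact: measurable_coord.
  by apply/seteqP; split=> x /= h i; [move=> _|]; exact: h.
rewrite big_ord_recl -IHn// -/D -product_measure1E//.
  congr ((_ \x _)%E _); apply/seteqP; split=> -[a v] /=.
    move=> h; split; first by have := h ord0; rewrite mxE unlift_none.
    by move=> i; have := h (lift ord0 i); rewrite mxE liftK.
  by move=> [Ba Bv] i; rewrite mxE; case: unliftP => [j|] ->.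
exact: mB.
Qed.
End lebesgue_rV.

HB.mixin Record NormedModule_isInnerProduct (R : realType) V
  & NormedModule R V := {
  dot : V -> V -> R ;
  dotC : forall x y, dot x y = dot y x ;
  dotDl : forall x y z, dot (x + y) z = dot x z + dot y z ;
  dotZl : forall k x y, dot (k *: x) y = k * dot x y ;
  dotxx : forall x, dot x x = `|x| ^+ 2 }.

#[short(type="innerProductType")]
HB.structure Definition InnerProduct (R : realType) :=
  {V of NormedModule_isInnerProduct R V & NormedModule R V}.

#[short(type="hilbertType")]
HB.structure Definition Hilbert (R : realType) :=
  {V of InnerProduct R V & CompleteNormedModule R V}.


Section L2.
Context d (T : measurableType d) (R : realType).
Variable mu : {measure set T -> \bar R}.

Local Notation L2fun := (LfunType mu (@lee1n R 2)).
Implicit Types f g h : L2fun.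

(* The square-integrable functions that vanish mu-a.e.; L2 is the quotient by
   this subspace. *)
Definition ae0 : {pred L2fun} :=
  [pred f : L2fun | `[< \forall x \ae mu, f x = 0 >]].

Lemma ae0P f : reflect (\forall x \ae mu, f x = 0) (f \in ae0).
Proof. exact: asboolP. Qed.

Lemma ae0_zmod_closed : zmod_closed ae0.
Proof.
split=> [|f g /ae0P f0 /ae0P g0]; first by apply/ae0P/aeW.
apply/ae0P; move: f0 g0; apply: filterS2 => x fx gx.
by rewrite -[LHS]/(f x - g x) fx gx subr0.
Qed.
HB.instance Definition _ := GRing.isZmodClosed.Build _ ae0 ae0_zmod_closed.

Lemma ae0Z a f : f \in ae0 -> a *: f \in ae0.
Proof.
move=> /ae0P f0; apply/ae0P; apply: filterS f0 => x fx.
by rewrite -[LHS]/(a * f x) fx mulr0.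
Qed.

Definition L2 : Type := Quotient.quot ae0.
HB.instance Definition _ := GRing.Zmodule.on L2.
HB.instance Definition _ := Quotient.on L2.
Local Open Scope quotient_scope.

Lemma L2_eqP f g : reflect (\forall x \ae mu, f x = g x) (\pi_L2 f == \pi_L2 g).
Proof.
rewrite -[_ == _]Quotient.idealrBE.
apply: (iffP (ae0P _)) => h; apply: filterS h => x fg.
  by apply/eqP; rewrite -subr_eq0; exact/eqP.
by rewrite -[LHS]/(f x - g x) fg subrr.
Qed.

Lemma repr_piE f : \forall x \ae mu, (repr (\pi_L2 f) : L2fun) x = f x.
Proof. by apply/L2_eqP; rewrite reprK. Qed.

Lemma piD f g : \pi_L2 (f + g) = \pi_L2 f + \pi_L2 g.
Proof. exact: Quotient.pi_add. Qed.

Definition L2scale (a : R) (x : L2) : L2 := \pi_L2 (a *: (repr x : L2fun)).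

Lemma piZ a f : \pi_L2 (a *: f) = L2scale a (\pi_L2 f).
Proof.
apply/eqP/L2_eqP; apply: filterS (repr_piE f) => x fx.
by rewrite -[RHS]/(a * (repr (\pi_L2 f) : L2fun) x) fx.
Qed.

Lemma L2scaleA a b x : L2scale a (L2scale b x) = L2scale (a * b) x.
Proof. by elim/quotW: x => x; rewrite -(piZ b) -!piZ scalerA. Qed.
Lemma L2scale1 x : L2scale 1 x = x.
Proof. by elim/quotW: x => x; rewrite -!piZ scale1r. Qed.
Lemma L2scaleDr : right_distributive L2scale +%R.
Proof.
move=> a x y; elim/quotW: x => x; elim/quotW: y => y.
by rewrite -piD -!piZ scalerDr piD.
Qed.
Lemma L2scaleDl x a b : L2scale (a + b) x = L2scale a x + L2scale b x.
Proof. by elim/quotW: x => x; rewrite -!piZ scalerDl piD. Qed.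
HB.instance Definition _ := GRing.Zmodule_isLmodule.Build R L2
  L2scaleA L2scale1 L2scaleDr L2scaleDl.

Definition L2norm (x : L2) : R := fine 'N[mu]_2%:E[EFin \o (repr x : L2fun)]%E.

Lemma L2norm_pi f : L2norm (\pi_L2 f) = fine 'N[mu]_2%:E[EFin \o f]%E.
Proof.
rewrite /L2norm unlock; congr (fine (_ `^ _)%E).
apply: ae_eq_integral => //.
- apply: (measurableT_comp (measurable_poweR _)).
  by apply: measurableT_comp => //; apply/measurable_EFinP.
- apply: (measurableT_comp (measurable_poweR _)).
  by apply: measurableT_comp => //; apply/measurable_EFinP.
by apply: filterS (repr_piE f) => x /= -> _.
Qed.

Lemma ler_L2normD x y : L2norm (x + y) <= L2norm x + L2norm y.
Proof.
elim/quotW: x => x; elim/quotW: y => y.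
by rewrite -piD !L2norm_pi; exact: ler_LnormD.
Qed.

Lemma L2normZ a x : L2norm (a *: x) = `|a| * L2norm x.
Proof.
elim/quotW: x => x; rewrite -[_ *: _]/(L2scale a _) -piZ !L2norm_pi.
rewrite (_ : EFin \o _ = EFin \o (a \*: x))// LnormZ.
by rewrite -finite_norm_fine.
Qed.

Lemma L2norm0_eq0 x : L2norm x = 0 -> x = 0.
Proof.
elim/quotW: x => x; rewrite L2norm_pi => /fine_Lnormr_eq0 h.
have -> : 0 = \pi_L2 0.
  by apply: (addrI (\pi_L2 0)); rewrite -piD !addr0.
by apply/eqP/L2_eqP; apply: filterS h => t; exact.
Qed.

HB.instance Definition _ := Lmodule_isNormed.Build R L2
  ler_L2normD L2normZ L2norm0_eq0.

Definition L2dot (x y : L2) : R :=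
  \int[mu]_t ((repr x : L2fun) t * (repr y : L2fun) t).

Lemma L2fun_Lfun f : (f : T -> R) \in Lfun mu 2%:E.
Proof. exact: LfunP. Qed.

Lemma L2fun_mul_integrable f g :
  mu.-integrable setT (EFin \o (fun t => f t * g t)).
Proof. exact/Lfun1_integrable/Lfun2_mul_Lfun1/L2fun_Lfun/L2fun_Lfun. Qed.

Lemma L2dot_pi f g : L2dot (\pi_L2 f) (\pi_L2 g) = \int[mu]_t (f t * g t).
Proof.
rewrite /L2dot /Rintegral; congr fine; apply: ae_eq_integral => //.
- exact: measurable_int (L2fun_mul_integrable _ _).
- exact: measurable_int (L2fun_mul_integrable _ _).
by move: (repr_piE f) (repr_piE g); apply: filterS2 => t -> -> _.
Qed.

Lemma L2dotC x y : L2dot x y = L2dot y x.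
Proof. by apply: eq_Rintegral => t _; rewrite mulrC. Qed.

Lemma L2dotDl x y z : L2dot (x + y) z = L2dot x z + L2dot y z.
Proof.
elim/quotW: x => f; elim/quotW: y => g; elim/quotW: z => h.
rewrite -piD !L2dot_pi -RintegralD//; try exact: L2fun_mul_integrable.
by apply: eq_Rintegral => t _; rewrite -mulrDl.
Qed.

Lemma L2dotZl a x y : L2dot (a *: x) y = a * L2dot x y.
Proof.
elim/quotW: x => f; elim/quotW: y => g.
rewrite -[_ *: _]/(L2scale a _) -piZ !L2dot_pi -RintegralZl//.
  by apply: eq_Rintegral => t _; rewrite mulrA.
exact: L2fun_mul_integrable.
Qed.

Lemma L2dotxx x : L2dot x x = `|x| ^+ 2.
Proof.
elim/quotW: x => f; rewrite L2dot_pi -[`|_|]/(L2norm _) L2norm_pi.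
apply: EFin_inj; rewrite -powR_mulrn; last by rewrite fine_ge0 ?Lnorm_ge0.
rewrite -poweR_EFin finite_norm_fine poweR_Lnorm// /Rintegral fineK; last first.
  exact: integrable_fin_num (L2fun_mul_integrable _ _).
apply: eq_integral => t _; rewrite /= powR_mulrn// -normrX ger0_norm ?sqr_ge0//.
Qed.

HB.instance Definition _ := NormedModule_isInnerProduct.Build R L2
  L2dotC L2dotDl L2dotZl L2dotxx.

Definition L2_le (x y : L2) :=
  \forall t \ae mu, (repr x : L2fun) t <= (repr y : L2fun) t.

Lemma funrpos_Lfun f : (f : T -> R)^\+ \in Lfun mu 2%:E.
Proof.
have /andP[/[!inE]/= mf ff] := L2fun_Lfun f.
apply/andP; split; rewrite inE/=; first exact: measurable_funrpos.
apply: le_lt_trans ff; rewrite unlock.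
apply: (@gt0_ler_poweR R 2^-1); rewrite ?in_itv/= ?leey ?integral_ge0//.
have mp (u : T -> R) : measurable_fun setT u ->
    measurable_fun setT (fun t => (`|u t| `^ 2)%:E).
  move=> mu_; apply/measurable_EFinP.
  apply: (measurableT_comp (measurable_powR _)); exact: measurableT_comp.
apply: ge0_le_integral => //; [exact/mp/measurable_funrpos|exact: mp|].
move=> t _; rewrite lee_fin; apply: ge0_ler_powR; rewrite ?nnegrE//.
rewrite [leLHS]ger0_norm ?funrpos_ge0// /funrpos.
by rewrite ge_max ler_norm normr_ge0.
Qed.

Definition L2_pos (x : L2) : L2 := \pi_L2 (Lfun_Sub _ (funrpos_Lfun (repr x))).
End L2.

(* [O] open in R^d: classes of Borel functions on R^d, identified when they are
   equal Lebesgue-a.e. on [O], with norm and inner product taken over [O]. *)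
Notation L2_domain oO :=
  (L2 (mrestr (lebesgue_rV _ _) (open_measurable_rV oO))).

Definition borel (V : topologicalType) : set_system V := <<s @open V >>.

Definition separable (V : topologicalType) :=
  exists2 D : set V, countable D & dense D.

Section semigroup.
Context (R : realType) (H : innerProductType R).
Implicit Types (D : set H) (A : H -> H) (S : R -> H -> H).

(* An unbounded operator is a pair [D], [A]; the values of [A] outside of its
   domain [D] are irrelevant. *)
Definition linear_operator D A :=
  D 0 /\ forall k x y, D x -> D y ->
    D (k *: x + y) /\ A (k *: x + y) = k *: A x + A y.

Definition dissipative D A := forall x, D x -> dot (A x) x <= 0.

Definition maximal_dissipative D A :=
  dissipative D A /\
  forall D' A', linear_operator D' A' -> dissipative D' A' ->
    (forall x, D x -> D' x /\ A' x = A x) -> D' `<=` D.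

(* Only the values at times [0 <= s] matter. *)
Record contraction_semigroup S : Prop := {
  semigroup_linear : forall s : R, 0 <= s -> linear (S s) ;
  semigroup0 : forall x, S 0 x = x ;
  semigroupD : forall (s r : R) x, 0 <= s -> 0 <= r ->
    S (s + r) x = S s (S r x) ;
  semigroup_cvg0 : forall x, S h x @[h --> 0^'+] --> x ;
  semigroup_contraction : forall (s : R) x, 0 <= s -> `|S s x| <= `|x| }.

Definition generator D A S := forall x y,
  (D x /\ A x = y) <-> (h^-1 *: (S h x - x)) @[h --> 0^'+] --> y.

End semigroup.

Section bochner.
Context (R : realType) (V : normedModType R).

Record simple_function := SimpleFunction {
  simple_size : nat ;
  simple_set : nat -> set R ;
  simple_value : nat -> V }.

Definition simple_on (a b : R) (p : simple_function) :=
  forall i, (i < simple_size p)%N ->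
  measurable (simple_set p i) /\ simple_set p i `<=` `[a, b]%classic.

Definition simple_eval (p : simple_function) (r : R) : V :=
  \sum_(i < simple_size p) \1_(simple_set p i) r *: simple_value p i.

Definition simple_integral (p : simple_function) : V :=
  \sum_(i < simple_size p)
    fine (lebesgue_measure (simple_set p i)) *: simple_value p i.

(* [g] is Bochner integrable on [a, b] with integral [I]. *)
Definition is_bochner_integral (a b : R) (g : R -> V) (I : V) :=
  exists p : nat -> simple_function,
    [/\ forall n, simple_on a b (p n),
        \forall r \ae lebesgue_measure, r \in `[a, b] ->
          simple_eval (p n) r @[n --> \oo] --> g r,
        (\int[lebesgue_measure]_(r in `[a, b])
          `|g r - simple_eval (p n) r|%:E)%E @[n --> \oo] --> 0%E
      & simple_integral (p n) @[n --> \oo] --> I].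

End bochner.

Section hilbert_schmidt.
Context (R : realType) (Xi : hilbertType R) (H : normedModType R).

Definition orthonormal_basis (B : set Xi) :=
  (forall e f, B e -> B f -> dot e f = (e == f)%:R) /\
  (forall x, (forall e, B e -> dot x e = 0) -> x = 0).

(* A fixed orthonormal basis; the Hilbert-Schmidt norm does not depend on it. *)
Definition onb : set Xi := xget set0 orthonormal_basis.

Definition hs_norm2 (Phi : Xi -> H) : \bar R :=
  \esum_(e in onb) (`|Phi e| ^+ 2)%:E.

Record hs_operator := HSOperator {
  hs_fun :> Xi -> H ;
  hs_linear : linear hs_fun ;
  hs_continuous : continuous hs_fun ;
  hs_finite : (hs_norm2 hs_fun < +oo)%E }.

Definition hs_open : set_system hs_operator := [set U : set hs_operator |
  forall Phi : hs_operator, U Phi ->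
  exists2 e : R, 0 < e & forall Psi : hs_operator,
    (hs_norm2 (fun x => Phi x - Psi x)%R < (e ^+ 2)%:E)%E -> U Psi].

Definition hs_borel : set_system hs_operator := <<s hs_open >>.

End hilbert_schmidt.

(* Processes are curried, [X w s], and only their values at times of the
   interval under consideration matter. *)
Section processes.
Context (R : realType) d (Omega : measurableType d).
Context (F : R -> set_system Omega) (t T : R).

(* The progressively measurable subsets of Omega x [t, T]. *)
Definition prog : set_system (Omega * R) :=
  [set A | A `<=` setT `*` `[t, T]%classic /\
    forall s, t <= s <= T ->
      <<s setT `*` `[t, s]%classic,
          [set B `*` J | B in F s &
             J in [set J : set R | measurable J /\ J `<=` `[t, s]%classic]] >>
        (A `&` (setT `*` `[t, s]%classic))].

Definition prog_measurable (E : Type) (G : set_system E)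
    (f : Omega -> R -> E) :=
  forall U, G U -> prog [set p | t <= p.2 <= T /\ U (f p.1 p.2)].

Definition prog_borel_measurable (H : topologicalType)
    (b : Omega -> R -> H -> H) :=
  forall U, borel U ->
    <<s (setT `*` `[t, T]%classic) `*` setT,
        [set A `*` B | A in prog & B in @borel H] >>
      [set q | t <= q.1.2 <= T /\ U (b q.1.1 q.1.2 q.2)].

End processes.

Section wiener.
Context (R : realType) (Xi : hilbertType R).
Context d (Omega : measurableType d) (P : probability Omega R).
Context (W : R -> Xi -> Omega -> R) (t T : R).

Definition wiener_filtration (s : R) : set_system Omega :=
  <<s [set A | (exists u a (B : set R),
                 [/\ t <= u <= s, measurable B & A = W u a @^-1` B])
               \/ P.-negligible A] >>.

Definition increment (s u : R) (a : Xi) (w : Omega) : R := W u a w - W s a w.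

(* Started at time [t]; [W s a] stands for the formal pairing of [W s]
   with [a]. *)
Record cylindrical_wiener : Prop := {
  wiener_measurable : forall s a, t <= s <= T -> measurable_fun setT (W s a) ;
  wiener_start : forall a, \forall w \ae P, W t a w = 0 ;
  wiener_linear : forall s k a b, t <= s <= T ->
    \forall w \ae P, W s (k *: a + b) w = k * W s a w + W s b w ;
  wiener_continuous : forall a, \forall w \ae P,
    {within `[t, T], continuous (fun s => W s a w)} ;
  wiener_gaussian : forall s u a (B : set R), t <= s -> s < u -> u <= T ->
    a != 0 -> measurable B ->
    P (increment s u a @^-1` B) = normal_prob 0 (Num.sqrt (u - s) * `|a|) B ;
  wiener_independent : forall s u a A (B : set R), t <= s -> s <= u -> u <= T ->
    wiener_filtration s A -> measurable B ->
    P (A `&` increment s u a @^-1` B) =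
      (P A * P (increment s u a @^-1` B))%E }.

End wiener.

Section stochastic_integral.
Context (R : realType) (Xi : hilbertType R) (H : normedModType R).
Context d (Omega : measurableType d) (P : probability Omega R).
Context (W : R -> Xi -> Omega -> R) (t : R).

(* The elementary integrand  sum_i c_i 1_(]s_i, u_i]) <a_i, .> h_i. *)
Record elementary_process := ElementaryProcess {
  elem_size : nat ;
  elem_start : nat -> R ;
  elem_stop : nat -> R ;
  elem_coef : nat -> Omega -> R ;
  elem_dir : nat -> Xi ;
  elem_value : nat -> H }.

Definition elementary_on (s : R) (p : elementary_process) :=
  forall i, (i < elem_size p)%N ->
  [/\ t <= elem_start p i, elem_start p i <= elem_stop p i,
      elem_stop p i <= s,
      exists M, forall w, `|elem_coef p i w| <= M
    & forall B, measurable B ->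
        wiener_filtration P W t (elem_start p i) (elem_coef p i @^-1` B)].

Definition elem_eval (p : elementary_process) (w : Omega) (r : R)
    (x : Xi) : H :=
  \sum_(i < elem_size p | elem_start p i < r <= elem_stop p i)
    (elem_coef p i w * dot (elem_dir p i) x) *: elem_value p i.

Definition elem_integral (p : elementary_process) (w : Omega) : H :=
  \sum_(i < elem_size p)
    (elem_coef p i w *
     increment W (elem_start p i) (elem_stop p i) (elem_dir p i) w)
      *: elem_value p i.

(* Convergence to 0 in probability of nonnegative [Y n]; with the outer
   probability, so that the definition makes sense for all [Y]. *)
Definition cvg_prob0 (Y : nat -> Omega -> \bar R) :=
  forall e : R, 0 < e -> exists N : nat -> set Omega,
    (forall n, measurable (N n) /\ [set w | (e%:E < Y n w)%E] `<=` N n) /\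
    P (N n) @[n --> \oo] --> 0%E.

(* [Z] is (a version of) the Ito integral of [Phi] over [t, s]. *)
Definition is_stochastic_integral (s : R) (Phi : Omega -> R -> Xi -> H)
    (Z : Omega -> H) :=
  (forall U, borel U -> measurable (Z @^-1` U)) /\
  exists p : nat -> elementary_process,
    [/\ forall n, elementary_on s (p n),
        cvg_prob0 (fun n w => \int[lebesgue_measure]_(r in `[t, s])
          hs_norm2 (fun x => Phi w r x - elem_eval (p n) w r x)%R)%E
      & cvg_prob0 (fun n w => `|Z w - elem_integral (p n) w|%:E)].

End stochastic_integral.

Section mild_solution.
Context (R : realType) (Xi : hilbertType R) (H : innerProductType R).
Context d (Omega : measurableType d) (P : probability Omega R).
Context (W : R -> Xi -> Omega -> R) (t T : R) (S : R -> H -> H).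
Context (b : Omega -> R -> H -> H) (sigma : Omega -> R -> hs_operator Xi H).
Context (f : Omega -> R -> H) (x : H).

Definition mild_solution (X : Omega -> R -> H) :=
  prog_measurable (wiener_filtration P W t) t T (@borel H) X /\
  forall s, t <= s <= T ->
    (\forall w \ae P,
      (\int[lebesgue_measure]_(r in `[t, s])
        ((`|X w r| + `|S (s - r) (b w r (X w r) + f w r)|)%:E
         + hs_norm2 (S (s - r)%R \o sigma w r)) < +oo)%E) /\
    exists2 Z : Omega -> H,
      is_stochastic_integral P W t s (fun w r => S (s - r) \o sigma w r) Z &
      \forall w \ae P, exists2 I : H,
        is_bochner_integral t s
          (fun r => S (s - r) (b w r (X w r) + f w r)) I &
        X w s = S (s - t) x + I + Z w.

End mild_solution.

(* Main.v *)
(* Fix s. The two stochastic convolutions agree a.s.: tested against a vector h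
   of a countable dense family, two sequences of elementary integrals whose
   integrands approach the same process have a difference with small energy,
   and stopping this difference when its energy exceeds delta bounds its second
   moment, by orthogonality of the increments of W. Hence X2(s) - X1(s) is
   e^{(s-t)A} (x2 - x1) plus a Bochner integral. Pairing it with
   h = [X2(s) - X1(s)]_+ and using that the semigroup is positive and
   contractive gives, with u(r) = ||[X2(r) - X1(r)]_+||, that a.s.
   u(s) <= C int_t^s u(r) dr. The exceptional null set depends on s, so Fubini
   is used to get the inequality a.s. for almost every s; Gronwall's lemma then
   makes int_t^T u vanish, and the inequality at s gives u(s) = 0.

   The data are measurable only when composed with continuous functionals, and
   the integrals in the definition of a mild solution are a priori integrals of
   functions that need not be measurable, so they are compared as lower
   integrals. *)
From HB Require Import structures.
Require Import Defs.
From mathcomp Require Import finmap.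
From mathcomp Require Import all_boot all_order all_algebra.
From mathcomp Require Import all_classical all_reals all_analysis.
From mathcomp Require Import measurable_realfun.
From mathcomp Require Import lra ring.
Set Implicit Arguments.
Unset Strict Implicit.
Unset Printing Implicit Defensive.
Import Order.TTheory GRing.Theory Num.Theory numFieldNormedType.Exports.
Local Open Scope classical_set_scope.
Local Open Scope ring_scope.

(** The pairing with [h] takes the place of an Ito or chain rule for [||x_+||^2], for which a mild
    solution is not regular enough. It rests on two facts: [dot x x_+ = ||x_+||^2], and
    [dot x h <= dot x_+ h] whenever [h >= 0]. Since [h] is frozen at the end time [s], both can be
    used under the integral sign, behind the operators [S (s - r)].

    The obstacle on the stochastic side is that the integral is only a limit in probability along
    some sequence of elementary processes, and two solutions may come with different sequences. No
    moments of the limits are available, hence the stopping. Testing against one vector turns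
    operator-valued integrands into [Xi]-valued ones, whose energy Parseval's identity compares with
    the Hilbert-Schmidt distance of the two sequences to the common integrand. *)

(* [filterS], [filterS2] and [filterS3] do not unify with the almost everywhere
   filter of [lebesgue_measure]. *)
Lemma aeS d (T : measurableType d) (R : realType) (mu : {measure set T -> \bar R})
  (A B : T -> Prop) : (forall x, A x -> B x) ->
  (\forall x \ae mu, A x) -> \forall x \ae mu, B x.
Proof. exact: filterS. Qed.
Lemma aeS2 d (T : measurableType d) (R : realType) (mu : {measure set T -> \bar R})
  (A B C : T -> Prop) : (forall x, A x -> B x -> C x) ->
  (\forall x \ae mu, A x) -> (\forall x \ae mu, B x) -> \forall x \ae mu, C x.
Proof. exact: filterS2. Qed.
Lemma aeS3 d (T : measurableType d) (R : realType) (mu : {measure set T -> \bar R})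
  (A B C D : T -> Prop) : (forall x, A x -> B x -> C x -> D x) ->
  (\forall x \ae mu, A x) -> (\forall x \ae mu, B x) -> (\forall x \ae mu, C x) ->
  \forall x \ae mu, D x.
Proof. exact: filterS3. Qed.

(** * Inner product spaces *)

Section inner_product.
Context (R : realType) (V : innerProductType R).
Implicit Types (x y z : V).

Lemma dot0l x : dot 0 x = 0.
Proof. by rewrite -(scale0r 0) dotZl mul0r. Qed.
Lemma dot0r x : dot x 0 = 0. Proof. by rewrite dotC dot0l. Qed.
Lemma dotDr x y z : dot x (y + z) = dot x y + dot x z.
Proof. by rewrite dotC dotDl !(dotC x). Qed.
Lemma dotZr k x y : dot x (k *: y) = k * dot x y.
Proof. by rewrite dotC dotZl dotC. Qed.
Lemma dotNl x y : dot (- x) y = - dot x y.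
Proof. by rewrite -scaleN1r dotZl mulN1r. Qed.
Lemma dotNr x y : dot x (- y) = - dot x y.
Proof. by rewrite dotC dotNl dotC. Qed.
Lemma dotBl x y z : dot (x - y) z = dot x z - dot y z.
Proof. by rewrite dotDl dotNl. Qed.
Lemma dotBr x y z : dot x (y - z) = dot x y - dot x z.
Proof. by rewrite dotDr dotNr. Qed.
Lemma dot_suml (I : Type) (r : seq I) (Q : pred I) (F : I -> V) y :
  dot (\sum_(i <- r | Q i) F i) y = \sum_(i <- r | Q i) dot (F i) y.
Proof. by apply: (big_morph (fun z => dot z y)); [by move=> u v; exact: dotDl|exact: dot0l]. Qed.
Lemma dot_sumr (I : Type) (r : seq I) (Q : pred I) (F : I -> V) y :
  dot y (\sum_(i <- r | Q i) F i) = \sum_(i <- r | Q i) dot y (F i).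
Proof. by rewrite dotC dot_suml; apply: eq_bigr => i _; rewrite dotC. Qed.

Lemma dotxx_eq0 x : dot x x = 0 -> x = 0.
Proof. by rewrite dotxx => /eqP; rewrite sqrf_eq0 normr_eq0 => /eqP. Qed.

Lemma dot_normD x y : `|x + y| ^+ 2 = `|x| ^+ 2 + 2 * dot x y + `|y| ^+ 2.
Proof. by rewrite -!dotxx dotDl !dotDr (dotC y x); ring. Qed.

Lemma dot_polar x y : 4 * dot x y = `|x + y| ^+ 2 - `|x - y| ^+ 2.
Proof. by rewrite !dot_normD dotNr normrN; ring. Qed.

Lemma cauchy_schwarz x y : dot x y <= `|x| * `|y|.
Proof.
have [->|y0] := eqVneq y 0; first by rewrite dot0r normr0 mulr0.
have ny : 0 < `|y| by rewrite normr_gt0.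
have [->|x0] := eqVneq x 0; first by rewrite dot0l normr0 mul0r.
have nx : 0 < `|x| by rewrite normr_gt0.
(* Expanded, this square is [2 |x| |y| (|x| |y| - dot x y)], and the first factors are positive
   here. *)
have : 0 <= `| `|y| *: x - `|x| *: y | ^+ 2 by exact: sqr_ge0.
rewrite dot_normD normrN !normrZ !normr_id dotNr dotZl dotZr => h.
have {}h : 0 <= 2 * (`|x| * `|y|) * (`|x| * `|y| - dot x y) by nra.
by rewrite -subr_ge0; move: h; rewrite pmulr_rge0// !mulr_gt0.
Qed.

Lemma cauchy_schwarz_abs x y : `|dot x y| <= `|x| * `|y|.
Proof.
by rewrite ler_norml cauchy_schwarz andbT lerNl -dotNl -(normrN x) cauchy_schwarz.
Qed.

Lemma dot_continuousl y : continuous (fun x => dot x y).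
Proof.
move=> x; apply/cvgrPdist_le => e e0.
have d0 : 0 < e / (`|y| + 1) by rewrite divr_gt0// ltr_wpDl.
near=> z; rewrite -dotBl (le_trans (cauchy_schwarz_abs _ _))//.
apply: (@le_trans _ _ (e / (`|y| + 1) * (`|y| + 1))); last first.
  by rewrite divfK// gt_eqF// ltr_wpDl.
rewrite ler_pM//; last by rewrite lerDl.
Unshelve. all: by end_near. Qed.

Lemma cvg_dotl (I : Type) (F : set_system I) {FF : Filter F} (f : I -> V) x y :
  f @ F --> x -> (fun i => dot (f i) y) @ F --> dot x y.
Proof. by move=> fx; apply: (@cvg_comp _ _ _ f (fun z => dot z y) _ _ _ fx);
  exact: dot_continuousl. Qed.

End inner_product.

(** * Orthonormal bases and Parseval's identity *)

Section onb.
Context (R : realType) (Xi : hilbertType R).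

(** [onb] is picked by [xget], so existence is what has to be shown: Zorn's lemma gives a maximal
    orthonormal set, and it is total because a nonzero vector orthogonal to it could be normalized
    and added. *)
Lemma onb_orthonormal_basis : orthonormal_basis (@onb R Xi).
Proof.
apply: (@xgetPex _ set0 (@orthonormal_basis R Xi)).
pose ortho (B : set Xi) := forall e f, B e -> B f -> dot e f = (e == f)%:R.
have [F FF tF|B [oB maxB]] := @Zorn_bigcup Xi ortho.
  move=> e f [X FX Xe] [Y FY Yf]; have [XY|YX] := tF _ _ FX FY.
    by apply: (FF _ FY) => //; exact: XY.
  by apply: (FF _ FX) => //; exact: YX.
exists B; split => // x xB; apply: contrapT => /eqP x0.
have nx : `|x| != 0 by rewrite normr_eq0.
pose u := `|x|^-1 *: x.
have uu : dot u u = 1.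
  by rewrite dotZl dotZr dotxx expr2 mulKf// mulVf.
have uB e : B e -> dot u e = 0 by move=> Be; rewrite dotZl xB// mulr0.
have nBu : ~ B u by move=> Bu; have := uB _ Bu; rewrite uu => /eqP; rewrite oner_eq0.
apply: (maxB (B `|` [set u])).
  split; first by move=> e Be; left.
  by move=> /(_ u) h; apply/nBu/h; right.
move=> e f [Be|->] [Bf|->].
- exact: oB.
- rewrite dotC uB//; case: eqP => // ef; by move: Be; rewrite ef.
- rewrite uB//; case: eqP => // ef; by move: Bf; rewrite -ef.
- by rewrite uu eqxx.
Qed.

Hypothesis sepXi : separable Xi.

(** Distinct basis vectors are at distance [sqrt 2], so choosing a point of the dense set within
    [1/2] of each one is injective. *)
Lemma countable_onb : countable (@onb R Xi).
Proof.
have [ob _] := onb_orthonormal_basis.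
case: sepXi => D cD dD.
have /(_ _)/cid-/all_sig[f hf] (e : Xi) : exists d, D d /\ ball e (1/2) d.
  have [||d [hd Dd]] := dD (ball e (1/2)).
  - by exists e; apply: ballxx; rewrite divr_gt0.
  - exact: ball_open.
  by exists d.
have finj : {in @onb R Xi &, injective f}.
  move=> e g /set_mem Be /set_mem Bg efg.
  have : `|e - g| < 1.
    have := (hf e).2; have := (hf g).2; rewrite -efg -!ball_normE /= => h1 h2.
    rewrite (_ : e - g = (e - f e) - (g - f e)); last by rewrite opprB addrA subrK.
    rewrite (le_lt_trans (ler_normB _ _))//; lra.
  move=> h; apply/eqP/negP => /negP eg.
  have : `|e - g| ^+ 2 < 1 by rewrite expr_lt1.
  rewrite dot_normD normrN -!dotxx dotNr !ob// (negbTE eg) !eqxx /= mulr0n mulr1n; lra.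
move/countable_injP : cD => [g gi]; apply/countable_injP; exists (g \o f).
move=> e h Be Bh /= gfe; apply: finj => //.
by apply: gi => //; rewrite inE; exact: (hf _).1.
Qed.
End onb.

Section parseval.
Context (R : realType) (Xi : hilbertType R) (sepXi : separable Xi).

(** Indices that code no basis vector get the value [0]. Finite and infinite bases are then both
    handled by series over [nat], and orthogonality is required for distinct indices only. *)
Lemma onb_sequence : exists e : nat -> Xi, [/\
  forall k, e k = 0 \/ onb (e k),
  forall k l, k != l -> dot (e k) (e l) = 0 &
  forall x, onb x -> exists k, e k = x].
Proof.
have [ob _] := @onb_orthonormal_basis R Xi.
have /countable_injP[g gi] := countable_onb sepXi.
pose e k := xget (0 : Xi) [set x | onb x /\ g x = k].
have eP k : e k = 0 \/ (onb (e k) /\ g (e k) = k).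
  by rewrite /e; case: xgetP => [x -> [? ?]|_]; [right|left].
exists e; split.
- by move=> k; have [->|[]] := eP k; [left|right].
- move=> k l kl; have [->|[Bk gk]] := eP k; first by rewrite dot0l.
  have [->|[Bl gl]] := eP l; first by rewrite dot0r.
  rewrite ob//; case: eqP => // ekl.
  by case/eqP: kl; rewrite -gk -gl ekl.
- move=> x Bx; exists (g x).
  have [B1 g1] : onb (e (g x)) /\ g (e (g x)) = g x.
    by rewrite /e; apply: (@xgetPex _ 0 [set y | onb y /\ g y = g x]); exists x.
  by apply: gi; rewrite ?inE.
Qed.

Variable e : nat -> Xi.
Hypothesis e0 : forall k, e k = 0 \/ onb (e k).
Hypothesis eo : forall k l, k != l -> dot (e k) (e l) = 0.
Hypothesis es : forall x, onb x -> exists k, e k = x.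

(** The squared distances between the Fourier partial sums [p n] are the increments of the bounded
    monotone sequence [a], so [p] is Cauchy. Its limit has the same coefficients as [v], hence is
    [v] by totality of the basis. *)
Lemma parseval (v : Xi) :
  (\sum_(k <oo) (dot v (e k) ^+ 2)%:E = (`|v| ^+ 2)%:E)%E.
Proof.
have [ob obm] := @onb_orthonormal_basis R Xi.
pose p n : Xi := \sum_(0 <= k < n) dot v (e k) *: e k.
pose a n := \sum_(0 <= k < n) dot v (e k) ^+ 2.
have ee k : dot v (e k) * dot (e k) (e k) = dot v (e k).
  have [->|B] := e0 k; first by rewrite !dot0r mul0r.
  by rewrite (ob (e k))// eqxx mulr1.
have pe n k : dot (p n) (e k) = if (k < n)%N then dot v (e k) else 0.
  rewrite /p dot_suml; under eq_bigr do rewrite dotZl.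
  case: ltnP => kn; last first.
    rewrite big_nat big1// => i /andP[_ ik]; rewrite eo ?mulr0//.
    by rewrite ltn_eqF// (leq_trans ik).
  rewrite (bigD1_seq k) ?iota_uniq ?mem_index_iota//= ee big1 ?addr0// => i ik.
  by rewrite eo ?mulr0.
have pv n : dot (p n) v = a n.
  by rewrite /p dot_suml; apply: eq_bigr => k _; rewrite dotZl (dotC _ v) expr2.
have pp n m : (n <= m)%N -> dot (p n) (p m) = a n.
  move=> nm; rewrite {1}/p dot_suml /a big_nat [RHS]big_nat.
  apply: eq_bigr => k /andP[_ kn].
  by rewrite dotZl (dotC (e k)) pe (leq_trans kn)// expr2.
have pB n m : (n <= m)%N -> `|p n - p m| ^+ 2 = a m - a n.
  move=> nm; rewrite dot_normD normrN -!dotxx dotNr !pp//; ring.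
have a_le n : a n <= `|v| ^+ 2.
  have : 0 <= `|p n - v| ^+ 2 by exact: sqr_ge0.
  rewrite dot_normD normrN dotNr pv -(dotxx (p n)) pp//; lra.
have a_nd : nondecreasing_seq a.
  apply/nondecreasing_seqP => n; rewrite /a big_nat_recr//= lerDl; exact: sqr_ge0.
have a_cvg : cvgn a.
  by apply: nondecreasing_is_cvgn => //; exists (`|v| ^+ 2) => _ [n _ <-].
have p_cvg : cvgn p.
  apply/cauchy_cvgP/cauchy_exP => eps eps0.
  have /cvgrPdist_lt/(_ (eps ^+ 2)) := a_cvg.
  rewrite exprn_gt0// => /(_ isT)[N _ hN]; exists (p N).
  exists N => // m Nm; rewrite -ball_normE /=.
  suff : `|p N - p m| ^+ 2 < eps ^+ 2 by rewrite ltr_pXn2r ?nnegrE ?normr_ge0 ?(ltW eps0).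
  rewrite pB//; apply: le_lt_trans (hN N (leqnn N)).
  rewrite (le_trans _ (ler_norm _))// lerD2r; exact: nondecreasing_cvgn_le.
have pl k : dot (limn p) (e k) = dot v (e k).
  have h : dot (p i) (e k) @[i --> \oo] --> dot (limn p) (e k) by exact: cvg_dotl.
  rewrite -(cvg_lim _ h)//; apply: cvg_lim => //.
  apply: cvg_near_cst; exists k.+1 => // n /= kn; by rewrite pe kn.
have vl : v = limn p.
  apply/eqP; rewrite -subr_eq0; apply/eqP/obm => x /es[k <-].
  by rewrite dotBl pl subrr.
have av : a @ \oo --> `|v| ^+ 2.
  rewrite -dotxx {1}vl (_ : a = fun n => dot (p n) v); last by apply/funext.
  exact: cvg_dotl.
apply/cvg_lim => //.
rewrite (_ : (fun n => _) = EFin \o a); last first.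
  by apply/funext => n; rewrite /= /a sumEFin.
by apply: cvg_EFin => //; exact: nearW.
Qed.

(** [Phi 0 = 0] makes the padding zeros of the sequence contribute nothing to the series. *)
Lemma hs_norm2E (H : normedModType R) (Phi : Xi -> H) : Phi 0 = 0 ->
  (hs_norm2 Phi = \sum_(k <oo) (`|Phi (e k)| ^+ 2)%:E)%E.
Proof.
move=> P0; have [ob _] := @onb_orthonormal_basis R Xi.
have onbE : @onb R Xi = e @` (fun k => e k != 0).
  apply/seteqP; split=> [x Bx|_ [k ek <-]].
    have [k ekx] := es Bx; exists k => //; rewrite ekx; apply/eqP => x0.
    by have := ob _ _ Bx Bx; rewrite x0 dot0l eqxx => /eqP; rewrite eq_sym oner_eq0.
  by have [/eqP|//] := e0 k; rewrite (negbTE ek).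
rewrite /hs_norm2 onbE esum_pred_image.
- rewrite eseries_mkcond; apply: eq_eseriesr => k _.
  by case: eqP => //= ->; rewrite P0 normr0 expr0n.
- by move=> n _; rewrite lee_fin sqr_ge0.
- move=> k l /set_mem/eqP ek _ ekl; apply: contrapT => /eqP kl.
  by have := eo kl; rewrite -ekl => /dotxx_eq0.
Qed.
End parseval.

(** * The lattice structure of L2 *)

Section L2_order.
Context d (T : measurableType d) (R : realType) (mu : {measure set T -> \bar R}).
Local Notation L2fun := (LfunType mu (@lee1n R 2)).
Local Open Scope quotient_scope.
Implicit Types (x y z : L2 mu).

Definition L2rep x : T -> R := (repr x : L2fun).

Lemma L2repD x y : \forall t \ae mu, L2rep (x + y) t = L2rep x t + L2rep y t.
Proof. by have := repr_piE ((repr x : L2fun) + repr y); rewrite piD !reprK. Qed.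

Lemma L2repZ a x : \forall t \ae mu, L2rep (a *: x) t = a * L2rep x t.
Proof. by have := repr_piE (a *: (repr x : L2fun)); rewrite piZ !reprK. Qed.

Lemma L2repN x : \forall t \ae mu, L2rep (- x) t = - L2rep x t.
Proof.
by have := L2repZ (-1) x; rewrite scaleN1r; apply: filterS => t ->; rewrite mulN1r.
Qed.

Lemma L2repB x y : \forall t \ae mu, L2rep (x - y) t = L2rep x t - L2rep y t.
Proof.
by move: (L2repD x (- y)) (L2repN y); apply: filterS2 => t -> ->.
Qed.

Lemma L2rep0 : \forall t \ae mu, L2rep 0 t = 0.
Proof.
by have := L2repB 0 0; rewrite subrr; apply: filterS => t ->; rewrite subrr.
Qed.

Lemma L2rep_pos x : \forall t \ae mu, L2rep (L2_pos x) t = Num.max (L2rep x t) 0.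
Proof. exact: (repr_piE (Lfun_Sub _ (funrpos_Lfun (repr x)))). Qed.

Lemma L2rep_Lfun x : L2rep x \in Lfun mu 2%:E. Proof. exact: LfunP. Qed.

Lemma measurable_L2rep x : measurable_fun setT (L2rep x).
Proof. by have /andP[/[!inE]/= ] := L2rep_Lfun x. Qed.

Lemma L2dotE x y : dot x y = \int[mu]_t (L2rep x t * L2rep y t).
Proof. by []. Qed.

Lemma L2mul_integrable x y :
  mu.-integrable setT (EFin \o (fun t => L2rep x t * L2rep y t)).
Proof. exact: L2fun_mul_integrable. Qed.

Lemma L2_leE x y : L2_le x y = \forall t \ae mu, L2rep x t <= L2rep y t.
Proof. by []. Qed.

Lemma L2_leB x y : L2_le x y <-> L2_le 0 (y - x).
Proof.
rewrite !L2_leE; split=> h; move: h (L2repB y x) L2rep0; apply: filterS3 => t;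
  by move=> + h1 h2; rewrite h1 h2 subr_ge0.
Qed.

Lemma L2_ge0N x : L2_le x 0 <-> L2_le 0 (- x).
Proof. by rewrite L2_leB sub0r. Qed.

Lemma L2_ge0D x y : L2_le 0 x -> L2_le 0 y -> L2_le 0 (x + y).
Proof.
rewrite !L2_leE => hx hy.
apply: (filterS3 _ _ hx hy (filterI (L2repD x y) L2rep0)).
by move=> t h1 h2 [-> h3]; move: h1 h2; rewrite h3; exact: addr_ge0.
Qed.

Lemma L2_pos_ge0 x : L2_le 0 (L2_pos x).
Proof.
rewrite L2_leE; move: (L2rep_pos x) L2rep0; apply: filterS2 => t -> ->.
by rewrite le_max lexx orbT.
Qed.

Lemma L2_pos_subr_ge0 x : L2_le 0 (L2_pos x - x).
Proof.
apply: (iffLR (L2_leB x (L2_pos x))); rewrite L2_leE.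
by apply: filterS (L2rep_pos x) => t ->; rewrite le_max lexx.
Qed.

Lemma L2dot_ge0 x y : L2_le 0 x -> L2_le 0 y -> 0 <= dot x y.
Proof.
rewrite !L2_leE => hx hy; rewrite L2dotE /Rintegral fine_ge0//.
rewrite (@ae_eq_integral _ _ _ mu _ (fun t => `|L2rep x t * L2rep y t|%:E))//.
- by apply: integral_ge0 => t _; rewrite lee_fin.
- exact: measurable_int (L2mul_integrable _ _).
- apply/measurable_EFinP; apply: measurableT_comp => //.
  by apply: measurable_funM; exact: measurable_L2rep.
- move: hx hy L2rep0; apply: filterS3 => t.
  by move=> + + h _ /=; rewrite h => h1 h2; rewrite ger0_norm// mulr_ge0.
Qed.

(** Pointwise [x x_+ = x_+^2]. This identity turns a pairing with the positive part into the norm to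
    be estimated. *)
Lemma L2dot_pos x : dot x (L2_pos x) = `|L2_pos x| ^+ 2.
Proof.
rewrite -dotxx !L2dotE /Rintegral; congr fine; apply: ae_eq_integral => //.
- exact: measurable_int (L2mul_integrable _ _).
- exact: measurable_int (L2mul_integrable _ _).
- apply: filterS (L2rep_pos x) => t -> _ /=; congr EFin.
  by rewrite maxEle; case: ifP => _; rewrite ?mulr0 ?mul0r.
Qed.

Lemma L2_pos_eq0 x : `|L2_pos x| = 0 <-> L2_le x 0.
Proof.
split=> [/eqP|h].
  rewrite normr_eq0 => /eqP x0; apply/L2_ge0N.
  by have := L2_pos_subr_ge0 x; rewrite x0 sub0r.
apply/eqP; rewrite -sqrf_eq0 -L2dot_pos L2dotE; apply/eqP.
rewrite /Rintegral (@ae_eq_integral _ _ _ mu _ (cst 0%E))//.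
- by rewrite integral0.
- exact: measurable_int (L2mul_integrable _ _).
- move: h (L2rep_pos x) L2rep0; rewrite L2_leE; apply: filterS3 => t.
  by move=> + -> h _ /=; rewrite h => x0; rewrite max_r// mulr0.
Qed.

Lemma L2_pos_norm_le x : `|L2_pos x| <= `|x|.
Proof.
have [->|h] := eqVneq (L2_pos x) 0; first by rewrite normr0.
rewrite -(ler_pM2r (x := `|L2_pos x|)) ?normr_gt0// -expr2 -L2dot_pos.
exact: cauchy_schwarz.
Qed.

Lemma L2_pos_le_dot x y : L2_le 0 y -> dot x y <= dot (L2_pos x) y.
Proof.
by move=> y0; rewrite -subr_ge0 -dotBl; apply: L2dot_ge0 => //; exact: L2_pos_subr_ge0.
Qed.

(** Write [|x_+|^2 = dot x x_+], split [x] as [(x - y) + y], and replace [y] by [y_+]. The symmetric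
    form below is the Lipschitz property behind the measurability of [|(X2 - X1)_+|]. *)
Lemma L2_pos_norm_leD x y : `|L2_pos x| <= `|L2_pos y| + `|x - y|.
Proof.
have [->|h] := eqVneq (L2_pos x) 0; first by rewrite normr0 addr_ge0.
rewrite -(ler_pM2r (x := `|L2_pos x|)) ?normr_gt0// -expr2 -L2dot_pos.
rewrite -[x in dot x _](subrK y) dotDl mulrDl addrC lerD ?cauchy_schwarz//.
exact/(le_trans (L2_pos_le_dot _ (L2_pos_ge0 _)))/cauchy_schwarz.
Qed.

Lemma L2_pos_norm_dist x y : `| `|L2_pos x| - `|L2_pos y| | <= `|x - y|.
Proof.
have h1 := L2_pos_norm_leD x y; have := L2_pos_norm_leD y x.
by rewrite distrC ler_norml => h2; apply/andP; split; lra.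
Qed.

End L2_order.

(** * Separability of L2 *)

Section L2_of.
Context d (T : measurableType d) (R : realType) (mu : {measure set T -> \bar R}).
Local Open Scope quotient_scope.
Implicit Types (x y z : L2 mu) (f g : T -> R).

Lemma Lfun2_sqr_lty f : measurable_fun setT f ->
  (\int[mu]_t (f t ^+ 2)%:E < +oo)%E -> f \in Lfun mu 2%:E.
Proof.
move=> mf foo; rewrite inE; apply/andP; split; rewrite inE//=.
rewrite /finite_norm unlock poweR_lty//.
rewrite (eq_integral (fun t => (f t ^+ 2)%:E))// => t _ /=.
by rewrite powR_mulrn// -normrX ger0_norm ?sqr_ge0.
Qed.

Definition L2_of f : L2 mu :=
  if pselect (f \in Lfun mu 2%:E) is left fL then \pi_(L2 mu) (Lfun_Sub (@lee1n R 2) fL)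
  else 0.

Lemma L2rep_of f : f \in Lfun mu 2%:E -> \forall t \ae mu, L2rep (L2_of f) t = f t.
Proof. by move=> fL; rewrite /L2_of; case: pselect => // fL'; exact: repr_piE. Qed.

Lemma L2_ae_eq x y : (\forall t \ae mu, L2rep x t = L2rep y t) -> x = y.
Proof.
move=> xy; rewrite -[x]reprK -[y]reprK; apply/eqP/L2_eqP; exact: xy.
Qed.

Lemma L2_norm2E x f : measurable_fun setT f -> (\forall t \ae mu, L2rep x t = f t) ->
  (`|x| ^+ 2)%:E = (\int[mu]_t (f t ^+ 2)%:E)%E.
Proof.
move=> mf xf; rewrite -dotxx L2dotE /Rintegral fineK; last first.
  exact: integrable_fin_num (L2mul_integrable _ _).
apply: ae_eq_integral => //.
- exact: measurable_int (L2mul_integrable _ _).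
- by apply/measurable_EFinP; exact: measurable_funX.
- by apply: filterS xf => t -> _; rewrite /= expr2.
Qed.

Lemma L2_pos_subN x : x = L2_pos x - L2_pos (- x).
Proof.
apply: L2_ae_eq.
apply: (filterS3 _ _ (filterI (L2rep_pos x) (L2rep_pos (- x))) (L2repN x)
  (L2repB (L2_pos x) (L2_pos (- x)))) => t [h1 h2] h3 ->.
rewrite h1 h2 h3; case/orP: (le_total (L2rep x t) 0) => h4.
  by rewrite max_r// max_l ?oppr_ge0// sub0r opprK.
by rewrite max_l// max_r ?subr0// oppr_le0.
Qed.

End L2_of.

Import HBNNSimple.

Section L2_separable.
Context d (T : measurableType d) (R : realType) (mu : {measure set T -> \bar R}).
Context (I : countType) (G : I -> set T) (E : nat -> set T).
Hypotheses (GE : @measurable _ T = <<s range G >>) (GI : setI_closed (range G))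
  (GT : range G setT).
Hypotheses (mE : forall n, measurable (E n)) (ndE : nondecreasing_seq E)
  (UE : \bigcup_n E n = setT) (Eoo : forall n, (mu (E n) < +oo)%E).
Implicit Types (x y z : L2 mu).

Let gen (p : I * nat) : L2 mu := L2_of mu \1_(G p.1 `&` E p.2).
Let comb (l : seq (rat * (I * nat))) : L2 mu := \sum_(q <- l) ratr q.1 *: gen q.2.
(** Closure of the countable set of rational combinations of the indicators [gen]. It is shown to be
    a closed real subspace, and then to contain all indicators of sets cut by some [E n], all
    positive parts, and finally everything. *)
Let K x := forall e : R, 0 < e -> exists l, `|x - comb l| < e.

Let comb_cat l l' : comb (l ++ l') = comb l + comb l'.
Proof. by rewrite /comb big_cat. Qed.

Let combZ (q : rat) l : comb [seq (q * p.1, p.2) | p <- l] = ratr q *: comb l.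
Proof.
by rewrite /comb big_map scaler_sumr; apply: eq_bigr => p _; rewrite rmorphM/= scalerA.
Qed.

Let KD x y : K x -> K y -> K (x + y).
Proof.
move=> Kx Ky e e0; have e20 : 0 < e / 2 by rewrite divr_gt0.
have [l hl] := Kx _ e20; have [l' hl'] := Ky _ e20; exists (l ++ l').
rewrite comb_cat opprD addrACA (le_lt_trans (ler_normD _ _))//.
by rewrite [ltRHS]splitr ltrD.
Qed.

Let K0 : K 0.
Proof. by move=> e e0; exists nil; rewrite /comb big_nil subrr normr0. Qed.

Let KZ a x : K x -> K (a *: x).
Proof.
move=> Kx e e0.
have [->|a0] := eqVneq a 0; first by rewrite scale0r; exact: K0.
have [l hl] := Kx (e / 2 / (2 * `|a|)) ltac:(by rewrite !divr_gt0// mulr_gt0 ?normr_gt0).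
have c1 : 0 < `|comb l| + 1 by rewrite ltr_wpDl.
(* Replacing [a] by a rational within [dl] costs at most [dl * |comb l| <= e / 2]; the [+ 1] keeps
   the divisor positive. *)
pose dl := Num.min (e / 2 / (`|comb l| + 1)) `|a|.
have dl0 : 0 < dl by rewrite lt_min !divr_gt0//= normr_gt0.
have [q] : exists q : rat, a < ratr q < a + dl.
  have /rat_in_itvoo[q /itvP hq] : a < a + dl by rewrite ltrDl.
  by exists q; rewrite !hq.
move=> /andP[q1 q2]; exists [seq (q * p.1, p.2) | p <- l]; rewrite combZ.
rewrite (_ : _ - _ = a *: (x - comb l) + (a - ratr q) *: comb l); last first.
  by rewrite scalerBr scalerBl addrA subrK.
rewrite (le_lt_trans (ler_normD _ _))// [ltRHS]splitr !normrZ; apply: ltr_leD.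
  rewrite -ltr_pdivlMl ?normr_gt0// mulrC (lt_le_trans hl)//.
  rewrite ler_pM2l ?divr_gt0// lef_pV2 ?posrE ?mulr_gt0 ?normr_gt0//.
  by rewrite ler_peMl// ler1n.
rewrite distrC gtr0_norm ?subr_gt0//.
apply: (@le_trans _ _ (dl * (`|comb l| + 1))).
  by rewrite ler_pM ?subr_ge0 ?(ltW q1)// ?lerDl// lerBlDl ltW.
by rewrite -ler_pdivlMr// /dl ge_min lexx.
Qed.

Let KB x y : K x -> K y -> K (x - y).
Proof. by move=> Kx Ky; apply: KD => //; rewrite -scaleN1r; exact: KZ. Qed.

Let K_sum (J : Type) (s : seq J) (F : J -> L2 mu) :
  (forall j, K (F j)) -> K (\sum_(j <- s) F j).
Proof. by move=> KF; elim/big_ind : _. Qed.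

Let K_lim x (y : nat -> L2 mu) : (forall n, K (y n)) ->
  (fun n => (`|x - y n| ^+ 2)%:E) @ \oo --> 0%E -> K x.
Proof.
move=> Ky /fine_cvgP[_ /cvgrPdist_lt xy] e e0.
have e20 : 0 < e / 2 by rewrite divr_gt0.
have [N _ /(_ N (leqnn N))] := xy ((e / 2) ^+ 2) (exprn_gt0 2 e20).
rewrite /= sub0r normrN ger0_norm ?sqr_ge0// => hN.
have {}hN : `|x - y N| < e / 2.
  by move: hN; rewrite ltr_pXn2r ?nnegrE ?normr_ge0 ?(ltW e20).
have [l hl] := Ky N _ e20; exists l.
rewrite (_ : x - _ = (x - y N) + (y N - comb l)); last by rewrite addrA subrK.
by rewrite (le_lt_trans (ler_normD _ _))// [ltRHS]splitr ltrD.
Qed.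

(** Dominated convergence for the squared differences, which is why the integrable majorant [g]
    bounds squares. *)
Let K_dominated x (y : nat -> L2 mu) (f g : T -> R) (h : nat -> T -> R) :
  (forall n, K (y n)) ->
  measurable_fun setT f -> (forall n, measurable_fun setT (h n)) ->
  (\forall t \ae mu, L2rep x t = f t) ->
  (forall n, \forall t \ae mu, L2rep (y n) t = h n t) ->
  (forall t, h n t @[n --> \oo] --> f t) ->
  (forall n t, (f t - h n t) ^+ 2 <= g t) -> mu.-integrable setT (EFin \o g) ->
  K x.
Proof.
move=> Ky mf mh xf yh hf hg ig; apply: (K_lim Ky).
have mfh n : measurable_fun setT (fun t => f t - h n t) by exact: measurable_funB.
rewrite (_ : (fun n => _) = fun n => \int[mu]_t ((f t - h n t) ^+ 2)%:E)%E; last first.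
  apply/funext => n; apply: L2_norm2E => //.
  move: (L2repB x (y n)) xf (yh n); apply: filterS3 => t -> -> ->; by [].
rewrite -[X in _ --> X](@integral0 _ _ _ mu setT).
apply: (@dominated_cvg _ _ _ mu setT measurableT _ _ (EFin \o g)) => //.
- by move=> n; apply/measurable_EFinP; exact: measurable_funX.
- move=> t _; apply: cvg_EFin; first exact: nearW.
  rewrite (_ : 0 = (f t - f t) ^+ 2); last by rewrite subrr expr0n.
  rewrite (_ : fine \o _ = fun n => (f t - h n t) * (f t - h n t)); last first.
    by apply/funext => n /=; rewrite expr2.
  by rewrite expr2; apply: cvgM; apply: cvgB => //; exact: cvg_cst.
- by move=> n t _; rewrite gee0_abs ?lee_fin ?sqr_ge0// hg.
Qed.

Let ind_Lfun (A : set T) n : measurable A ->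
  (\1_(A `&` E n) : T -> R) \in Lfun mu 2%:E.
Proof.
move=> mA; apply: Lfun2_sqr_lty; first by apply: measurable_indic; exact: measurableI.
rewrite (eq_integral (fun t => (\1_(A `&` E n) t)%:E)); last first.
  by move=> t _; rewrite expr2 indicE; case: (_ \in _); rewrite ?mulr1 ?mulr0.
rewrite integral_indic ?setIT//; last exact: measurableI.
rewrite (le_lt_trans _ (Eoo n))// le_measure ?inE//; exact: measurableI.
Qed.

Let mG i : measurable (G i).
Proof. by rewrite GE; apply: sub_sigma_algebra; exists i. Qed.

(** Monotone class argument: the good sets form a lambda system containing the generating pi-system
    [range G]. Cutting by [E n] keeps every indicator square integrable, including that of the whole
    space. *)
Let K_ind n : forall A : set T, measurable A -> K (L2_of mu \1_(A `&` E n)).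
Proof.
suff h : <<s range G >> `<=` [set A | measurable A /\ K (L2_of mu \1_(A `&` E n))].
  by move=> A; rewrite {1}GE => /h[].
have rG i : K (L2_of mu \1_(G i `&` E n)).
  move=> e e0; exists [:: (1, (i, n))].
  by rewrite /comb big_seq1 /= rmorph1 scale1r subrr normr0.
apply: lambda_system_subset => //; last first.
  by move=> _ [i _ <-]; split.
split=> //.
- by split=> //; case: GT => i _ <-.
- move=> A B AB [mA KA] [mB KB']; split; first exact: measurableD.
  rewrite (_ : L2_of mu _ = L2_of mu \1_(A `&` E n) - L2_of mu \1_(B `&` E n)); first exact: KB.
  apply: L2_ae_eq.
  apply: (filterS3 _ _ (L2rep_of (ind_Lfun n mA))
    (filterI (L2rep_of (ind_Lfun n mB)) (L2rep_of (ind_Lfun n (measurableD mA mB))))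
    (L2repB (L2_of mu \1_(A `&` E n)) (L2_of mu \1_(B `&` E n)))) => t.
  move=> h1 [h2 ->] ->; rewrite h1 h2 !indicE in_setI in_setD !in_setI.
  have : t \in B -> t \in A by move=> /set_mem/AB/mem_set.
  by case: (t \in A) => /=; case: (t \in B) => /=;
    case: (t \in E n) => //= h; rewrite ?subrr ?subr0//; have := h isT.
- move=> F ndF PF; split; first by apply: bigcup_measurable => k _; exact: (PF k).1.
  have mUF : measurable (\bigcup_k F k) by apply: bigcup_measurable => k _; exact: (PF k).1.
  have mi (A : set T) : measurable A -> measurable_fun setT (\1_(A `&` E n) : T -> R).
    by move=> mA; apply: measurable_indic; exact: measurableI.
  apply: (@K_dominated _ (fun k => L2_of mu \1_(F k `&` E n)) _ (\1_(setT `&` E n))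
    (fun k => \1_(F k `&` E n)) _ (mi _ mUF) _ (L2rep_of (ind_Lfun n mUF))) => //.
  + by move=> k; exact: (PF k).2.
  + by move=> k; apply: mi; exact: (PF k).1.
  + by move=> k; apply: L2rep_of; apply: ind_Lfun; exact: (PF k).1.
  + move=> t; apply: cvg_near_cst.
    have [[k _ Fkt]|nF] := pselect ((\bigcup_k F k) t).
      exists k => // m /= km; rewrite !indicE !in_setI; congr ((_ && _)%:R).
      have /subsetPset := ndF _ _ km; move=> /(_ t Fkt) Fmt.
      by rewrite !mem_set//; exists k.
    apply: nearW => m; rewrite !indicE !in_setI; congr ((_ && _)%:R).
    by rewrite !memNset// => Fm; apply: nF; exists m.
  + move=> k t; rewrite !indicE !in_setI in_setT /=.
    have [Fk|nF] := boolP (t \in F k); last first.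
      by case: (_ \in _); case: (t \in E n) => /=; rewrite ?subrr ?subr0 ?expr0n ?expr1n.
    by rewrite (mem_set (_ : (\bigcup_k F k) t)) ?subrr ?expr0n//; exists k => //; exact: set_mem.
  + apply/integrableP; split.
      by apply/measurable_EFinP; exact: mi.
    under eq_integral => t _ do rewrite /= ger0_norm//.
    rewrite integral_indic ?setIT ?setTI//.
Qed.

Let L2_of_sum (s : seq R) (F : R -> set T) n : (forall r, measurable (F r)) ->
  \forall t \ae mu, L2rep (\sum_(r <- s) r *: L2_of mu \1_(F r `&` E n)) t =
    \sum_(r <- s) r * \1_(F r `&` E n) t.
Proof.
move=> mF; elim: s => [|r s IH].
  by rewrite big_nil; apply: filterS (L2rep0 mu) => t ->; rewrite big_nil.
rewrite big_cons.
apply: (filterS3 _ _ IH (filterI (L2rep_of (ind_Lfun n (mF r)))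
   (L2repZ r (L2_of mu \1_(F r `&` E n))))
   (L2repD (r *: L2_of mu \1_(F r `&` E n))
     (\sum_(r <- s) r *: L2_of mu \1_(F r `&` E n)))) => t.
by move=> h1 [h2 h3] ->; rewrite h1 h3 h2 big_cons.
Qed.

Let K_all x : K x.
Proof.
suff Kpos y : K (L2_pos y) by rewrite (L2_pos_subN x); exact: KB.
pose f t := Num.max (L2rep y t) 0.
have f0 t : 0 <= f t by rewrite /f le_max lexx orbT.
have mf : measurable_fun setT f.
  by apply: measurable_maxr => //; exact: measurable_L2rep.
have mEf : measurable_fun setT (EFin \o f) by apply/measurable_EFinP.
pose s := nnsfun_approx measurableT mEf.
have sf t : s n t @[n --> \oo] --> f t.
  have := @cvg_nnsfun_approx _ _ _ _ measurableT _ mEf (fun t _ => f0 t) t Logic.I.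
  by move=> /fine_cvgP[].
have s_le n t : s n t <= f t.
  have h : nondecreasing_seq (s ^~ t).
    by move=> m k mk; have /lefP := nd_nnsfun_approx measurableT mEf mk; exact.
  rewrite -(cvg_lim _ (sf t))//; apply: nondecreasing_cvgn_le => //.
  by apply/cvg_ex; exists (f t); exact: sf.
pose A n (r : R) := s n @^-1` [set r].
have mA n r : measurable (A n r) by exact: measurable_sfunP.
pose z n := \sum_(r <- fset_set (range (s n))) r *: L2_of mu \1_(A n r `&` E n).
have sE n t : \sum_(r <- fset_set (range (s n))) r * \1_(A n r `&` E n) t =
    s n t * \1_(E n) t.
  have fin : finite_set (range (s n)) by exact: fimfunP.
  have st : s n t \in fset_set (range (s n)).
    by rewrite in_fset_set// inE; exists t.
  rewrite (bigD1_seq (s n t) st (fset_uniq _))/=.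
  rewrite big1 ?addr0 => [|r rs].
    rewrite !indicE in_setI [t \in A _ _]mem_set//.
  by rewrite indicE in_setI memNset ?mulr0// /A /= => /esym/eqP; apply/negP.
(* The factor [\1_(E n)] makes the simple approximations square integrable; they still converge
   since the [E n] exhaust the space. They lie between [0] and [f], so the squared error is at most
   [f ^+ 2]. *)
apply: (@K_dominated _ z f (fun t => f t ^+ 2) (fun n t => s n t * \1_(E n) t)).
- by move=> n; apply: K_sum => r; apply: KZ; exact: K_ind.
- exact: mf.
- by move=> n; apply: measurable_funM => //; exact: measurable_indic.
- exact: L2rep_pos.
- by move=> n; apply: filterS (L2_of_sum (fset_set (range (s n))) n (mA n)) => t ->; exact: sE.
- move=> t; rewrite -[X in _ --> X]mulr1; apply: cvgM; first exact: sf.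
  have [k _ Ek] : (\bigcup_n E n) t by rewrite UE.
  apply: cvg_near_cst; exists k => // m /= km; rewrite indicE mem_set//.
  by have /subsetPset := ndE km; exact.
- move=> n t; rewrite ler_pXn2r ?nnegrE ?subr_ge0// ?lerBlDl ?lerDr ?mulr_ge0//.
  by rewrite (le_trans _ (s_le n t))// indicE; case: (_ \in _); rewrite ?mulr1 ?mulr0.
- have := Lfun2_integrable_sqr (L2rep_Lfun (L2_pos y)).
  rewrite /comp => iy; apply/integrableP; split.
    by apply/measurable_EFinP; exact: measurable_funX.
  move/integrableP : iy => [my]; apply: le_lt_trans; rewrite le_eqVlt; apply/orP; left.
  apply/eqP/ae_eq_integral => //.
  + by apply: measurableT_comp => //; apply/measurable_EFinP; exact: measurable_funX.
  + by apply: measurableT_comp.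
  + by apply: filterS (L2rep_pos y) => t /= -> _.
Qed.

Theorem L2_separable : exists D : nat -> L2 mu,
  forall x (e : R), 0 < e -> exists n, `|x - D n| < e.
Proof.
exists (fun n => if unpickle n is Some l then comb l else 0) => x e e0.
have [l hl] := K_all x e0; exists (pickle l); by rewrite pickleK.
Qed.

End L2_separable.

Section rV_generators.
Context (R : realType) (n : nat).

(** Indexing by a list of constraints rather than by a corner makes the family countable and stable
    under intersection, which is concatenation; the empty list gives the whole space. *)
Definition rat_orthant (l : seq ('I_n * rat)) : set 'rV[R]_n :=
  [set x | all (fun p => ratr p.2 < x ord0 p.1) l].

Lemma rat_orthantI : setI_closed (range rat_orthant).
Proof.
move=> _ _ [l _ <-] [l' _ <-]; exists (l ++ l') => //.
apply/seteqP; split=> x; rewrite /rat_orthant /= all_cat; first by move=> /andP.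
by move=> [-> ->].
Qed.

Lemma rat_orthant_measurable l : measurable (rat_orthant l).
Proof.
elim: l => [|p l IH].
  by rewrite (_ : rat_orthant _ = setT)//; apply/seteqP; split.
rewrite (_ : rat_orthant _ = (fun x : 'rV[R]_n => x ord0 p.1) @^-1` `]ratr p.2, +oo[%classic
   `&` rat_orthant l); last first.
  apply/seteqP; split=> x /=; rewrite /rat_orthant /= in_itv/= andbT.
    by move=> /andP.
  by move=> [-> ->].
by apply: measurableI => //; rewrite -[X in measurable X]setTI; exact: measurable_coord.
Qed.

Lemma measurable_rat_orthant :
  @measurable _ 'rV[R]_n = <<s range rat_orthant >>.
Proof.
apply/seteqP; split; last first.
  apply: smallest_sub; last by move=> _ [l _ <-]; exact: rat_orthant_measurable.
  by split; [exact: measurable0|by move=> A mA; rewrite setTD; exact: measurableC|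
    move=> F mF; exact: bigcupT_measurable].
apply: smallest_sub; first exact: smallest_sigma_algebra.
move=> _ [i [B [mB ->]]].
have [s0 sC sU] := smallest_sigma_algebra setT (range rat_orthant).
have {mB} : (@RGenOInfty.G R).-sigma.-measurable B.
  by rewrite -RGenOInfty.measurableE; exact: mB.
move: B; apply: smallest_sub.
  split.
  - by rewrite /= preimage_set0; exact: s0.
  - by move=> A mA; rewrite /= setTD preimage_setC -setTD; exact: sC.
  - by move=> F mF; rewrite /= preimage_bigcup; exact: sU.
move=> _ [a ->] /=.
(* A coordinate exceeds [a] exactly when it exceeds some rational [q > a]; codes of no such rational
   contribute the empty set. *)
pose F (k : nat) : set 'rV[R]_n := if unpickle k is Some q then
  if a < ratr q then rat_orthant [:: (i, q)] else set0 else set0.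
rewrite (_ : _ @^-1` _ = \bigcup_k F k).
  apply: sU => k; rewrite /F; case: unpickle => [q|]; last exact: s0.
  by case: ifP => _; [apply: sub_sigma_algebra; exists [:: (i, q)]|exact: s0].
apply/seteqP; split=> x /=.
  rewrite in_itv /= andbT => /rat_in_itvoo[q /itvP hq].
  exists (pickle q); first by [].
  rewrite /F pickleK ifT ?hq// /rat_orthant.
  by apply/andP; rewrite hq.
move=> [k _]; rewrite /F; case: unpickle => [q|//]; case: ifP => // aq.
by rewrite /rat_orthant /= andbT in_itv/= andbT; exact: lt_trans.
Qed.

End rV_generators.

Lemma L2_domain_separable (R : realType) (d : nat) (O : set 'rV[R]_d) (oO : open O) :
  exists D : nat -> L2_domain oO,
  forall x (e : R), 0 < e -> exists n, `|x - D n| < e.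
Proof.
have /sigma_finiteP[E [UE ndE Eoo]] := sigma_finiteT (lebesgue_rV R d).
apply: (@L2_separable _ _ R _ _ (@rat_orthant R d) E) => //.
- exact: measurable_rat_orthant.
- exact: rat_orthantI.
- by exists nil => //; apply/seteqP; split.
- by move=> n; have [] := Eoo n.
- move=> n; have [mE] := Eoo n; apply: le_lt_trans.
  have mEO := measurableI _ _ mE (open_measurable_rV oO).
  exact: (le_measure (lebesgue_rV R d) (mem_set mEO) (mem_set mE) (@subIsetl _ _ _)).
Qed.

(** * Measurability of processes *)

Section product_measurability.
Context (R : realType) d (Omega : measurableType d) (P : probability Omega R).

(** Completeness of [P] makes the negligible generators measurable. *)
Lemma wiener_filtration_sub_measurable (Xi : hilbertType R)
    (W : R -> Xi -> Omega -> R) t s : measure_is_complete P ->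
  (forall u a, t <= u <= s -> measurable_fun setT (W u a)) ->
  wiener_filtration P W t s `<=` measurable.
Proof.
move=> cP mW; apply: smallest_sub.
  split; [exact: measurable0|by move=> A mA; rewrite setTD; exact: measurableC|
    by move=> F mF; exact: bigcupT_measurable].
move=> A [[u [a [B [tus mB ->]]]]|]; last exact: cP.
by rewrite -[X in measurable X]setTI; exact: mW.
Qed.

(** At the final time [s = T], progressive measurability is joint measurability on [Omega x
    [t, T]]. *)
Lemma prog_sub_measurable (F : R -> set_system Omega) t T : t <= T ->
  F T `<=` measurable -> prog F t T `<=` measurable.
Proof.
move=> tT FT A [Asub hA].
have := hA T; rewrite tT lexx => /(_ isT).
rewrite (_ : A `&` _ = A); last exact/setIidl.
move: A {Asub hA}.
have mD : measurable ([set: Omega] `*` `[t, T]%classic) by exact: measurableX.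
apply: smallest_sub.
  split; [exact: measurable0|by move=> A mA; exact: measurableD|
    by move=> G mG; exact: bigcupT_measurable].
by move=> _ [B FB [J [mJ _] <-]]; apply: measurableX => //; exact: FT.
Qed.

End product_measurability.

Section separable_measurability.
Context (R : realType) (V : normedModType R) (D : nat -> V).
Hypothesis dD : forall x (e : R), 0 < e -> exists n, `|x - D n| < e.
Context d (T : measurableType d) (E : set T) (X Y : T -> V) (phi : V -> V -> R).
Hypothesis lip : forall x x' y y',
  `|phi x y - phi x' y'| <= `|x - x'| + `|y - y'|.
Hypothesis mX : forall U, open U -> measurable (E `&` X @^-1` U).
Hypothesis mY : forall U, open U -> measurable (E `&` Y @^-1` U).

(** [X] and [Y] are measurable only separately, through open sets of [V]. By separability,
    [phi (X, Y) > a] is a countable union of conditions that [X] and [Y] lie in small balls around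
    two points of [D]. *)
Lemma measurable_fun_lipschitz2 : measurable_fun E (fun w => phi (X w) (Y w)).
Proof.
move=> mE; apply: (measurability _ (RGenOInfty.measurableE R)) => //.
move=> _ [_ [a ->] <-].
pose N k : R := k.+1%:R^-1.
have N0 k : 0 < N k by rewrite invr_gt0.
(* The margin [2 * N k] is what the Lipschitz bound can lose over two balls of radius [N k]. *)
pose B (p : nat * nat * nat) : set T :=
  if a + 2 * N p.2 < phi (D p.1.1) (D p.1.2) then
    (E `&` X @^-1` ball (D p.1.1) (N p.2)) `&` (E `&` Y @^-1` ball (D p.1.2) (N p.2))
  else set0.
have mB p : measurable (B p).
  rewrite /B; case: ifP => // _.
  by apply: measurableI; [apply: mX|apply: mY]; exact: ball_open.
rewrite (_ : _ `&` _ = \bigcup_(p in setT) B p).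
  exact: countable_bigcupT_measurable.
apply/seteqP; split=> [w [Ew /=]|w [[[n m] k] _]].
- rewrite in_itv/= andbT => aw.
  (* A quarter of the gap: passing to the centres loses less than [2 * N k], and a margin [2 * N k]
     must remain. *)
  have c0 : 0 < (phi (X w) (Y w) - a) / 4 by rewrite divr_gt0// subr_gt0.
  have /cvgrPdist_lt/(_ _ c0)[k _ hk] := @cvg_harmonic R.
  have {hk} := hk k (leqnn k); rewrite /harmonic /= sub0r normrN ger0_norm ?(ltW (N0 k))// => hk.
  have [n hn] := dD (X w) (N0 k); have [m hm] := dD (Y w) (N0 k).
  exists (n, m, k) => //; rewrite /B /=.
  have := lip (X w) (D n) (Y w) (D m); rewrite ler_norml => /andP[_ h].
  rewrite (_ : _ < _ = true); last by move: hn hm hk h; rewrite -/(N k); lra.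
  by split; split=> //=; rewrite -ball_normE /= distrC.
- rewrite /B /=; case: ifP => // h [[Ew /= hx] [_ /= hy]]; split=> //=.
  rewrite in_itv/= andbT.
  move: hx hy; rewrite -!ball_normE /= => hx hy.
  have := lip (D n) (X w) (D m) (Y w); rewrite ler_norml => /andP[_ h']; lra.
Qed.

End separable_measurability.

(** * Lower integrals and Bochner integrals against a vector *)

Section lower_integral.
Context d (T : measurableType d) (R : realType) (mu : {measure set T -> \bar R}).

(* [g] need not be measurable: its integral is then a lower integral. *)
Lemma ge0_le_integral_lower (D : set T) (f g : T -> \bar R) :
  (forall x, D x -> (0 <= f x)%E) -> (forall x, D x -> (f x <= g x)%E) ->
  (\int[mu]_(x in D) f x <= \int[mu]_(x in D) g x)%E.
Proof.
move=> f0 fg; rewrite !ge0_integralE//; last by move=> x Dx; exact: le_trans (f0 _ Dx) (fg _ Dx).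
apply: le_ereal_sup => _ [h hf <-]; exists h => // x; apply: le_trans (hf x) _.
by rewrite !patchE; case: ifPn => // /set_mem/fg.
Qed.

(** Only [f] is measurable, so it is [f] that is set to [0] on the null set. This leaves its
    integral unchanged and makes the inequality hold everywhere. *)
Lemma ae_ge0_le_integral_lower (D : set T) (f g : T -> \bar R) : measurable D ->
  measurable_fun D f ->
  (forall x, D x -> (0 <= f x)%E) -> (forall x, D x -> (0 <= g x)%E) ->
  (\forall x \ae mu, D x -> (f x <= g x)%E) ->
  (\int[mu]_(x in D) f x <= \int[mu]_(x in D) g x)%E.
Proof.
move=> mD mf f0 g0 [N [mN N0 fgN]].
pose f' x := if x \in N then 0%E else f x.
have mf' : measurable_fun D f'.
  apply: measurable_fun_if => //; last exact: (measurable_funS mD (@subIsetl _ _ _) mf).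
  apply: (@measurable_fun_bool _ _ _ _ true); rewrite (_ : _ @^-1` _ = N).
    exact: measurableI.
  by apply/seteqP; split=> x /=; [move/set_mem|move/mem_set].
rewrite (@ae_eq_integral _ _ _ mu D f' f)//; last first.
  exists N; split=> // x /= h; apply: contrapT => Nx; apply: h.
  by rewrite /f' memNset.
apply: ge0_le_integral_lower => x Dx; rewrite /f'; case: ifPn => xN //.
- exact: f0.
- exact: g0.
- by apply: contrapT => h; move/negP: xN; apply; apply/mem_set/fgN => /(_ Dx).
Qed.

End lower_integral.

Section bochner_dot.
Context (R : realType) (V : innerProductType R).
Local Notation mu := (@lebesgue_measure R).

Lemma simple_dot (a b : R) (p : simple_function V) (h : V) : simple_on a b p ->
  [/\ measurable_fun setT (fun r => dot (simple_eval p r) h),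
      mu.-integrable `[a, b] (fun r => (dot (simple_eval p r) h)%:E) &
      (\int[mu]_(r in `[a, b]) (dot (simple_eval p r) h)%:E =
       (dot (simple_integral p) h)%:E)%E].
Proof.
move=> pab.
pose c i := dot (simple_value p i) h.
pose f (i : 'I_(simple_size p)) r : R := \1_(simple_set p i) r * c i.
have fE r : dot (simple_eval p r) h = \sum_(i < simple_size p) f i r.
  by rewrite /simple_eval dot_suml; apply: eq_bigr => i _; rewrite dotZl.
have fin (i : 'I_(simple_size p)) : mu (simple_set p i) \is a fin_num.
  have [mi si] := pab i (ltn_ord i).
  rewrite ge0_fin_numE//; apply: (@le_lt_trans _ _ (mu `[a, b]%classic)).
    by rewrite le_measure ?inE.
  by rewrite lebesgue_measure_itv /=; case: ifP => _; rewrite ?ltry// -EFinB ltry.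
have mf i : measurable_fun setT (f i).
  have [mi si] := pab i (ltn_ord i).
  by apply: measurable_funM => //; exact: measurable_indic.
have ind i : mu.-integrable `[a, b] (fun r => (\1_(simple_set p (i : 'I_(simple_size p))) r)%:E).
  have [mi si] := pab i (ltn_ord i).
  apply/integrableP; split.
    by apply/measurable_EFinP/measurable_funTS; exact: measurable_indic.
  under eq_integral => t _ do rewrite /= ger0_norm//.
  by rewrite integral_indic// setIidl// ltey_eq fin.
have intf i : mu.-integrable `[a, b] (EFin \o f i).
  rewrite (_ : EFin \o _ = (fun r => (\1_(simple_set p i) r)%:E) \* cst (c i)%:E)%E//.
  exact: integrableZr.
split.
- rewrite (_ : (fun r => _) = fun r => \sum_(i < simple_size p) f i r); last by apply/funext.
  exact: measurable_sum.
- rewrite (_ : (fun r => _) = fun r => \sum_(i < simple_size p) (f i r)%:E)%E; last first.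
    by apply/funext => r; rewrite fE sumEFin.
  by apply: integrable_sum => // i _; exact: intf.
- under eq_integral => r _ do rewrite fE -sumEFin.
  rewrite integral_sum// /simple_integral dot_suml -sumEFin; apply: eq_bigr => i _.
  have [mi si] := pab i (ltn_ord i).
  rewrite dotZl EFinM fineK// -/(c i).
  under eq_integral => r _ do rewrite /f EFinM.
  by rewrite integralZr// integral_indic// setIidl.
Qed.

(** The integrand [g] need not be measurable itself. [G] agrees with [dot (g r) h] off the null set
    where the simple approximations may fail to converge, and is measurable as a limit of their
    pairings. *)
Lemma bochner_dot (a b : R) (g : R -> V) (I h : V) : is_bochner_integral a b g I ->
  exists G : R -> R, [/\ mu.-integrable `[a, b] (EFin \o G),
    \forall r \ae mu, r \in `[a, b] -> G r = dot (g r) h &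
    (\int[mu]_(r in `[a, b]) (G r)%:E = (dot I h)%:E)%E].
Proof.
move=> [p [pab pg pint pI]].
pose phi n r := dot (simple_eval (p n) r) h.
pose D := `[a, b]%classic : set R.
have mD : measurable D by exact: measurable_itv.
have [N [mN N0 hN]] := pg.
pose G (r : R) : R := if r \in N then 0 else dot (g r) h.
have aeG : \forall r \ae mu, r \in `[a, b] -> G r = dot (g r) h.
  exists N; split=> // r /= nG; apply: contrapT => rN; apply: nG.
  by rewrite /G memNset.
pose psi n (r : R) : R := if r \in N then 0 else phi n r.
have mphi n : measurable_fun D (phi n).
  by have [m _ _] := simple_dot h (pab n); exact: measurable_funTS.
have mG : measurable_fun D G.
  apply: (@measurable_fun_cvg _ _ _ _ psi).
    move=> n; apply: measurable_fun_if => //.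
      apply: (@measurable_fun_bool _ _ _ _ true); rewrite (_ : _ @^-1` _ = N).
        exact: measurableI.
      by apply/seteqP; split=> x /=; [move/set_mem|move/mem_set].
    exact: (measurable_funS mD (@subIsetl _ _ _) (mphi n)).
  move=> r Dr; rewrite /psi /G; case: ifPn => rN; first exact: cvg_cst.
  apply: cvg_dotl; apply: contrapT => nc; move/negP: rN; apply.
  by apply/mem_set/hN => /= /(_ Dr).
(* The Cauchy-Schwarz factor is divided out on the measurable side, so that no constant has to be
   taken out of an integral of a possibly nonmeasurable function. The [+ 1] avoids division by
   zero. *)
pose k := `|h| + 1.
have k0 : 0 < k by rewrite ltr_wpDl.
have mGphi n : measurable_fun D (fun r => (`|G r - phi n r| / k)%:E).
  apply/measurable_EFinP; apply: measurable_funM => //.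
  by apply: measurableT_comp => //; exact: measurable_funB.
have bound n : (\int[mu]_(r in D) (`|G r - phi n r| / k)%:E <=
    \int[mu]_(r in D) `|g r - simple_eval (p n) r|%:E)%E.
  apply: (ae_ge0_le_integral_lower (mu := mu) mD (mGphi n)).
  - by move=> r Dr; rewrite lee_fin divr_ge0 ?(ltW k0).
  - by move=> r Dr; rewrite lee_fin.
  - move: aeG; apply: aeS => r Gr Dr; rewrite lee_fin Gr// /phi -dotBl ler_pdivrMr//.
    by rewrite (le_trans (cauchy_schwarz_abs _ _))// ler_wpM2l// lerDl.
have lim0 : (\int[mu]_(r in D) `|G r - phi n r|%:E)%E @[n --> \oo] --> 0%E.
  rewrite -(mule0 k%:E).
  rewrite (_ : (fun n => _) =
      fun n => k%:E * \int[mu]_(r in D) (`|G r - phi n r| / k)%:E)%E; last first.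
    apply/funext => n; rewrite -(@ge0_integralZl _ _ _ mu D mD _ (mGphi n) k%:E); last 2 first.
      by move=> r Dr; rewrite lee_fin divr_ge0 ?(ltW k0).
      by rewrite lee_fin ltW.
    by apply: eq_integral => r _; rewrite -EFinM mulrC divfK// gt_eqF.
  apply: cvgeZl => //.
  apply: (squeeze_cvge _ (cvg_cst _) pint); apply: nearW => n; rewrite bound andbT.
  by apply: integral_ge0 => r _; rewrite lee_fin divr_ge0// ltW.
have iG : mu.-integrable D (EFin \o G).
  have [_ /cvgrPdist_lt/(_ _ ltr01)[n0 _ hn0]] := iffLR (fine_cvgP _ _) lim0.
  have /fine_cvgP[[n1 _ hn1] _] := lim0.
  pose n := maxn n0 n1.
  have fi : (\int[mu]_(r in D) `|G r - phi n r|%:E < +oo)%E.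
    have := hn1 n (leq_maxr _ _); rewrite ge0_fin_numE//.
    by apply: integral_ge0 => r _; rewrite lee_fin.
  have i1 : mu.-integrable D (EFin \o (fun r => G r - phi n r)).
    apply/integrableP; split; last exact: fi.
    by apply/measurable_EFinP; apply: measurable_funB; [exact: mG|exact: mphi].
  have [_ i2 _] := simple_dot h (pab n).
  rewrite (_ : EFin \o G = (EFin \o (fun r => G r - phi n r)%R) \+ (EFin \o phi n))%E; last first.
    by apply/funext => r /=; rewrite -EFinD subrK.
  exact: integrableD.
exists G; split=> //.
have iphi n : mu.-integrable D (EFin \o phi n) by have [] := simple_dot h (pab n).
have intphi n : (\int[mu]_(r in D) (phi n r)%:E = (dot (simple_integral (p n)) h)%:E)%E.
  by have [] := simple_dot h (pab n).
have dI : dot (simple_integral (p n)) h @[n --> \oo] --> dot I h by exact: cvg_dotl.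
have dG : (dot (simple_integral (p n)) h) @[n --> \oo] --> \int[mu]_(r in D) G r.
  have /fine_cvgP[_ l0] := lim0.
  apply/cvgrPdist_le => e e0; move/cvgrPdist_le : l0 => /(_ e e0).
  apply: filterS => n; rewrite /= sub0r normrN => hn.
  apply: le_trans hn.
  rewrite [leRHS]ger0_norm; last by rewrite fine_ge0// integral_ge0// => r _; rewrite lee_fin.
  rewrite (_ : dot _ _ = \int[mu]_(r in D) phi n r); last by rewrite /Rintegral intphi.
  rewrite -RintegralB//; apply: le_normr_Rintegral => //.
  by apply: (@integrableB _ _ _ mu D mD _ _ iG (iphi n)).
rewrite -(cvg_lim _ dI)// (cvg_lim _ dG)// fineK//.
exact: integrable_fin_num.
Qed.

End bochner_dot.

(** * Measurability of convolution integrands *)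

Section semigroup_measurability.
Context (R : realType) (V : innerProductType R) (S : R -> V -> V).
Hypothesis sgS : contraction_semigroup S.

Lemma semigroupB s x y : 0 <= s -> S s (x - y) = S s x - S s y.
Proof.
move=> s0; have := semigroup_linear sgS s0 (-1) y x.
by rewrite !scaleN1r (addrC (- y)) => ->; rewrite addrC.
Qed.

(** Since [S c x - S s x = S s (S (c - s) x - x)], the contraction property transports continuity at
    [0] to every [s], with [eta] independent of [s]. *)
Lemma semigroup_right_continuous x (e : R) : 0 < e -> exists2 eta, 0 < eta &
  forall s c, 0 <= s -> s <= c -> c < s + eta -> `|S c x - S s x| < e.
Proof.
move=> e0; have /cvgrPdist_lt/(_ _ e0) := @semigroup_cvg0 _ _ _ sgS x.
rewrite near_withinE => /nbhs_ballP[eta /= eta0 h]; exists eta => // s c s0 sc ce.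
have [<-|nsc] := eqVneq s c; first by rewrite subrr normr0.
have lsc : 0 < c - s by rewrite subr_gt0 lt_neqAle nsc.
rewrite -[in S c](subrKC s c) (semigroupD sgS)// ?(ltW lsc)// -semigroupB//.
rewrite (le_lt_trans (semigroup_contraction sgS _ _))// distrC; apply: h => //.
by rewrite /ball /= sub0r normrN gtr0_norm// ltrBlDl.
Qed.

Lemma measurable_semigroup_dot (t s : R) (y : R -> V) h :
  (forall c, 0 <= c -> measurable_fun `[t, s] (fun r => dot (S c (y r)) h)) ->
  measurable_fun `[t, s] (fun r => dot (S (s - r) (y r)) h).
Proof.
move=> my.
(* Approximate [s - r] from above on a grid of mesh [1 / (n + 1)] and use right
   continuity of the semigroup. *)
pose k (n : nat) (r : R) := Num.truncn ((r - t) * n.+1%:R).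
(* On the grid cells that meet [[t, s]] the maximum is inactive; it makes [c n j] an admissible
   semigroup time for every [j]. *)
pose c (n j : nat) : R := Num.max (s - t - j%:R / n.+1%:R) 0.
have c0 n j : 0 <= c n j by rewrite /c le_max lexx orbT.
have kP n r : t <= r -> (k n r)%:R <= (r - t) * n.+1%:R < (k n r).+1%:R.
  by move=> tr; apply: truncn_itv; rewrite mulr_ge0// subr_ge0.
have cE n r : t <= r <= s -> s - r <= c n (k n r) /\ c n (k n r) < s - r + n.+1%:R^-1.
  move=> /andP[tr rs]; have /andP[k1 k2] := kP n r tr.
  have n0 : 0 < n.+1%:R :> R by [].
  have {}k1 : (k n r)%:R / n.+1%:R <= r - t by rewrite ler_pdivrMr.
  have {}k2 : r - t < (k n r)%:R / n.+1%:R + n.+1%:R^-1.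
    rewrite (_ : _ + _ = (k n r).+1%:R / n.+1%:R); last first.
      by rewrite -(natr1 (k n r)) mulrDl mul1r.
    by rewrite ltr_pdivlMr.
  have -> : c n (k n r) = s - t - (k n r)%:R / n.+1%:R by rewrite /c max_l//; move: k1 rs;
    set q := _ / _; lra.
  by move: k1 k2; set q := _ / _; set i := _^-1; split; lra.
apply: (@measurable_fun_cvg _ _ _ _ (fun n r => dot (S (c n (k n r)) (y r)) h)).
  move=> n _ B mB.
  (* On the [j]-th grid cell the semigroup time is the constant [c n j], to which the hypothesis
     applies. *)
  rewrite (_ : _ `&` _ = \bigcup_j (([set r | t + j%:R / n.+1%:R <= r] `&`
      [set r | r < t + j.+1%:R / n.+1%:R]) `&`
      (`[t, s] `&` (fun r => dot (S (c n j) (y r)) h) @^-1` B))).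
    apply: bigcupT_measurable => j; apply: measurableI; last exact: my.
    apply: measurableI.
      by rewrite (_ : mkset _ = `[t + j%:R / n.+1%:R, +oo[%classic)//;
        apply/seteqP; split=> r /=; rewrite in_itv /= andbT.
    by rewrite (_ : mkset _ = `]-oo, t + j.+1%:R / n.+1%:R[%classic)//;
        apply/seteqP; split=> r /=; rewrite in_itv.
  have n0 : 0 < n.+1%:R :> R by [].
  apply/seteqP; split=> r.
    move=> [/= rts Br]; exists (k n r) => //.
    have /andP[tr rs] : t <= r <= s by move: rts; rewrite in_itv.
    have /andP[k1 k2] := kP n r tr.
    split; last by split.
    by split=> /=; [rewrite -lerBrDl ler_pdivrMr|rewrite -ltrBlDl ltr_pdivlMr].
  move=> [j _ [[/= j1 j2] [rts Br]]]; split=> //=.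
  suff -> : k n r = j by [].
  have /andP[tr rs] : t <= r <= s by move: rts; rewrite /= in_itv.
  have /andP[k1 k2] := kP n r tr.
  have {}j1 : j%:R <= (r - t) * n.+1%:R by rewrite -ler_pdivrMr// lerBrDl.
  have {}j2 : (r - t) * n.+1%:R < j.+1%:R by rewrite -ltr_pdivlMr// ltrBlDl.
  have l1 := le_lt_trans j1 k2; have l2 := le_lt_trans k1 j2.
  by move: l1 l2; rewrite !ltr_nat !ltnS => l1 l2; apply/eqP; rewrite eqn_leq l2.
move=> r /= rts; have tr : t <= r <= s by move: rts; rewrite in_itv.
apply: cvg_dotl; apply/cvgrPdist_lt => e e0.
have [eta eta0 heta] := semigroup_right_continuous (y r) e0.
have /cvgrPdist_lt/(_ _ eta0)[N _ hN] := @cvg_harmonic R.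
exists N => // n Nn /=; have [c1 c2] := cE n r tr.
rewrite distrC; apply: heta => //; first by move: tr; rewrite subr_ge0 => /andP[].
apply: lt_trans c2 _; rewrite ltrD2l.
by have := hN n Nn; rewrite /harmonic /= sub0r normrN ger0_norm.
Qed.

(** The Hilbert-Schmidt norm dominates the norm of the value at each basis vector, and neither [S c]
    nor the pairing with [h] destroys continuity. The case [e = 0] serves the padded basis. *)
Lemma hs_open_dot (Xi : hilbertType R) (sepXi : separable Xi) (e : Xi) c h a : 0 <= c ->
  e = 0 \/ onb e -> hs_open [set Phi : hs_operator Xi V | a < dot (S c (Phi e)) h].
Proof.
move=> c0 ee Phi /= aP.
pose b := dot (S c (Phi e)) h - a.
have b0 : 0 < b by rewrite subr_gt0.
have h0 : 0 < `|h| + 1 by rewrite ltr_wpDl.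
exists (b / (`|h| + 1)); first by rewrite divr_gt0.
move=> Psi hs.
have d0 : `|Phi e - Psi e| < b / (`|h| + 1).
  suff : `|Phi e - Psi e| ^+ 2 < (b / (`|h| + 1)) ^+ 2.
    by rewrite ltr_pXn2r ?nnegrE ?divr_ge0 ?(ltW b0) ?(ltW h0).
  rewrite -lte_fin; apply: le_lt_trans hs.
  case: ee => [->|Be].
    have lin0 (A : hs_operator Xi V) : A 0 = 0.
      by have := hs_linear A (-1) 0 0; rewrite scaler0 addr0 scaleN1r addNr.
    by rewrite !lin0 subrr normr0 expr0n; apply: esum_ge0 => x _; rewrite lee_fin sqr_ge0.
  rewrite /hs_norm2; apply: esum_ge; exists [set e].
    by split; [exact: finite_set1|move=> _ ->].
  by rewrite fsbig_set1.
have : `|dot (S c (Phi e)) h - dot (S c (Psi e)) h| < b.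
  rewrite -dotBl (le_lt_trans (cauchy_schwarz_abs _ _))// -semigroupB//.
  apply: (@le_lt_trans _ _ (`|Phi e - Psi e| * (`|h| + 1))).
    by rewrite ler_pM ?(semigroup_contraction sgS)// lerDl.
  by rewrite -ltr_pdivlMr.
by move=> /ltr_normlW; rewrite /b; lra.
Qed.

(** Measurability holds for every single [w], as a section of a jointly measurable set. *)
Lemma measurable_fun_hs_dot (Xi : hilbertType R) (sepXi : separable Xi)
    d (Omega : measurableType d) (F : R -> set_system Omega) (t T : R)
    (sigma : Omega -> R -> hs_operator Xi V) (e : Xi) c h w :
  t <= T -> F T `<=` measurable -> prog_measurable F t T (@hs_borel R Xi V) sigma ->
  0 <= c -> e = 0 \/ onb e ->
  measurable_fun `[t, T] (fun r => dot (S c (sigma w r e)) h).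
Proof.
move=> tT FT ms c0 ee mtT; apply: (measurability _ (RGenOInfty.measurableE R)) => //.
move=> _ [_ [a ->] <-].
have hb : hs_borel [set Phi : hs_operator Xi V | a < dot (S c (Phi e)) h].
  by apply: sub_sigma_algebra; exact: hs_open_dot.
move: (ms _ hb) => /(prog_sub_measurable tT FT) mA.
have := measurable_xsection w mA; congr (measurable _).
apply/seteqP; split=> r; rewrite /xsection /= inE /= !in_itv/= ?andbT.
  by move=> [? ?]; split.
by move=> [? ?]; split.
Qed.

End semigroup_measurability.

(** * Gaussian increments of the Wiener process *)

Section independence.
Context d (Omega : measurableType d) (R : realType) (P : probability Omega R).
Context (X Y : Omega -> R).
Hypotheses (mX : measurable_fun setT X) (mY : measurable_fun setT Y).
Hypothesis XY : forall A B, measurable A -> measurable B ->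
  P (X @^-1` A `&` Y @^-1` B) = (P (X @^-1` A) * P (Y @^-1` B))%E.
Hypotheses (iX : P.-integrable setT (EFin \o X)) (iY : P.-integrable setT (EFin \o Y)).

(** Independence on rectangles identifies the joint law with the product of the marginal laws;
    Tonelli then gives integrability and Fubini the value. *)
Lemma independent_integralM :
  P.-integrable setT (fun w => (X w * Y w)%:E) /\
  (\int[P]_w (X w * Y w)%:E = \int[P]_w (X w)%:E * \int[P]_w (Y w)%:E)%E.
Proof.
pose pX : {mfun Omega >-> R} := HB.pack X (isMeasurableFun.Build _ _ _ _ X mX).
pose pY : {mfun Omega >-> R} := HB.pack Y (isMeasurableFun.Build _ _ _ _ Y mY).
have mXY : measurable_fun setT (fun w => (X w, Y w)) by exact: measurable_fun_pair.
pose pXY : {mfun Omega >-> (R * R)%type} :=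
  HB.pack (fun w => (X w, Y w)) (isMeasurableFun.Build _ _ _ _ _ mXY).
pose muX := distribution P pX; pose muY := distribution P pY.
have lawE A : measurable A -> (muX \x muY)%E A = distribution P pXY A.
  apply: product_measure_unique => B C mB mC; exact: XY.
pose f (z : R * R) := (z.1 * z.2)%:E.
have mf : measurable_fun setT f.
  by apply/measurable_EFinP; apply: measurable_funM; [exact: measurable_fst|exact: measurable_snd].
have maf : measurable_fun setT (fun z => `|f z|%E) by exact: measurableT_comp.
have eqI (g : R * R -> \bar R) :
    (\int[muX \x muY]_z g z = \int[distribution P pXY]_z g z)%E.
  by apply: eq_measure_integral => A mA _; exact: lawE.
have absX : (\int[muX]_x `|x|%:E < +oo)%E.
  rewrite ge0_integral_distribution//; last exact/measurable_EFinP.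
  by have /integrableP[_] := iX.
have absY : (\int[muY]_x `|x|%:E < +oo)%E.
  rewrite ge0_integral_distribution//; last exact/measurable_EFinP.
  by have /integrableP[_] := iY.
have prodoo : (\int[muX \x muY]_z `|f z| < +oo)%E.
  rewrite fubini_tonelli1//.
  rewrite (eq_integral (fun x : R => `|x|%:E * \int[muY]_y `|y|%:E)%E); last first.
    move=> x _; rewrite /fubini_F -ge0_integralZl//; last exact/measurable_EFinP.
    by apply: eq_integral => y _; rewrite /f /= normrM EFinM.
  rewrite ge0_integralZr//; first by rewrite lte_mul_pinfty// ?integral_ge0// ge0_fin_numE//
    integral_ge0.
  - exact/measurable_EFinP.
  - exact: integral_ge0.
have iprod : (muX \x muY)%E.-integrable setT f by apply/integrableP.
have iXY : P.-integrable setT (f \o pXY).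
  apply/integrableP; split; first exact: measurableT_comp.
  by rewrite -(ge0_integral_distribution pXY maf)// -eqI.
split; first exact: iXY.
transitivity (\int[distribution P pXY]_z f z)%E; first by rewrite integral_distribution.
rewrite -eqI -integral12_prod_meas1//.
have iYl : muY.-integrable setT (fun y => y%:E).
  by apply/integrableP; split=> //; exact/measurable_EFinP.
have iXl : muX.-integrable setT (fun y => y%:E).
  by apply/integrableP; split=> //; exact/measurable_EFinP.
have EY : (\int[muY]_y y%:E = \int[P]_w (Y w)%:E)%E.
  by rewrite integral_distribution//; exact/measurable_EFinP.
have EX : (\int[muX]_y y%:E = \int[P]_w (X w)%:E)%E.
  by rewrite integral_distribution//; exact/measurable_EFinP.
have fY : (\int[muY]_y y%:E)%E \is a fin_num by exact: integrable_fin_num.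
rewrite -EX -EY (eq_integral (fun x : R => x%:E * \int[muY]_y y%:E)%E); last first.
  move=> x _; rewrite /fubini_F -integralZl//.
by rewrite -(fineK fY) integralZr.
Qed.

End independence.

Section gaussian.
Context d (Omega : measurableType d) (R : realType) (P : probability Omega R).

Definition gaussian_moment2 (s : R) : \bar R := (\int[normal_prob 0 s]_x (x ^+ 2)%:E)%E.

Context (Y : Omega -> R) (s : R).
Hypotheses (mY : measurable_fun setT Y)
  (lawY : forall B, measurable B -> P (Y @^-1` B) = normal_prob 0 s B).

Let pY : {mfun Omega >-> measurableTypeR R} :=
  HB.pack (Y : Omega -> measurableTypeR R)
    (isMeasurableFun.Build _ _ Omega (measurableTypeR R) Y mY).

Let lawE (f : R -> \bar R) :
  (\int[distribution P pY]_x f x = \int[normal_prob 0 s]_x f x)%E.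
Proof. by apply: eq_measure_integral => A mA _; exact: lawY. Qed.

Lemma gaussian_sqr : (\int[P]_w (Y w ^+ 2)%:E = gaussian_moment2 s)%E.
Proof.
rewrite /gaussian_moment2 -lawE ge0_integral_distribution//.
  by apply/measurable_EFinP; exact: measurable_funX.
by move=> y; rewrite lee_fin sqr_ge0.
Qed.

Lemma gaussian_mean (f : R -> \bar R) : measurable_fun setT f ->
  P.-integrable setT (f \o Y) ->
  (\int[P]_w f (Y w) = \int[normal_prob 0 s]_x f x)%E.
Proof. by move=> mf iY; rewrite -lawE integral_distribution. Qed.

End gaussian.

(** Doubling the standard deviation leaves a spare factor [expR u >= 1 + u] in the density, with [u]
    a multiple of [x ^+ 2], and this absorbs the polynomial [x ^+ 2 + 1]. The moment is thus at most
    a multiple of the mass of a wider Gaussian. *)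
Lemma gaussian_moment2_lty (R : realType) (s : R) : s != 0 ->
  (gaussian_moment2 s < +oo)%E.
Proof.
move=> s0; rewrite /gaussian_moment2.
have s20 : 0 < s ^+ 2 by rewrite exprn_even_gt0.
(* With [D = 2 s^2], [y = x^2] and [u = 3 y / (4 D)], the choice [c = 1 + 4 D] gives
   [c (1 + u) >= 1 + 4 D u = 1 + 3 y], which dominates [y + 1]. *)
pose c : R := 1 + 8 * s ^+ 2.
have c0 : 0 < c by rewrite ltr_pwDl// mulr_ge0// ltW.
pose p1 := @normal_pdf R 0 s; pose p2 := @normal_pdf R 0 (2 * s).
have s20' : 2 * s != 0 by rewrite mulf_neq0.
pose k : R := c * (normal_peak s / normal_peak (2 * s)).
have peak0 u : u != 0 -> 0 < normal_peak u :> R by move=> u0; exact: normal_peak_gt0.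
pose D : R := s ^+ 2 *+ 2.
have D0 : 0 < D by rewrite /D pmulrn_lgt0.
have bound x : (x ^+ 2 + 1) * p1 x <= k * p2 x.
  rewrite /p1 /p2 !normal_pdfE//= /normal_fun !subr0 /k.
  have -> : (2 * s) ^+ 2 *+ 2 = 4 * D by rewrite exprMn -mulrnAr -natrX.
  rewrite -/D; move: (sqr_ge0 x); set y := x ^+ 2 => y0.
  have -> : - y / (4 * D) = - y / D + 3 * y / (4 * D).
    by field; rewrite /= gt_eqF.
  rewrite expRD.
  have := peak0 _ s20'; have := peak0 _ s0.
  set a := normal_peak s; set a' := normal_peak (2 * s).
  set e1 := expR (- y / D); set u := 3 * y / (4 * D) => a0 a'0.
  have -> : c * (a / a') * (a' * (e1 * expR u)) = (c * expR u) * (a * e1).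
    by field; rewrite /= gt_eqF.
  rewrite ler_wpM2r//; first by rewrite mulr_ge0 ?expR_ge0 ?(ltW a0).
  apply: (@le_trans _ _ (c * (1 + u))); last first.
    by rewrite ler_wpM2l ?(ltW c0)//; exact: expR_ge1Dx.
  have cE : c = 1 + 4 * D by rewrite /c /D -mulr_natr; ring.
  have u0 : 0 <= u by rewrite /u divr_ge0// mulr_ge0// ltW.
  have Du : 4 * D * u = 3 * y by rewrite /u; field; rewrite /= gt_eqF.
  rewrite cE mulrDl mul1r mulrDr Du mulr1; lra.
have mlevel (n : nat) : measurable [set x : R | n%:R <= x ^+ 2].
  rewrite (_ : [set x | _] = (fun x : R => x ^+ 2) @^-1` `[n%:R, +oo[%classic).
    rewrite -[X in measurable X]setTI; exact: (@exprn_measurable R setT 2).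
  by apply/seteqP; split=> x /=; rewrite in_itv/= andbT.
(* The law is tied to its density through the measure of sets, so [x ^+ 2] is replaced by the number
   of integers [n <= x ^+ 2]: a sum of indicators lying between [x ^+ 2] and [x ^+ 2 + 1]. *)
pose g n (x : R) := (\1_[set x : R | n%:R <= x ^+ 2] x)%:E : \bar R.
have g0 n x : (0 <= g n x)%E by rewrite lee_fin.
have mg n : measurable_fun setT (g n).
  by apply/measurable_EFinP; exact: measurable_indic.
have count N (y : R) : 0 <= y -> \sum_(0 <= n < N) (n%:R <= y)%R%:R <= y + 1 :> R.
  move=> y0; elim: N => [|N IH]; first by rewrite big_geq// addr_ge0.
  rewrite big_nat_recr//=; case: (leP N%:R y) => Ny; last by rewrite addr0.
  rewrite lerD2r (le_trans _ Ny)// (@le_trans _ _ (\sum_(0 <= n < N) 1))//.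
    by apply: ler_sum => n _; case: (n%:R <= y) => /=; rewrite ?ler01.
  by rewrite sumr_const_nat subn0.
have sumE N x : (\sum_(0 <= n < N) g n x)%E = (\sum_(0 <= n < N) (n%:R <= x ^+ 2)%R%:R)%:E.
  by rewrite -sumEFin; apply: eq_bigr => n _; rewrite /g indicE mem_setE.
have lower x : ((x ^+ 2)%:E <= \sum_(n <oo) g n x)%E.
  pose m := (Num.truncn (x ^+ 2)).+1.
  have /andP[m1 m2] := truncn_itv (sqr_ge0 x).
  apply: le_trans (nneseries_lim_ge m (fun n _ _ => g0 n x)).
  rewrite sumE lee_fin; apply: (le_trans (ltW m2)).
  rewrite -[X in X%:R <= _]subn0 -sumr_const_nat big_nat [leRHS]big_nat.
  apply: ler_sum => n /andP[_]; rewrite ltnS => nm.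
  by rewrite (le_trans _ m1)// ler_nat.
have mp1 : measurable_fun setT p1 by exact: measurable_normal_pdf.
have mp2 : measurable_fun setT p2 by exact: measurable_normal_pdf.
have p10 x : 0 <= p1 x by exact: normal_pdf_ge0.
have p20 x : 0 <= p2 x by exact: normal_pdf_ge0.
have mgp n : measurable_fun setT (fun x => g n x * (p1 x)%:E)%E.
  by apply: emeasurable_funM => //; exact/measurable_EFinP.
have gp0 n x : (0 <= g n x * (p1 x)%:E)%E by rewrite mule_ge0// lee_fin.
have msum : measurable_fun setT (fun x : measurableTypeR R => \sum_(n <oo) (g n x * (p1 x)%:E))%E.
  exact: (@ge0_emeasurable_sum _ (measurableTypeR R) _ setT
    (fun n x => g n x * (p1 x)%:E)%E xpredT (fun k x _ _ => gp0 k x) (fun k _ => mgp k)).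
have levelE n : (\int[normal_prob 0 s]_x g n x = \int[@lebesgue_measure R]_x (g n x * (p1 x)%:E))%E.
  rewrite integral_indic//; last exact: mlevel.
  rewrite setIT.
  transitivity (\int[@lebesgue_measure R]_(x in [set x : R | (n%:R <= x ^+ 2)%R]) (p1 x)%:E)%E
    => //.
  rewrite integral_mkcond.
  apply: eq_integral => x _; rewrite patchE /g indicE.
  by case: ifP => _; rewrite ?mul1e ?mul0e.
apply: (@le_lt_trans _ _ (\int[normal_prob 0 s]_x (\sum_(n <oo) g n x))%E).
  apply: ge0_le_integral => //.
  - by move=> x _; rewrite lee_fin sqr_ge0.
  - by apply/measurable_EFinP; exact: measurable_funX.
  - exact: (@ge0_emeasurable_sum _ _ _ setT g xpredT (fun k x _ _ => g0 k x) (fun k _ => mg k)).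
rewrite integral_nneseries//.
rewrite (eq_eseriesr (fun n _ => levelE n)) -integral_nneseries//.
apply: (@le_lt_trans _ _ (\int[@lebesgue_measure R]_x (k%:E * (p2 x)%:E))%E).
  apply: ge0_le_integral => //.
  - by move=> x _; apply: nneseries_ge0 => n _ _; rewrite mule_ge0// lee_fin.
  - by apply/measurable_EFinP; apply: measurable_funM.
  - move=> x _; apply: lime_le.
      by apply: is_cvg_nneseries => n _ _; rewrite mule_ge0// lee_fin.
    apply: nearW => N; rewrite -ge0_sume_distrl//.
    rewrite sumE -!EFinM lee_fin; apply: le_trans (bound x).
    by rewrite ler_wpM2r// count// sqr_ge0.
have k0 : 0 <= k.
  by rewrite /k mulr_ge0 ?(ltW c0)// divr_ge0// ltW// peak0.
rewrite (@ge0_integralZl_EFin _ (measurableTypeR R) R (@lebesgue_measure R) setT measurableT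
  (EFin \o p2) (fun x _ => p20 x) (iffRL (measurable_EFinP _ _) mp2) k k0).
by rewrite integral_normal_pdf mule1 ltry.
Qed.

(** * Adapted random variables and moments of the increments *)

Section adapted.
Context (R : realType) (Xi : hilbertType R) d (Omega : measurableType d)
  (P : probability Omega R) (W : R -> Xi -> Omega -> R) (t T : R).

Definition wiener_gens (s : R) : set_system Omega :=
  [set A | (exists u a (B : set R),
                 [/\ t <= u <= s, measurable B & A = W u a @^-1` B])
               \/ P.-negligible A].

(** Phrased as measurability on a type that carries the generated sigma-field, so that sums and
    products of adapted variables fall under the general lemmas on measurable functions. *)
Definition adapted s (f : Omega -> R) :=
  measurable_fun (setT : set (g_sigma_algebraType (wiener_gens s)))
    (f : g_sigma_algebraType (wiener_gens s) -> R).

Lemma adaptedP s f : adapted s f <->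
  forall B, measurable B -> wiener_filtration P W t s (f @^-1` B).
Proof.
split=> [h B mB|h _ B mB]; first by have := h measurableT B mB; rewrite setTI.
by rewrite setTI; exact: h.
Qed.

Lemma wiener_filtration_mono s s' : s <= s' ->
  wiener_filtration P W t s `<=` wiener_filtration P W t s'.
Proof.
move=> ss'; apply: sub_sigma_algebra2 => A [[u [a [B [/andP[tu us] mB ->]]]]|]; last by right.
by left; exists u, a, B; rewrite tu (le_trans us ss').
Qed.

Lemma adapted_mono s s' f : s <= s' -> adapted s f -> adapted s' f.
Proof.
by move=> ss' /adaptedP h; apply/adaptedP => B mB; exact: wiener_filtration_mono (h B mB).
Qed.

Lemma adapted_W s u a : t <= u <= s -> adapted s (W u a).
Proof.
move=> tus; apply/adaptedP => B mB; apply: sub_sigma_algebra.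
by left; exists u, a, B.
Qed.

Lemma adapted_increment s u v a : t <= u <= s -> t <= v <= s ->
  adapted s (increment W u v a).
Proof. by move=> us vs; apply: measurable_funB; exact: adapted_W. Qed.

Hypotheses (cP : measure_is_complete P) (wW : cylindrical_wiener P W t T).

Lemma adapted_measurable s f : s <= T -> adapted s f -> measurable_fun setT f.
Proof.
move=> sT /adaptedP h _ B mB; rewrite setTI.
apply: (wiener_filtration_sub_measurable cP _ (h B mB)) => u a /andP[tu us].
by apply: (wiener_measurable wW); rewrite tu (le_trans us).
Qed.

Section increment.
Context (s u : R) (ts : t <= s) (su : s <= u) (uT : u <= T).
Local Notation inc := (increment W s u).
Local Notation E f := (\int[P]_w f w).
Local Notation L1 f := (P.-integrable setT (EFin \o f)).

Let s_in : t <= s <= T. Proof. by rewrite ts (le_trans su). Qed.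
Let u_in : t <= u <= T. Proof. by rewrite uT (le_trans ts). Qed.

Lemma measurable_increment a : measurable_fun setT (inc a).
Proof. by apply: measurable_funB; exact: (wiener_measurable wW). Qed.

Lemma increment_linear k a b :
  \forall w \ae P, inc (k *: a + b) w = k * inc a w + inc b w.
Proof.
move: (wiener_linear wW k a b s_in) (wiener_linear wW k a b u_in).
apply: aeS2 => w; rewrite /increment => -> ->; ring.
Qed.

Lemma increment0 : \forall w \ae P, inc 0 w = 0.
Proof.
have := increment_linear 1 0 0; rewrite scaler0 addr0; apply: aeS => w.
by rewrite mul1r => h; apply: (@addrI _ (inc 0 w)); rewrite addr0 -h.
Qed.

Lemma incrementZ k a : \forall w \ae P, inc (k *: a) w = k * inc a w.
Proof.
move: (increment_linear k a 0) increment0; rewrite addr0.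
by apply: aeS2 => w -> ->; rewrite addr0.
Qed.

Lemma incrementD a b : \forall w \ae P, inc (a + b) w = inc a w + inc b w.
Proof.
by move: (increment_linear 1 a b); rewrite scale1r; apply: aeS => w ->; rewrite mul1r.
Qed.

Lemma incrementB a b : \forall w \ae P, inc (a - b) w = inc a w - inc b w.
Proof.
move: (increment_linear (-1) b a); apply: aeS => w.
by rewrite scaleN1r addrC => ->; rewrite mulN1r addrC.
Qed.

(* Equal to 1, but only its finiteness is needed. *)
Definition gauss2 : R := fine (@gaussian_moment2 R 1).

Let sd (a : Xi) := Num.sqrt (u - s) * `|a|.

Let law a : s < u -> a != 0 -> forall B, measurable B ->
  P (inc a @^-1` B) = normal_prob 0 (sd a) B.
Proof. by move=> su' a0 B mB; exact: (wiener_gaussian wW). Qed.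

Let sd_gt0 a : s < u -> a != 0 -> 0 < sd a.
Proof. by move=> su' a0; rewrite mulr_gt0 ?normr_gt0// sqrtr_gt0 subr_gt0. Qed.

(** These are the two cases that the Gaussian law of the increments leaves out. *)
Lemma increment_degenerate a : (s < u) = false \/ a = 0 -> \forall w \ae P, inc a w = 0.
Proof.
move=> [h|->]; last exact: increment0.
apply: aeW => w; have -> : s = u by apply/eqP; rewrite eq_le su leNgt h.
by rewrite /increment subrr.
Qed.

Lemma increment_sqrE a :
  (\int[P]_w (inc a w ^+ 2)%:E = (gauss2 * (u - s) * `|a| ^+ 2)%:E)%E.
Proof.
have mi2 b : measurable_fun setT (fun w => (inc b w ^+ 2)%:E).
  by apply/measurable_EFinP; apply: measurable_funX; exact: measurable_increment.
have [su'|su'] := boolP (s < u); last first.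
  rewrite (@ae_eq_integral _ _ _ P setT (cst 0%E))//.
    rewrite integral0; have -> : s = u by apply/eqP; rewrite eq_le su leNgt su'.
    by rewrite subrr mulr0 mul0r.
  move: (@increment_degenerate a (or_introl (negbTE su'))); apply: aeS => w -> _.
  by rewrite expr0n.
have [->|a0] := eqVneq a 0.
  rewrite (@ae_eq_integral _ _ _ P setT (cst 0%E))//.
    by rewrite integral0 normr0 expr0n mulr0.
  by move: increment0; apply: aeS => w -> _; rewrite expr0n.
have s0 := sd_gt0 su' a0.
(* The direction is rescaled to standard deviation [1], so that one constant serves all directions
   and time steps. *)
pose a' := (sd a)^-1 *: a.
have a'0 : a' != 0 by rewrite scaler_eq0 invr_eq0 negb_or a0 gt_eqF.
have sd1 : sd a' = 1.
  by rewrite /sd normrZ ger0_norm ?invr_ge0 ?(ltW s0)// mulrCA mulVf// gt_eqF.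
have E1 : (\int[P]_w (inc a' w ^+ 2)%:E = gauss2%:E)%E.
  rewrite (gaussian_sqr (measurable_increment a') (law su' a'0)) sd1 fineK//.
  rewrite ge0_fin_numE ?gaussian_moment2_lty ?oner_eq0//.
  by apply: integral_ge0 => x _; rewrite lee_fin sqr_ge0.
rewrite (@ae_eq_integral _ _ _ P setT (fun w => (sd a ^+ 2)%:E * (inc a' w ^+ 2)%:E)%E)//.
- rewrite ge0_integralZl_EFin//; last 2 first.
  + by move=> x _; rewrite lee_fin sqr_ge0.
  + exact: sqr_ge0.
  rewrite E1 -EFinM /sd exprMn sqr_sqrtr ?subr_ge0//; congr EFin; ring.
- by apply: emeasurable_funM.
- move: (incrementZ (sd a) a'); rewrite /a' scalerA mulfV ?gt_eqF// scale1r.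
  by apply: aeS => w -> _; rewrite exprMn EFinM.
Qed.

Lemma increment_Lfun2 a : inc a \in Lfun P 2%:E.
Proof.
have mi := measurable_increment a.
rewrite inE; apply/andP; split; rewrite inE//=.
rewrite /finite_norm unlock poweR_lty//.
rewrite (eq_integral (fun w => (inc a w ^+ 2)%:E)); last first.
  by move=> w _ /=; rewrite powR_mulrn// -normrX ger0_norm ?sqr_ge0.
by rewrite increment_sqrE ltry.
Qed.

Lemma increment_integrable a : L1 (inc a).
Proof.
apply/Lfun1_integrable.
exact: (Lfun_subset12 (fin_num_measure P setT measurableT) (increment_Lfun2 a)).
Qed.

Lemma increment_sqr_integrable a : L1 (fun w => inc a w ^+ 2).
Proof. exact/Lfun2_integrable_sqr/increment_Lfun2. Qed.

(** By symmetry: the increments in the directions [a] and [- a] have the same law and are almost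
    surely opposite, so the mean is its own opposite. *)
Lemma increment_mean a : (\int[P]_w (inc a w)%:E = 0)%E.
Proof.
have mi b : measurable_fun setT (fun w => (inc b w)%:E).
  by apply/measurable_EFinP; exact: measurable_increment.
have [su'|su'] := boolP (s < u); last first.
  rewrite (@ae_eq_integral _ _ _ P setT (cst 0%E))// ?integral0//.
  by move: (@increment_degenerate a (or_introl (negbTE su'))); apply: aeS => w -> _.
have [->|a0] := eqVneq a 0.
  rewrite (@ae_eq_integral _ _ _ P setT (cst 0%E))// ?integral0//.
  by move: increment0; apply: aeS => w -> _.
have na0 : - a != 0 by rewrite oppr_eq0.
have lawN : sd (- a) = sd a by rewrite /sd normrN.
have mE : measurable_fun setT (EFin \o (fun x : R => x)).
  by apply/measurable_EFinP; exact: measurable_id.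
have h1 := gaussian_mean (measurable_increment a) (law su' a0) mE (increment_integrable a).
have h2 := gaussian_mean (measurable_increment (- a)) (law su' na0) mE
  (increment_integrable (- a)).
have h3 : E (inc (- a)) = - E (inc a).
  rewrite -mulN1r -RintegralZl//; last exact: increment_integrable.
  congr fine; apply: ae_eq_integral => //.
    apply/measurable_EFinP; apply: measurable_funM => //; exact: measurable_increment.
  by move: (incrementZ (-1) a); rewrite scaleN1r; apply: aeS => w -> _.
have fi := integrable_fin_num measurableT (increment_integrable a).
have h4 : E (inc (- a)) = E (inc a).
  by rewrite lawN -h1 in h2; rewrite /Rintegral; congr fine; exact: h2.
have : E (inc a) = 0 by lra.
by rewrite /Rintegral => h; rewrite -[LHS]fineK// h.
Qed.

Lemma increment_indep s' (xi : Omega -> R) a A B : s' = s -> adapted s' xi ->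
  measurable A -> measurable B ->
  P (xi @^-1` A `&` inc a @^-1` B) = (P (xi @^-1` A) * P (inc a @^-1` B))%E.
Proof.
move=> -> /adaptedP hxi mA mB; apply: (wiener_independent wW) => //; exact: hxi.
Qed.

Lemma adapted_increment_mean xi a : adapted s xi -> L1 xi ->
  L1 (fun w => xi w * inc a w) /\ E (fun w => xi w * inc a w) = 0.
Proof.
move=> axi ixi.
have mxi := adapted_measurable (le_trans su uT) axi.
have [i1 e1] := independent_integralM mxi (measurable_increment a)
  (fun A B => @increment_indep s xi a A B erefl axi) ixi (increment_integrable a).
by split=> //; rewrite /Rintegral e1 increment_mean mule0.
Qed.

Lemma adapted_increment_sqr xi a : adapted s xi -> L1 xi ->
  L1 (fun w => xi w * inc a w ^+ 2) /\
  E (fun w => xi w * inc a w ^+ 2) = gauss2 * (u - s) * `|a| ^+ 2 * E xi.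
Proof.
move=> axi ixi.
have mxi := adapted_measurable (le_trans su uT) axi.
have mi2 : measurable_fun setT (fun w => inc a w ^+ 2).
  by apply: measurable_funX; exact: measurable_increment.
pose q w := inc a w ^+ 2.
have ind A B : measurable A -> measurable B ->
  P (xi @^-1` A `&` q @^-1` B) = (P (xi @^-1` A) * P (q @^-1` B))%E.
  move=> mA mB.
  have := @increment_indep s xi a A ((fun x : R => x ^+ 2) @^-1` B) erefl axi mA.
  apply; rewrite -[X in measurable X]setTI; exact: (@exprn_measurable R setT 2).
have [i1 e1] := independent_integralM mxi mi2 ind ixi (increment_sqr_integrable a).
split=> //; rewrite /Rintegral e1 increment_sqrE fineM//=; first exact: mulrC.
exact: (integrable_fin_num measurableT ixi).
Qed.

(** Only the law of a single increment is given, so the mixed moment is obtained by polarization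
    from the directions [a + b] and [a - b]. *)
Lemma adapted_increment_prod xi a b : adapted s xi -> L1 xi ->
  L1 (fun w => xi w * (inc a w * inc b w)) /\
  E (fun w => xi w * (inc a w * inc b w)) = gauss2 * (u - s) * dot a b * E xi.
Proof.
move=> axi ixi.
have [i1 e1] := adapted_increment_sqr (a + b) axi ixi.
have [i2 e2] := adapted_increment_sqr (a - b) axi ixi.
have mxi := adapted_measurable (le_trans su uT) axi.
pose f w := 4^-1 * (xi w * inc (a + b) w ^+ 2 - xi w * inc (a - b) w ^+ 2).
have i3 : L1 (fun w => xi w * inc (a + b) w ^+ 2 - xi w * inc (a - b) w ^+ 2).
  exact: (integrableB measurableT i1 i2).
have i4 : L1 f by exact: (integrableZl measurableT 4^-1 i3).
have mprod : measurable_fun setT (fun w => xi w * (inc a w * inc b w)).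
  by do 2 apply: measurable_funM => //; exact: measurable_increment.
have fE : \forall w \ae P, f w = xi w * (inc a w * inc b w).
  move: (incrementD a b) (incrementB a b); apply: aeS2 => w h1 h2.
  by rewrite /f h1 h2; field.
have eqi : (\int[P]_w (f w)%:E = \int[P]_w (xi w * (inc a w * inc b w))%:E)%E.
  apply: ae_eq_integral => //; [exact: measurable_int i4|exact/measurable_EFinP|].
  by move: fE; apply: aeS => w ->.
split.
  apply/integrableP; split; first exact/measurable_EFinP.
  rewrite (@ae_eq_integral _ _ _ P setT (fun w => `|(f w)%:E|%E))//.
  - by have /integrableP[] := i4.
  - by apply: measurableT_comp => //; exact/measurable_EFinP.
  - by apply: measurableT_comp => //; exact: measurable_int i4.
  - by move: fE; apply: aeS => w /= -> _.
rewrite /Rintegral -eqi -/(E f) /f (RintegralZl 4^-1 measurableT i3)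
  (RintegralB measurableT i1 i2) e1 e2.
by rewrite -mulrBl -mulrBr -dot_polar -/(E xi); field.
Qed.

End increment.
End adapted.

(** * Tail bound for elementary stochastic integrals *)

Section integrability.
Context d (Omega : measurableType d) (R : realType) (P : probability Omega R).
Local Notation E f := (\int[P]_w f w).
Local Notation L1 f := (P.-integrable setT (EFin \o f)).

Lemma Lfun2_measurable f : f \in Lfun P 2%:E -> measurable_fun setT f.
Proof. by move=> /andP[/[!inE]]. Qed.

Lemma bounded_mul_Lfun2 (B : R) (xi f : Omega -> R) : measurable_fun setT xi ->
  (forall w, `|xi w| <= B) -> f \in Lfun P 2%:E ->
  (fun w => xi w * f w) \in Lfun P 2%:E.
Proof.
move=> mxi bxi fL; apply: Lfun2_sqr_lty.
  by apply: measurable_funM => //; exact: Lfun2_measurable.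
have /integrableP[mi] := integrableZl measurableT (B ^+ 2) (Lfun2_integrable_sqr fL).
apply: le_lt_trans; apply: ge0_le_integral_lower => w _ /=.
  by rewrite lee_fin sqr_ge0.
rewrite lee_fin exprMn normrM !(ger0_norm (sqr_ge0 _)).
have B0 : 0 <= B by exact: le_trans (normr_ge0 _) (bxi w).
by rewrite ler_wpM2r ?sqr_ge0// -[xi w ^+ 2]real_normK ?num_real// ler_pXn2r ?nnegrE.
Qed.

Lemma Lfun2D (f g : Omega -> R) : f \in Lfun P 2%:E -> g \in Lfun P 2%:E ->
  (fun w => f w + g w) \in Lfun P 2%:E.
Proof. by have [_ h] := Lfun_addr_closed P (@lee1n R 2); exact: h. Qed.

Lemma Lfun2_sum (I : Type) (s : seq I) (f : I -> Omega -> R) :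
  (forall i, f i \in Lfun P 2%:E) -> (fun w => \sum_(i <- s) f i w) \in Lfun P 2%:E.
Proof.
move=> fL; elim: s => [|i s IH].
  rewrite (_ : (fun w => _) = cst 0); first exact: Lfun_cst.
  by apply/funext => w; rewrite big_nil.
rewrite (_ : (fun w => _) = fun w => f i w + \sum_(j <- s) f j w); first exact: Lfun2D.
by apply/funext => w; rewrite big_cons.
Qed.

Lemma Lfun2_L1 (f : Omega -> R) : f \in Lfun P 2%:E -> L1 f.
Proof.
by move=> fL; apply/Lfun1_integrable; exact: (Lfun_subset12 (fin_num_measure P setT
  measurableT) fL).
Qed.

Lemma Lfun2_mulL1 (f g : Omega -> R) : f \in Lfun P 2%:E -> g \in Lfun P 2%:E ->
  L1 (fun w => f w * g w).
Proof. by move=> fL gL; exact/Lfun1_integrable/(Lfun2_mul_Lfun1 fL gL). Qed.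

Lemma bounded_L1 (B : R) (f : Omega -> R) : measurable_fun setT f ->
  (forall w, `|f w| <= B) -> L1 f.
Proof.
move=> mf fB; apply: Lfun2_L1.
rewrite (_ : f = fun w => f w * cst 1 w); last by apply/funext => w; rewrite mulr1.
by apply: (bounded_mul_Lfun2 (B := B)) => //; exact: Lfun_cst.
Qed.

Lemma Rintegral_sum (I : Type) (s : seq I) (f : I -> Omega -> R) :
  (forall i, L1 (f i)) ->
  L1 (fun w => \sum_(i <- s) f i w) /\
  E (fun w => \sum_(i <- s) f i w) = \sum_(i <- s) E (f i).
Proof.
move=> fL; elim: s => [|i s [IH1 IH2]].
  rewrite (_ : (fun w => _) = cst 0); last by apply/funext => w; rewrite big_nil.
  split; first exact: finite_measure_integrable_cst.
  by rewrite big_nil Rintegral_cst// mul0r.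
rewrite (_ : (fun w => _) = fun w => f i w + \sum_(j <- s) f j w); last first.
  by apply/funext => w; rewrite big_cons.
split; first exact: (integrableD measurableT (fL i) IH1).
by rewrite RintegralD// IH2 big_cons.
Qed.

End integrability.

Section ito.
Context (R : realType) (Xi : hilbertType R) d (Omega : measurableType d)
  (P : probability Omega R) (W : R -> Xi -> Omega -> R) (t T : R).
Hypotheses (cP : measure_is_complete P) (wW : cylindrical_wiener P W t T).
Context (n : nat) (tau : nat -> R) (c : 'I_n -> nat -> Omega -> R) (a : 'I_n -> Xi).
Hypotheses (nd_tau : forall k, tau k <= tau k.+1) (tau_ge : forall k, t <= tau k)
  (tau_le : forall k, tau k <= T).
Hypothesis ac : forall i k, adapted P W t (tau k) (c i k).
Context (B : R) (bc : forall i k w, `|c i k w| <= B).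
Context (delta : R) (delta0 : 0 <= delta).
Local Notation E f := (\int[P]_w f w).
Local Notation L1 f := (P.-integrable setT (EFin \o f)).
Local Notation ad := (adapted P W t).
Local Notation inc k := (increment W (tau k) (tau k.+1)).

Definition ito_step k w := \sum_(i < n) c i k w * inc k (a i) w.
(** The integral over []tau k, tau k.+1]] of the squared norm of the [Xi]-valued integrand, which is
    constant in time there. *)
Definition ito_energy k w := `|\sum_(i < n) c i k w *: a i| ^+ 2 * (tau k.+1 - tau k).
Let A k w := \sum_(0 <= j < k) ito_energy j w.
(** The energy of step [k] is already known at time [tau k]. The indicator can therefore include it
    and stay adapted at [tau k], so the stopped energy never overshoots [delta]. *)
Let chi k : Omega -> R := \1_[set w | A k.+1 w <= delta].
(* Stopping as soon as the energy would exceed [delta] keeps the second moment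
   of the stopped sum [M] below a multiple of [delta]. *)
Let M k w := \sum_(0 <= j < k) chi j w * ito_step j w.

Let homo_tau k l : (k <= l)%N -> tau k <= tau l.
Proof. by move=> kl; apply: (homo_leq (@lexx _ _) (@le_trans _ _) nd_tau). Qed.

Let mono k l f : (k <= l)%N -> ad (tau k) f -> ad (tau l) f.
Proof. by move=> kl; apply: adapted_mono; exact: homo_tau. Qed.

Lemma ito_energy_ge0 k w : 0 <= ito_energy k w.
Proof. by rewrite /ito_energy mulr_ge0 ?sqr_ge0// subr_ge0. Qed.

Let energyE k w : ito_energy k w =
  \sum_(i < n) \sum_(j < n) (tau k.+1 - tau k) * dot (a i) (a j) * (c i k w * c j k w).
Proof.
rewrite /ito_energy -dotxx dot_suml mulr_suml; apply: eq_bigr => i _.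
rewrite dot_sumr mulr_suml; apply: eq_bigr => j _; rewrite dotZl dotZr; ring.
Qed.

Let ad_energy k : ad (tau k) (ito_energy k).
Proof.
rewrite /adapted (_ : ito_energy k = fun w => \sum_(i < n) \sum_(j < n)
  (tau k.+1 - tau k) * dot (a i) (a j) * (c i k w * c j k w)); last exact/funext/energyE.
apply: measurable_sum => i; apply: measurable_sum => j.
apply: measurable_funM => //; apply: measurable_funM; exact: ac.
Qed.

Let ad_A k : ad (tau k) (A k.+1).
Proof.
rewrite /adapted /A; under eq_fun do rewrite big_mkord.
apply: measurable_sum => j; apply: (mono (k := j)); last exact: ad_energy.
by rewrite -ltnS ltn_ord.
Qed.

Let ad_chi k : ad (tau k) (chi k).
Proof.
apply: measurable_indic.
rewrite (_ : [set w | _] = A k.+1 @^-1` `]-oo, delta]%classic); last first.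
  by apply/seteqP; split=> w /=; rewrite in_itv.
by have /adaptedP h := @ad_A k; exact: (h _ (measurable_itv _)).
Qed.

Let chi01 k w : chi k w = 0 \/ chi k w = 1.
Proof. by rewrite /chi indicE; case: (_ \in _); [right|left]. Qed.

Let chi_bound k w : `|chi k w| <= 1.
Proof. by case: (chi01 k w) => ->; rewrite ?normr0 ?normr1. Qed.

Let mchi k : measurable_fun setT (chi k).
Proof. exact: (adapted_measurable cP wW (tau_le k) (@ad_chi k)). Qed.

Let mc i k : measurable_fun setT (c i k).
Proof. exact: (adapted_measurable cP wW (tau_le k) (@ac i k)). Qed.

Let inc_L2 k b : inc k b \in Lfun P 2%:E.
Proof. exact: (increment_Lfun2 wW). Qed.

Let step_L2 k : ito_step k \in Lfun P 2%:E.
Proof.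
by apply: Lfun2_sum => i; apply: (bounded_mul_Lfun2 (B := B)).
Qed.

Let ad_step k : ad (tau k.+1) (ito_step k).
Proof.
apply: measurable_sum => i; apply: measurable_funM.
  by apply: mono (@ac i k).
by apply: adapted_increment; rewrite ?tau_ge ?lexx ?nd_tau.
Qed.

Let ad_M k : ad (tau k) (M k).
Proof.
rewrite /adapted /M; under eq_fun do rewrite big_mkord.
apply: measurable_sum => j; apply: measurable_funM.
  by apply: (mono (k := j)); [exact: ltnW|exact: ad_chi].
by apply: (mono (k := j.+1)); [exact: ltn_ord|exact: ad_step].
Qed.

Let M_L2 k : M k \in Lfun P 2%:E.
Proof.
by apply: Lfun2_sum => j; apply: (bounded_mul_Lfun2 (B := 1)).
Qed.

Let chiV k w := chi k w * ito_energy k w.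

Let chiV_bound k w : 0 <= chiV k w <= delta.
Proof.
rewrite /chiV; apply/andP; split.
  by rewrite mulr_ge0 ?ito_energy_ge0//; case: (chi01 k w) => ->.
rewrite /chi indicE; have [|_] := boolP (_ \in _); last by rewrite mul0r.
rewrite inE /= => h; rewrite mul1r (le_trans _ h)// /A big_nat_recr//= lerDr.
by apply: sumr_ge0 => j _; exact: ito_energy_ge0.
Qed.

Let chiV_L1 k : L1 (chiV k).
Proof.
apply: (@bounded_L1 _ _ _ _ delta).
  apply: measurable_funM => //.
  exact: (adapted_measurable cP wW (tau_le k) (@ad_energy k)).
by move=> w; have /andP[h1 h2] := chiV_bound k w; rewrite ger0_norm.
Qed.

(** Everything except the increment is adapted at [tau k], and the increment is centred and
    independent of it. *)
Let cross k : E (fun w => M k w * (chi k w * ito_step k w)) = 0.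
Proof.
pose xi i w := M k w * (chi k w * c i k w).
have axi i : ad (tau k) (xi i).
  by apply: measurable_funM; [exact: ad_M|apply: measurable_funM; [exact: ad_chi|exact: ac]].
have ixi i : L1 (xi i).
  rewrite (_ : xi i = fun w => (chi k w * c i k w) * M k w); last first.
    by apply/funext => w; rewrite /xi mulrC.
  apply: Lfun2_L1; apply: (bounded_mul_Lfun2 (B := B)) => //.
    exact: measurable_funM.
  move=> w; rewrite normrM (le_trans _ (bc i k w))// ler_piMl//.
have h i := adapted_increment_mean cP wW (tau_ge k) (nd_tau k) (tau_le k.+1) (a i) (axi i) (ixi i).
have [_ hs] := Rintegral_sum (enum 'I_n) (fun i => (h i).1).
transitivity (E (fun w => \sum_(i <- enum 'I_n) xi i w * inc k (a i) w)).
  apply: eq_Rintegral => w _; rewrite /ito_step big_enum /= !mulr_sumr.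
  by apply: eq_bigr => i _; rewrite /xi; ring.
by rewrite hs big1// => i _; exact: (h i).2.
Qed.

(** Expanded over pairs of directions, each pair contributes its [dot (a i) (a j)] times the time
    step; [energyE] reassembles the energy. *)
Let square k : E (fun w => (chi k w * ito_step k w) ^+ 2) = gauss2 R * E (chiV k).
Proof.
pose xi (p : 'I_n * 'I_n) w := chi k w * (c p.1 k w * c p.2 k w).
have axi p : ad (tau k) (xi p).
  by apply: measurable_funM; [exact: ad_chi|apply: measurable_funM; exact: ac].
have ixi p : L1 (xi p).
  apply: (@bounded_L1 _ _ _ _ (B * B)).
    by apply: measurable_funM => //; exact: measurable_funM.
  move=> w; rewrite !normrM (@le_trans _ _ (`|c p.1 k w| * `|c p.2 k w|))//.
    by rewrite ler_piMl// mulr_ge0.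
  by rewrite ler_pM.
have h p := adapted_increment_prod cP wW (tau_ge k) (nd_tau k) (tau_le k.+1)
  (a p.1) (a p.2) (axi p) (ixi p).
have [_ hs] := Rintegral_sum (enum (fun _ : 'I_n * 'I_n => true)) (fun i => (h i).1).
transitivity (E (fun w => \sum_(p <- enum (fun _ : 'I_n * 'I_n => true))
    xi p w * (inc k (a p.1) w * inc k (a p.2) w))).
  apply: eq_Rintegral => w _; rewrite big_enum /= exprMn.
  have -> : chi k w ^+ 2 = chi k w by case: (chi01 k w) => ->; rewrite ?expr0n ?expr1n.
  rewrite -(pair_bigA _ (fun i j => xi (i, j) w * (inc k (a i) w * inc k (a j) w))) /=.
  rewrite expr2 /ito_step mulr_suml mulr_sumr; apply: eq_bigr => i _.
  rewrite !mulr_sumr; apply: eq_bigr => j _; rewrite /xi /=; ring.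
rewrite hs (eq_bigr _ (fun i _ => (h i).2)).
pose g (p : 'I_n * 'I_n) w := (tau k.+1 - tau k) * dot (a p.1) (a p.2) * xi p w.
have ig p : L1 (g p) by exact: (integrableZl measurableT _ (ixi p)).
have [_ gs] := Rintegral_sum (enum (fun _ : 'I_n * 'I_n => true)) ig.
transitivity (gauss2 R * E (fun w => \sum_(p <- enum (fun _ : 'I_n * 'I_n => true)) g p w)).
  rewrite gs mulr_sumr; apply: eq_bigr => p _.
  by rewrite /g (RintegralZl _ measurableT (ixi p)) !mulrA.
congr (_ * _); apply: eq_Rintegral => w _; rewrite big_enum /= /chiV energyE.
rewrite -(pair_bigA _ (fun i j => g (i, j) w)) /= mulr_sumr; apply: eq_bigr => i _.
rewrite mulr_sumr; apply: eq_bigr => j _; rewrite /g /xi /=; ring.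
Qed.

Let isometry k : E (fun w => M k w ^+ 2) = gauss2 R * \sum_(0 <= j < k) E (chiV j).
Proof.
elim: k => [|k IH].
  rewrite big_geq// mulr0 (_ : (fun w => _) = fun=> 0) ?Rintegral_cst ?mul0r//.
  by apply/funext => w; rewrite /M big_geq// expr0n.
rewrite big_nat_recr//= mulrDr -IH -square.
have X_L2 : (fun w => chi k w * ito_step k w) \in Lfun P 2%:E.
  exact: (bounded_mul_Lfun2 (B := 1)).
have i1 : L1 (fun w => M k w ^+ 2) by exact: Lfun2_integrable_sqr (M_L2 k).
have i2 : L1 (fun w => (chi k w * ito_step k w) ^+ 2).
  exact: Lfun2_integrable_sqr X_L2.
have i3 := Lfun2_mulL1 (M_L2 k) X_L2.
have i4 : L1 (fun w => 2 * (M k w * (chi k w * ito_step k w))).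
  exact: (integrableZl measurableT 2 i3).
have i5 : L1 (fun w => M k w ^+ 2 + 2 * (M k w * (chi k w * ito_step k w))).
  exact: (integrableD measurableT i1 i4).
transitivity (E (fun w => M k w ^+ 2 + 2 * (M k w * (chi k w * ito_step k w)) +
    (chi k w * ito_step k w) ^+ 2)).
  by apply: eq_Rintegral => w _; rewrite /M big_nat_recr//=; ring.
rewrite (RintegralD measurableT i5 i2) (RintegralD measurableT i1 i4).
by rewrite (RintegralZl 2 measurableT i3) cross mulr0 addr0.
Qed.

(** [A] is nondecreasing: if the last step is kept, [A m.+1 <= delta] bounds the whole sum, and
    otherwise its last term vanishes. *)
Let sum_chiV m w : \sum_(0 <= j < m) chiV j w <= delta.
Proof.
elim: m => [|m IH]; first by rewrite big_geq.
have [Am|Am] := boolP (A m.+1 w <= delta).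
  apply: le_trans Am; apply: ler_sum => j _; rewrite /chiV ler_piMl ?ito_energy_ge0//.
  by case: (chi01 j w) => ->.
rewrite big_nat_recr//= /chiV /chi indicE memNset ?mul0r ?addr0//=.
exact/negP.
Qed.

Let gauss2_ge0 : 0 <= gauss2 R.
Proof. by rewrite fine_ge0// integral_ge0// => x _; rewrite lee_fin sqr_ge0. Qed.

(** Where the total energy is at most [delta], no step is discarded and the stopped sum is the
    original one. On the rest of the event Chebyshev's inequality is applied to the stopped sum
    [M m], whose second moment is at most [gauss2 R * delta]. *)
Lemma ito_tail m eps : 0 < eps ->
  (P [set w | (eps <= `|\sum_(0 <= k < m) ito_step k w|)%R] <=
   P [set w | (delta < \sum_(0 <= k < m) ito_energy k w)%R] +
   (gauss2 R * delta / eps ^+ 2)%:E)%E.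
Proof.
move=> eps0.
have e20 : 0 < eps ^+ 2 by rewrite exprn_gt0.
have mS : measurable_fun setT (fun w => \sum_(0 <= k < m) ito_step k w).
  by apply: measurable_sum => k; exact: Lfun2_measurable.
have mM : measurable_fun setT (M m) by exact: Lfun2_measurable.
have mA : measurable_fun setT (A m).
  apply: measurable_sum => k.
  exact: (adapted_measurable cP wW (tau_le k) (@ad_energy k)).
have ms1 (f : Omega -> R) : measurable_fun setT f -> measurable [set w | eps <= `|f w|].
  move=> mf; rewrite (_ : [set w | _] = (fun w => `|f w|) @^-1` `[eps, +oo[%classic).
    rewrite -[X in measurable X]setTI.
    have mf' : measurable_fun setT (fun w => `|f w|) by exact: measurableT_comp.
    exact: mf'.
  by apply/seteqP; split=> w /=; rewrite in_itv /= andbT.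
have ms2 : measurable [set w | delta < A m w].
  rewrite (_ : [set w | _] = A m @^-1` `]delta, +oo[%classic).
    by rewrite -[X in measurable X]setTI; exact: mA.
  by apply/seteqP; split=> w /=; rewrite in_itv /= andbT.
have sub : [set w | eps <= `|\sum_(0 <= k < m) ito_step k w|] `<=`
    [set w | delta < A m w] `|` [set w | eps <= `|M m w|].
  move=> w /= h; have [Am|Am] := boolP (A m w <= delta); last by left; rewrite ltNge.
  right; suff -> : M m w = \sum_(0 <= k < m) ito_step k w by [].
  rewrite /M big_nat [RHS]big_nat; apply: eq_bigr => j /andP[_ jm].
  rewrite /chi indicE mem_set ?mul1r//=; apply: le_trans Am.
  rewrite /A (@big_cat_nat _ _ _ j.+1 0 m)//= lerDl.
  by apply: sumr_ge0 => i _; exact: ito_energy_ge0.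
apply: le_trans (le_measure P _ _ sub) _; rewrite ?inE; [exact: ms1|apply: measurableU;
  [exact: ms2|exact: ms1]|].
apply: le_trans (measureU2 _ _ _) _; [exact: ms2|exact: ms1|].
rewrite leeD2l//.
have mM2 : measurable_fun setT (fun w => (M m w ^+ 2)%:E).
  by apply/measurable_EFinP; exact: measurable_funX.
have markov := le_integral_abse P measurableT mM2 e20.
have E2 : (\int[P]_w `|(M m w ^+ 2)%:E| <= (gauss2 R * delta)%:E)%E.
  have i1 : L1 (fun w => M m w ^+ 2) by exact: Lfun2_integrable_sqr (M_L2 m).
  rewrite (eq_integral (fun w => (M m w ^+ 2)%:E)); last first.
    by move=> w _; rewrite gee0_abs// lee_fin sqr_ge0.
  rewrite -(fineK (integrable_fin_num measurableT i1)) lee_fin.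
  rewrite -/(Rintegral P setT (fun w => M m w ^+ 2)) isometry ler_wpM2l//.
  have [i2 <-] := Rintegral_sum (index_iota 0 m) chiV_L1.
  apply: (@le_trans _ _ (E (fun=> delta))).
    by apply: le_Rintegral => //; exact: finite_measure_integrable_cst.
  by rewrite Rintegral_cst// [X in fine X](probability_setT P) mulr1.
have : ((eps ^+ 2)%:E * P [set w | eps <= `|M m w|]%R <= (gauss2 R * delta)%:E)%E.
  apply: le_trans E2; apply: le_trans markov; rewrite setTI.
  have sq (x : R) : (eps ^+ 2 <= x ^+ 2) = (eps <= `|x|).
    by rewrite -[x ^+ 2]real_normK ?num_real// ler_pXn2r ?nnegrE// ltW.
  rewrite (_ : [set w | _] = [set x | (eps ^+ 2)%:E <= `|(M m x ^+ 2)%:E|]%E)//.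
  by apply/seteqP; split=> w; rewrite /mkset gee0_abs lee_fin ?sqr_ge0// sq.
by rewrite -lee_pdivlMl// -EFinM mulrC.
Qed.

End ito.

Lemma sum_range_indicator (R : pzSemiRingType) (lo hi m : nat) (x : nat -> R) :
  (lo <= hi)%N -> (hi <= m)%N ->
  \sum_(0 <= k < m) ((lo <= k < hi)%N%:R * x k) = \sum_(lo <= k < hi) x k.
Proof.
move=> lohi him; rewrite (@big_cat_nat _ _ _ lo)//=; last exact: leq_trans him.
rewrite (@big_cat_nat _ _ _ hi lo)//= big_nat big1 ?add0r; last first.
  by move=> k /andP[_ kl]; rewrite leqNgt kl mul0r.
rewrite [X in _ + X]big_nat [X in _ + X]big1 ?addr0; last first.
  by move=> k /andP[hk _]; rewrite [(k < hi)%N]ltnNge hk andbF mul0r.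
by rewrite big_nat [RHS]big_nat; apply: eq_bigr => k ->; rewrite mul1r.
Qed.

Section grid.
Context (R : realType) (Xi : hilbertType R) d (Omega : measurableType d)
  (P : probability Omega R) (W : R -> Xi -> Omega -> R) (t T : R).
Hypotheses (cP : measure_is_complete P) (wW : cylindrical_wiener P W t T).
Context (s : R) (ts : t <= s) (sT : s <= T).
Context (n : nat) (st sp : 'I_n -> R) (cf : 'I_n -> Omega -> R) (dr : 'I_n -> Xi).
Hypotheses (t_st : forall i, t <= st i) (st_sp : forall i, st i <= sp i)
  (sp_s : forall i, sp i <= s)
  (cf_bnd : forall i, exists B, forall w, `|cf i w| <= B)
  (cf_ad : forall i, adapted P W t (st i) (cf i)).

(** All start and stop times are merged into one sorted grid, which brings the sum into the form of
    [ito_tail]. The set [N] covers the event of large energy, as provided by convergence in outer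
    probability. *)
Lemma elementary_tail (delta eps : R) (N : set Omega) : 0 <= delta -> 0 < eps ->
  measurable N ->
  (forall w, (delta%:E < \int[lebesgue_measure]_(r in `[t, s])
    (`|\sum_(i < n) (\1_(`]st i, sp i]%classic) r * cf i w) *: dr i| ^+ 2)%:E)%E -> N w) ->
  (P [set w | (eps <= `|\sum_(i < n) cf i w * increment W (st i) (sp i) (dr i) w|)%R] <=
   P N + (gauss2 R * delta / eps ^+ 2)%:E)%E.
Proof.
move=> delta0 eps0 mN hN.
pose L := sort <=%R ([seq st i | i <- enum 'I_n] ++ [seq sp i | i <- enum 'I_n]).
(* The default [s] keeps [tau] nondecreasing and inside [[t, s]] past the end of the list. *)
pose tau k := nth s L k.
have L_in x : x \in L -> t <= x <= s.
  rewrite mem_sort mem_cat => /orP[] /mapP[i _ ->].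
    by rewrite t_st (le_trans (st_sp i) (sp_s i)).
  by rewrite sp_s (le_trans (t_st i) (st_sp i)).
have tau_in k : t <= tau k <= s.
  have [kL|kL] := ltnP k (size L); first by apply: L_in; exact: mem_nth.
  by rewrite /tau nth_default// ts lexx.
have tau_ge k : t <= tau k by have /andP[] := tau_in k.
have tau_les k : tau k <= s by have /andP[] := tau_in k.
have tau_le k : tau k <= T by exact: le_trans sT.
have nd_tau k : tau k <= tau k.+1.
  have [kL|kL] := ltnP k.+1 (size L); last by rewrite {2}/tau nth_default.
  by have /(sortedP s) := sort_le_sorted ([seq st i | i <- enum 'I_n] ++ [seq sp i | i <- enum
    'I_n]); exact.
have homo_tau k l : (k <= l)%N -> tau k <= tau l.
  by move=> kl; apply: (homo_leq (@lexx _ _) (@le_trans _ _) nd_tau).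
pose sg i := index (st i) L; pose up i := index (sp i) L.
have stL i : st i \in L by rewrite mem_sort mem_cat map_f ?mem_enum.
have spL i : sp i \in L by rewrite mem_sort mem_cat [X in _ || X]map_f ?mem_enum ?orbT.
have tau_sg i : tau (sg i) = st i by exact: nth_index.
have tau_up i : tau (up i) = sp i by exact: nth_index.
have sg_up i : (sg i <= up i)%N.
  rewrite leqNgt; apply/negP => h; have := homo_tau _ _ (ltnW h).
  rewrite tau_sg tau_up => h2.
  have e : sp i = st i by apply/eqP; rewrite eq_le h2 st_sp.
  by move: h; rewrite /sg /up e ltnn.
pose m := size L.
have up_m i : (up i <= m)%N by exact: index_size.
(* The coefficient is switched on only in the cells between its own two times, hence after [st i];
   this makes it adapted at [tau k]. *)
pose c i k w := (sg i <= k < up i)%N%:R * cf i w.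
have ac i k : adapted P W t (tau k) (c i k).
  rewrite /c; have [/andP[h _]|_] := boolP (sg i <= k < up i)%N; last first.
    rewrite /adapted (_ : (fun w => _) = fun=> 0); first exact: measurable_cst.
    by apply/funext => w; rewrite mul0r.
  rewrite (_ : (fun w => _) = cf i); last by apply/funext => w; rewrite mul1r.
  by apply: adapted_mono (@cf_ad i); rewrite -tau_sg; exact: homo_tau.
have /(_ _)/cid-/all_sig[b hb] := cf_bnd.
pose B := \sum_(i < n) `|b i|.
have bc i k w : `|c i k w| <= B.
  rewrite /c normrM (@le_trans _ _ `|cf i w|)//.
    by case: (sg i <= k < up i)%N; rewrite ?normr1 ?mul1r// normr0 mul0r.
  rewrite (le_trans (hb i w))// (le_trans (ler_norm _))// /B (bigD1 i)//= lerDl.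
  by apply: sumr_ge0.
have key := @ito_tail _ _ _ _ _ _ _ _ cP wW n tau c dr nd_tau tau_ge tau_le ac B bc
  delta delta0 m eps eps0.
have sumE w : \sum_(0 <= k < m) ito_step W tau c dr k w =
    \sum_(i < n) cf i w * increment W (st i) (sp i) (dr i) w.
  rewrite /ito_step exchange_big /=; apply: eq_bigr => i _.
  transitivity (cf i w * \sum_(0 <= k < m) ((sg i <= k < up i)%N%:R *
      increment W (tau k) (tau k.+1) (dr i) w)).
    by rewrite mulr_sumr; apply: eq_bigr => k _; rewrite /c; ring.
  rewrite sum_range_indicator// /increment telescope_sumr//.
  by rewrite tau_up tau_sg.
rewrite (_ : [set w | _] = [set w | eps <= `|\sum_(0 <= k < m) ito_step W tau c dr k w|]);
  last first.
  by apply/seteqP; split=> w; rewrite /mkset sumE.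
apply: le_trans key _; rewrite leeD2r// le_measure ?inE//.
  have mE k : measurable_fun setT (ito_energy tau c dr k).
    have e w : ito_energy tau c dr k w = \sum_(i < n) \sum_(j < n)
        (tau k.+1 - tau k) * dot (dr i) (dr j) * (c i k w * c j k w).
      rewrite /ito_energy -dotxx dot_suml mulr_suml; apply: eq_bigr => i _.
      rewrite dot_sumr mulr_suml; apply: eq_bigr => j _; rewrite dotZl dotZr; ring.
    rewrite (_ : ito_energy _ _ _ _ = fun w => \sum_(i < n) \sum_(j < n)
        (tau k.+1 - tau k) * dot (dr i) (dr j) * (c i k w * c j k w)); last exact/funext/e.
    have mc i : measurable_fun setT (c i k) by exact: (adapted_measurable cP wW (tau_le k) (@ac
      i k)).
    apply: measurable_sum => i; apply: measurable_sum => j.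
    by apply: measurable_funM => //; exact: measurable_funM.
  rewrite (_ : [set w | _] = (fun w => \sum_(0 <= k < m) ito_energy tau c dr k w) @^-1`
    `]delta, +oo[%classic).
    rewrite -[X in measurable X]setTI.
    have ms : measurable_fun setT (fun w => \sum_(0 <= k < m) ito_energy tau c dr k w).
      by apply: measurable_sum => k.
    exact: ms.
  by apply/seteqP; split=> w /=; rewrite in_itv /= andbT.
move=> w /= dw; apply: hN; apply: lt_le_trans (_ : ((\sum_(0 <= k < m) ito_energy tau c dr k
  w)%:E <= _)%E).
  by rewrite lte_fin.
pose g r : R := `|\sum_(i < n) (\1_(`]st i, sp i]%classic) r * cf i w) *: dr i| ^+ 2.
have mg : measurable_fun setT g.
  have e r : g r = \sum_(i < n) \sum_(j < n) dot (dr i) (dr j) *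
      ((\1_(`]st i, sp i]%classic) r * cf i w) * (\1_(`]st j, sp j]%classic) r * cf j w)).
    rewrite /g -dotxx dot_suml; apply: eq_bigr => i _.
    rewrite dot_sumr; apply: eq_bigr => j _; rewrite dotZl dotZr; ring.
  rewrite (_ : g = fun r => \sum_(i < n) \sum_(j < n) dot (dr i) (dr j) *
      ((\1_(`]st i, sp i]%classic) r * cf i w) * (\1_(`]st j, sp j]%classic) r * cf j w)));
        last exact/funext/e.
  apply: measurable_sum => i; apply: measurable_sum => j.
  by apply: measurable_funM => //; apply: measurable_funM; apply: measurable_funM => //;
    exact: measurable_indic.
have mgE (D : set R) : measurable_fun D (fun r => (g r)%:E).
  by apply/measurable_EFinP; exact: measurable_funTS.
have g0 r : (0 <= (g r)%:E)%E by rewrite lee_fin sqr_ge0.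
(* No start or stop time lies strictly inside a cell, and left-open cells match the left-open
   supports, so every indicator is constant on a cell. *)
have gE k r : tau k < r <= tau k.+1 -> g r = `|\sum_(i < n) c i k w *: dr i| ^+ 2.
  move=> /andP[kr rk]; rewrite /g; congr (`|_| ^+ 2); apply: eq_bigr => i _.
  congr (_ *: _); rewrite /c indicE; congr (_%:R * _).
  rewrite -[in RHS]/((sg i <= k) && (k < up i))%N; congr nat_of_bool.
  apply/idP/idP; rewrite inE /= in_itv /=; last first.
    move=> /andP[h1 h2]; apply/andP; split.
      by rewrite -tau_sg (le_lt_trans (homo_tau _ _ h1)).
    by rewrite -tau_up (le_trans rk)// homo_tau.
  move=> /andP[h1 h2]; apply/andP; split; rewrite leqNgt; apply/negP.
    move=> /homo_tau; rewrite tau_sg => h; move: (lt_le_trans h1 rk); by rewrite ltNge h.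
  rewrite ltnS => /homo_tau; rewrite tau_up => h; move: (lt_le_trans kr h2); by rewrite ltNge h.
have stepE k : (\int[lebesgue_measure]_(r in `]tau k, tau k.+1]) (g r)%:E =
    (ito_energy tau c dr k w)%:E)%E.
  rewrite (eq_integral (fun=> (`|\sum_(i < n) c i k w *: dr i| ^+ 2)%:E)); last first.
    by move=> r; rewrite inE /= in_itv /= => /gE ->.
  rewrite integral_cst//= lebesgue_measure_itv /= lte_fin /ito_energy.
  have := nd_tau k; rewrite le_eqVlt => /orP[/eqP ->|h].
    by rewrite ltxx subrr mulr0 mule0.
  by rewrite h -EFinB -EFinM.
have sumg l : ((\sum_(0 <= k < l) ito_energy tau c dr k w)%:E =
    \int[lebesgue_measure]_(r in `]tau 0%N, tau l]) (g r)%:E)%E.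
  elim: l => [|l IH]; first by rewrite big_geq// set_itvoc0 integral_set0.
  rewrite big_nat_recr//= EFinD IH -stepE -ge0_integral_setU//.
  - by congr integral; rewrite -itv_bndbnd_setU// ?bnd_simp// homo_tau.
  - exact: mgE.
  - rewrite disj_set2E; apply/eqP/seteqP; split=> r //=; rewrite !in_itv /=.
    by move=> [/andP[_ h1] /andP[h2 _]]; move: (lt_le_trans h2 h1); rewrite ltxx.
rewrite sumg; apply: ge0_subset_integral => //; first exact: mgE.
move=> r /=; rewrite !in_itv /= => /andP[h1 h2].
by rewrite (ltW (le_lt_trans (tau_ge 0%N) h1)) (le_trans h2).
Qed.

End grid.

(** * Uniqueness of the stochastic integral *)

Lemma cvge0_near_lt (R : realType) (f : nat -> \bar R) (e : R) : 0 < e ->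
  f n @[n --> \oo] --> 0%E -> \forall n \near \oo, (f n < e%:E)%E.
Proof.
move=> e0 /fine_cvgP[h1 /cvgrPdist_lt/(_ _ e0) h2].
move: h1 h2; apply: filterS2 => n fn; rewrite /= sub0r normrN => h.
by rewrite -(fineK fn) lte_fin (le_lt_trans (ler_norm _)).
Qed.

Section uniqueness.
Context (R : realType) (Xi : hilbertType R) (H : innerProductType R)
  d (Omega : measurableType d)
  (P : probability Omega R) (W : R -> Xi -> Omega -> R) (t T : R).
Hypotheses (sepXi : separable Xi) (cP : measure_is_complete P)
  (wW : cylindrical_wiener P W t T).
Context (s : R) (ts : t <= s) (sT : s <= T).
Context (Phi : Omega -> R -> Xi -> H) (h : H) (h1 : `|h| <= 1).
Hypothesis Phi0 : forall w r, t <= r <= s -> Phi w r 0 = 0.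
Hypothesis mPhi : forall w e, e = 0 \/ onb e ->
  measurable_fun `[t, s] (fun r => dot (Phi w r e) h).

Let cf (p : elementary_process Xi H Omega) i w := elem_coef p i w * dot (elem_value p i) h.
(** The Riesz vector of the functional that sends [x] to [dot (elem_eval p w r x) h]. *)
Let vec (p : elementary_process Xi H Omega) w r : Xi := \sum_(i < elem_size p)
  (\1_(`]elem_start p i, elem_stop p i]%classic) r * cf p i w) *: elem_dir p i.

Let elem_eval_dot p w r x : dot (elem_eval p w r x) h = dot (vec p w r) x.
Proof.
rewrite /elem_eval big_mkcond /= !dot_suml; apply: eq_bigr => i _.
rewrite dotZl /cf indicE; have [hr|hr] := boolP (_ < r <= _).
  by rewrite mem_set /= ?in_itv//= mul1r dotZl; ring.
by rewrite memNset ?mul0r ?dot0l//= in_itv /=; exact/negP.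
Qed.

(** By Parseval the left-hand side sums squares of differences of two errors [beta], each at most
    [2 (G p + G q)] termwise. As [|h| <= 1], [G] is below the Hilbert-Schmidt distance; unlike that
    distance, it is known to be measurable. The quarters come from
    [2 (delta / 4 + delta / 4) = delta]. *)
Let energy_bound (p q : elementary_process Xi H Omega) w (delta : R) :
  (\int[lebesgue_measure]_(r in `[t, s])
     hs_norm2 (fun x => Phi w r x - elem_eval p w r x)%R <= (delta / 4)%:E)%E ->
  (\int[lebesgue_measure]_(r in `[t, s])
     hs_norm2 (fun x => Phi w r x - elem_eval q w r x)%R <= (delta / 4)%:E)%E ->
  (\int[lebesgue_measure]_(r in `[t, s]) (`|vec p w r - vec q w r| ^+ 2)%:E
     <= delta%:E)%E.
Proof.
move=> hp hq.
have [e [e0 eo es]] := onb_sequence sepXi.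
pose beta u k r := dot (Phi w r (e k) - elem_eval u w r (e k)) h.
have mvec u k : measurable_fun setT (fun r => dot (vec u w r) (e k)).
  rewrite /vec; under eq_fun do rewrite dot_suml.
  apply: measurable_sum => i; under eq_fun do rewrite dotZl.
  by do 2 apply: measurable_funM => //; exact: measurable_indic.
have mD : measurable (`[t, s]%classic : set R) by exact: measurable_itv.
have mbeta u k : measurable_fun `[t, s] (beta u k).
  rewrite (_ : beta u k = fun r => dot (Phi w r (e k)) h - dot (vec u w r) (e k)); last first.
    by apply/funext => r; rewrite /beta dotBl elem_eval_dot.
  by apply: measurable_funB; [exact: mPhi|exact: measurable_funTS].
pose G u r := (\sum_(k <oo) (beta u k r ^+ 2)%:E)%E.
have mG u : measurable_fun `[t, s] (G u).
  apply: (@ge0_emeasurable_sum _ _ _ `[t, s]%classic (fun k r => (beta u k r ^+ 2)%:E) xpredT).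
    by move=> k r _ _; rewrite lee_fin sqr_ge0.
  by move=> k _; apply/measurable_EFinP; exact: measurable_funX.
have G0 u r : (0 <= G u r)%E by apply: nneseries_ge0 => k _ _; rewrite lee_fin sqr_ge0.
have GI u : (\int[lebesgue_measure]_(r in `[t, s]) G u r <=
    \int[lebesgue_measure]_(r in `[t, s]) hs_norm2 (fun x => Phi w r x - elem_eval u w r x)%R)%E.
  apply: ge0_le_integral_lower => r /=; rewrite in_itv /= => tr //.
  have E0 : Phi w r 0 - elem_eval u w r 0 = 0.
    rewrite Phi0// sub0r /elem_eval big1 ?oppr0// => i _.
    by rewrite dot0r mulr0 scale0r.
  rewrite (hs_norm2E e0 eo es (Phi := fun x => Phi w r x - elem_eval u w r x) E0).
  apply: lee_nneseries => [k _|k _]; first by rewrite lee_fin sqr_ge0.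
  rewrite lee_fin -[leLHS]real_normK ?num_real// ler_pXn2r ?nnegrE//.
  by rewrite (le_trans (cauchy_schwarz_abs _ _))// ler_piMr.
have key r : ((`|vec p w r - vec q w r| ^+ 2)%:E <= 2%:E * (G p r + G q r))%E.
  rewrite -(parseval e0 eo es) /G -nneseriesD; last 2 first.
    by move=> k _; rewrite lee_fin sqr_ge0.
    by move=> k _; rewrite lee_fin sqr_ge0.
  rewrite -nneseriesZl//; last by move=> k _; rewrite -EFinD lee_fin addr_ge0 ?sqr_ge0.
  apply: lee_nneseries => [k _|k _]; first by rewrite lee_fin sqr_ge0.
  rewrite -EFinD -EFinM lee_fin dotBl -!elem_eval_dot /beta !dotBl.
  set x := dot (elem_eval p _ _ _) h; set y := dot (elem_eval q _ _ _) h.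
  set z := dot (Phi _ _ _) h; have := sqr_ge0 ((z - x) + (z - y)).
  by nra.
apply: (@le_trans _ _ (\int[lebesgue_measure]_(r in `[t, s]) (2%:E * (G p r + G q r)))%E).
  by apply: ge0_le_integral_lower => r _ //; rewrite lee_fin sqr_ge0.
have mS : measurable_fun `[t, s] (fun r => G p r + G q r)%E by exact: emeasurable_funD.
have S0 r : (0 <= G p r + G q r)%E by rewrite adde_ge0.
rewrite (@ge0_integralZl_EFin _ (measurableTypeR R) R (@lebesgue_measure R) _ mD
  (fun r => G p r + G q r)%E (fun r _ => S0 r) mS 2 (ler0n _ 2)).
rewrite (@ge0_integralD _ (measurableTypeR R) R (@lebesgue_measure R) _ mD (G p) (G q)
  (fun r _ => G0 p r) (mG p) (fun r _ => G0 q r) (mG q)).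
apply: (@le_trans _ _ (2%:E * ((delta / 4)%:E + (delta / 4)%:E))%E).
  by apply: lee_wpmul2l; rewrite ?lee_fin//; apply: leeD; [exact: le_trans hp|exact: le_trans hq].
by rewrite -EFinD -EFinM lee_fin; lra.
Qed.

(** The difference is again an elementary sum, over the disjoint union of the two index sets, with
    the second family of coefficients negated. *)
Let ito_tail_diff (p q : elementary_process Xi H Omega) (delta eps : R) (N : set Omega) :
  elementary_on P W t s p -> elementary_on P W t s q ->
  0 <= delta -> 0 < eps -> measurable N ->
  (forall w, (delta%:E < \int[lebesgue_measure]_(r in `[t, s])
    (`|vec p w r - vec q w r| ^+ 2)%:E)%E -> N w) ->
  (P [set w | (eps <= `|dot (elem_integral W p w) h - dot (elem_integral W q w) h|)%R] <=
   P N + (gauss2 R * delta / eps ^+ 2)%:E)%E.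
Proof.
move=> hp hq delta0 eps0 mN hN.
pose n := (elem_size p + elem_size q)%N.
pose pick (A : Type) (f : elementary_process Xi H Omega -> nat -> A) (i : 'I_n) : A :=
  match fintype.split i with inl j => f p j | inr j => f q j end.
pose c (i : 'I_n) w : R := match fintype.split i with inl j => cf p j w | inr j => - cf q j w end.
have picked (Q : R -> R -> (Omega -> R) -> Prop) :
    (forall j, (j < elem_size p)%N -> Q (elem_start p j) (elem_stop p j) (cf p j)) ->
    (forall j, (j < elem_size q)%N -> Q (elem_start q j) (elem_stop q j) (fun w => - cf q j w)) ->
    forall i, Q (pick _ (@elem_start _ _ _ _ _) i) (pick _ (@elem_stop _ _ _ _ _) i) (c i).
  by move=> Qp Qq i; rewrite /pick /c; case: (fintype.split i) => j; [exact: Qp|exact: Qq].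
have bnd (u : elementary_process Xi H Omega) j : elementary_on P W t s u -> (j < elem_size u)%N ->
    exists B, forall w, `|cf u j w| <= B.
  move=> hu ju; have [_ _ _ [B hB] _] := hu j ju.
  by exists (B * `|dot (elem_value u j) h|) => w; rewrite normrM ler_wpM2r.
have adap (u : elementary_process Xi H Omega) j : elementary_on P W t s u -> (j < elem_size u)%N ->
    adapted P W t (elem_start u j) (cf u j).
  move=> hu ju; have [_ _ _ _ a] := hu j ju.
  by apply: measurable_funM => //; apply/adaptedP.
have := @elementary_tail _ _ _ _ P W t T cP wW s ts sT n
  (pick _ (@elem_start _ _ _ _ _)) (pick _ (@elem_stop _ _ _ _ _)) c
  (pick _ (@elem_dir _ _ _ _ _)) _ _ _ _ _ delta eps N delta0 eps0 mN.
have splitl j : fintype.split (lshift (elem_size q) j) = inl j :> 'I_(elem_size p) +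
  'I_(elem_size q).
  by rewrite -[lshift _ _]/(unsplit (inl _)) unsplitK.
have splitr j : fintype.split (rshift (elem_size p) j) = inr j :> 'I_(elem_size p) +
  'I_(elem_size q).
  by rewrite -[rshift _ _]/(unsplit (inr _)) unsplitK.
have sumE w : \sum_(i < n) c i w * increment W (pick _ (@elem_start _ _ _ _ _) i)
    (pick _ (@elem_stop _ _ _ _ _) i) (pick _ (@elem_dir _ _ _ _ _) i) w =
    dot (elem_integral W p w) h - dot (elem_integral W q w) h.
  rewrite big_split_ord /= /elem_integral !dot_suml -sumrN; congr (_ + _); apply: eq_bigr => j _.
    by rewrite /c /pick splitl dotZl /cf; ring.
  by rewrite /c /pick splitr dotZl /cf; ring.
have vecE w r : \sum_(i < n) (\1_(`]pick _ (@elem_start _ _ _ _ _) i,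
    pick _ (@elem_stop _ _ _ _ _) i]%classic) r * c i w) *: pick _ (@elem_dir _ _ _ _ _) i =
    vec p w r - vec q w r.
  rewrite big_split_ord /= /vec -sumrN; congr (_ + _); apply: eq_bigr => j _.
    by rewrite /c /pick splitl.
  by rewrite /c /pick splitr mulrN scaleNr.
move=> key.
rewrite (_ : [set w | _] = [set w | eps <= `|\sum_(i < n) c i w *
    increment W (pick _ (@elem_start _ _ _ _ _) i)
    (pick _ (@elem_stop _ _ _ _ _) i) (pick _ (@elem_dir _ _ _ _ _) i) w|]); last first.
  by apply/seteqP; split=> w; rewrite /mkset sumE.
apply: key.
- by apply: (picked (fun a b c => t <= a)) => j jn; [have [] := hp j jn|have [] := hq j jn].
- by apply: (picked (fun a b c => a <= b)) => j jn; [have [] := hp j jn|have [] := hq j jn].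
- by apply: (picked (fun a b c => b <= s)) => j jn; [have [] := hp j jn|have [] := hq j jn].
- apply: (picked (fun a b c => exists B, forall w, `|c w| <= B)) => j jn; first exact: bnd.
  by have [B hB] := bnd q j hq jn; exists B => w; rewrite normrN.
- apply: (picked (fun a b c => adapted P W t a c)) => j jn; first exact: adap.
  have := @adap q j hq jn; rewrite /adapted => a.
  rewrite (_ : (fun w => - cf q j w) = fun w => -1 * cf q j w); last first.
    by apply/funext => w; rewrite mulN1r.
  exact: measurable_funM.
- move=> w hw; apply: hN; apply: lt_le_trans hw _.
  by under eq_integral => r _ do rewrite vecE.
Qed.

Lemma measurable_borel_dot (Z : Omega -> H) (g : H) :
  (forall U, borel U -> measurable (Z @^-1` U)) ->
  measurable_fun setT (fun w => dot (Z w) g).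
Proof.
move=> mZ mT; apply: (measurability _ (RGenOInfty.measurableE R)) => //.
move=> _ [_ [a ->] <-]; rewrite setTI.
have : borel [set z : H | a < dot z g].
  apply: sub_sigma_algebra.
  apply: (@open_comp _ _ (fun z : H => dot z g) [set x | a < x]); last exact: open_gt.
  by move=> z _; exact: dot_continuousl.
move=> /mZ; congr (measurable _); apply/seteqP; split=> w /=; by rewrite in_itv /= andbT.
Qed.

Lemma stochastic_integral_unique Z1 Z2 :
  is_stochastic_integral P W t s Phi Z1 ->
  is_stochastic_integral P W t s Phi Z2 ->
  \forall w \ae P, dot (Z1 w - Z2 w) h = 0.
Proof.
move=> [mZ1 [p [p_on p_lim pZ]]] [mZ2 [q [q_on q_lim qZ]]].
have mD : measurable_fun setT (fun w => dot (Z1 w - Z2 w) h).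
  under eq_fun do rewrite dotBl.
  by apply: measurable_funB; exact: measurable_borel_dot.
(* Three errors of size [eps]: from [Z1] to the first elementary integral, between the two
   elementary integrals, and from the second one to [Z2]. *)
pose A eps := [set w | 3 * eps <= `|dot (Z1 w - Z2 w) h|].
have mA eps : measurable (A eps).
  rewrite (_ : A eps = (fun w => `|dot (Z1 w - Z2 w) h|) @^-1` `[3 * eps, +oo[%classic).
    rewrite -[X in measurable X]setTI.
    have m' : measurable_fun setT (fun w => `|dot (Z1 w - Z2 w) h|) by exact: measurableT_comp.
    exact: m'.
  by apply/seteqP; split=> w /=; rewrite in_itv /= andbT.
have PA eps : 0 < eps -> P (A eps) = 0%E.
  move=> eps0; apply/eqP; rewrite -measure_le0; apply/lee_addgt0Pr => theta theta0.
  rewrite add0e.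
  have g0 : 0 < gauss2 R + 1.
    by rewrite ltr_wpDl// fine_ge0// integral_ge0// => x _; rewrite lee_fin sqr_ge0.
  (* Chosen so that [gauss2 R * delta / eps ^+ 2 <= theta / 2]; the four exceptional sets, of
     probability below [theta / 8] each, account for the other half. *)
  pose delta := theta / 2 * eps ^+ 2 / (gauss2 R + 1).
  have delta0 : 0 < delta by rewrite /delta !divr_gt0 ?mulr_gt0 ?divr_gt0 ?exprn_gt0.
  have d40 : 0 < delta / 4 by rewrite divr_gt0.
  have th8 : 0 < theta / 8 by rewrite divr_gt0.
  have [N1 [hN1 cN1]] := p_lim _ d40; have [N2 [hN2 cN2]] := q_lim _ d40.
  have [N3 [hN3 cN3]] := pZ _ eps0; have [N4 [hN4 cN4]] := qZ _ eps0.
  have [n [[n1 n2] [n3 n4]]] : exists n, ((P (N1 n) < (theta / 8)%:E)%E /\ (P (N2 n) < (theta /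
    8)%:E)%E)
      /\ ((P (N3 n) < (theta / 8)%:E)%E /\ (P (N4 n) < (theta / 8)%:E)%E).
    have : \forall n \near \oo, ((P (N1 n) < (theta / 8)%:E)%E /\ (P (N2 n) < (theta / 8)%:E)%E)
      /\ ((P (N3 n) < (theta / 8)%:E)%E /\ (P (N4 n) < (theta / 8)%:E)%E).
      by apply: filterI; apply: filterI; exact: cvge0_near_lt.
    by move=> [n _ /(_ n (leqnn n))]; exists n.
  have [m1 s1] := hN1 n; have [m2 s2] := hN2 n; have [m3 s3] := hN3 n; have [m4 s4] := hN4 n.
  pose B := [set w | eps <= `|dot (elem_integral W (p n) w) h - dot (elem_integral W (q n) w) h|].
  have PB : (P B <= P (N1 n `|` N2 n) + (gauss2 R * delta / eps ^+ 2)%:E)%E.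
    apply: ito_tail_diff => //; [exact: ltW|exact: measurableU|move=> w].
    move=> hw; apply: contrapT => /not_orP[w1 w2]; move: hw; apply/negP; rewrite -leNgt.
    apply: energy_bound; rewrite leNgt; apply/negP => hlt; [apply: w1; exact: s1|apply: w2;
      exact: s2].
  have mB : measurable B.
    have mI u (r : elementary_process Xi H Omega) : elementary_on P W t s r ->
        u = r -> measurable_fun setT (fun w => dot (elem_integral W r w) h).
      move=> hr _; rewrite /elem_integral; under eq_fun do rewrite dot_suml.
      apply: measurable_sum => i; under eq_fun do rewrite dotZl.
      have [h_1 h_2 h_3 _ h_5] := hr i (ltn_ord i).
      apply: measurable_funM => //; apply: measurable_funM.
        apply: (adapted_measurable cP wW (le_trans h_2 (le_trans h_3 sT))).
        exact/adaptedP.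
      by apply: (measurable_increment wW h_1 h_2 (le_trans h_3 sT)).
    rewrite (_ : B = (fun w => `|dot (elem_integral W (p n) w) h - dot (elem_integral W (q n)
      w) h|) @^-1` `[eps, +oo[%classic).
      rewrite -[X in measurable X]setTI.
      have m' : measurable_fun setT (fun w => `|dot (elem_integral W (p n) w) h - dot
        (elem_integral W (q n) w) h|).
        by apply: measurableT_comp => //; apply: measurable_funB; exact: mI.
      exact: m'.
    by apply/seteqP; split=> w /=; rewrite in_itv /= andbT.
  have sub : A eps `<=` (N3 n `|` N4 n) `|` B.
    move=> w Aw; apply: contrapT => /not_orP[/not_orP[w3 w4] wB]; move: Aw; apply/negP.
    rewrite -ltNge.
    have l3 : `|dot (Z1 w - elem_integral W (p n) w) h| <= eps.
      have : ~ (eps%:E < `|Z1 w - elem_integral W (p n) w|%:E)%E by move=> hlt; apply: w3;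
        exact: s3.
      move/negP; rewrite -leNgt lee_fin => l.
      by rewrite (le_trans (cauchy_schwarz_abs _ _))// (le_trans _ l)// ler_piMr.
    have l4 : `|dot (Z2 w - elem_integral W (q n) w) h| <= eps.
      have : ~ (eps%:E < `|Z2 w - elem_integral W (q n) w|%:E)%E by move=> hlt; apply: w4;
        exact: s4.
      move/negP; rewrite -leNgt lee_fin => l.
      by rewrite (le_trans (cauchy_schwarz_abs _ _))// (le_trans _ l)// ler_piMr.
    have lB : `|dot (elem_integral W (p n) w) h - dot (elem_integral W (q n) w) h| < eps.
      by rewrite ltNge; apply/negP.
    move: l3 l4 lB; rewrite !dotBl !ler_norml !ltr_norml.
    by move=> /andP[? ?] /andP[? ?] /andP[? ?]; apply/andP; split; lra.
  have PU (X Y : set Omega) : measurable X -> measurable Y -> (P (X `|` Y) <= P X + P Y)%E.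
    by move=> mX mY; exact: measureU2.
  apply: le_trans (le_measure P _ _ sub) _; rewrite ?inE; [exact: mA|
    by apply: measurableU => //; exact: measurableU|].
  apply: le_trans (PU _ _ (measurableU _ _ m3 m4) mB) _.
  apply: (@le_trans _ _ ((P (N3 n) + P (N4 n)) + ((P (N1 n) + P (N2 n)) +
     (gauss2 R * delta / eps ^+ 2)%:E))%E).
    by apply: leeD; [exact: PU|apply: le_trans PB _; apply: leeD => //; exact: PU].
  apply: (@le_trans _ _ (((theta / 8)%:E + (theta / 8)%:E) + (((theta / 8)%:E + (theta / 8)%:E) +
     (theta / 2)%:E))%E).
    apply: leeD; first by apply: leeD; exact: ltW.
    apply: leeD; first by apply: leeD; exact: ltW.
    rewrite lee_fin /delta.
    rewrite (_ : _ / _ = theta / 2 * (gauss2 R / (gauss2 R + 1))); last first.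
      by field; rewrite /= !gt_eqF.
    by rewrite ler_piMr ?divr_ge0 ?(ltW theta0)// ler_pdivrMr// mul1r lerDl.
  by rewrite -!EFinD lee_fin; lra.
have [N NE] : exists N : nat -> set Omega, forall k, N k = A (k.+1%:R^-1).
  by exists (fun k => A (k.+1%:R^-1)).
exists (\bigcup_k N k); split.
- by apply: bigcupT_measurable => k; rewrite NE.
- have mN k : measurable (N k) by rewrite NE.
  have mUN : measurable (\bigcup_k N k) by exact: bigcupT_measurable.
  apply/eqP; rewrite -measure_le0.
  apply: le_trans (measure_sigma_subadditive P mN mUN (@subset_refl _ _)) _.
  by rewrite eseries0// => k _ _; rewrite /= NE PA.
- move=> w /= /eqP nz; have x0 : 0 < `|dot (Z1 w - Z2 w) h| / 3 by rewrite divr_gt0 ?normr_gt0.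
  have /cvgrPdist_lt/(_ _ x0)[k _ hk] := @cvg_harmonic R.
  exists k => //; rewrite NE /A /=; have := hk k (leqnn k).
  rewrite /harmonic /= sub0r normrN (ger0_norm (_ : 0 <= k.+1%:R^-1))//.
  move: (k.+1%:R^-1) `|_| => i y; lra.
Qed.

End uniqueness.

(** * Gronwall inequality for processes *)

Section ae_swap.
Context d (Omega : measurableType d) (R : realType) (P : probability Omega R).
Local Notation leb := (@lebesgue_measure R).

(** Tonelli for the indicator of [B]: the iterated integral that integrates over [Omega] first
    vanishes, hence so does the other one. *)
Lemma ae_swap (B : set (Omega * R)) : measurable B ->
  (forall r, \forall w \ae P, ~ B (w, r)) ->
  \forall w \ae P, \forall r \ae leb, ~ B (w, r).
Proof.
move=> mB hB.
pose g (z : Omega * R) : \bar R := (\1_B z)%:E.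
have mg : measurable_fun setT g by apply/measurable_EFinP; exact: measurable_indic.
have g0 z : (0 <= g z)%E by rewrite lee_fin.
have Fub := @fubini_tonelli _ _ Omega (measurableTypeR R) R P leb g mg g0.
have z0 : (\int[leb]_r \int[P]_w g (w, r) = 0)%E.
  apply: integral0_eq => r _.
  rewrite (@ae_eq_integral _ _ _ P setT (cst 0%E))//; first by rewrite integral0.
    by apply: measurableT_comp mg _; exact: measurable_pair2.
  by move: (hB r); apply: aeS => w nB _; rewrite /g indicE memNset.
rewrite z0 in Fub.
have mF : measurable_fun setT (fun w => \int[leb]_r g (w, r))%E.
  exact: (@measurable_fun_fubini_tonelli_F _ _ Omega (measurableTypeR R) R leb g mg g0).
have /(ae_eq_integral_abs P measurableT mF) : (\int[P]_w `|\int[leb]_r g (w, r)| = 0)%E.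
  rewrite -Fub; apply: eq_integral => w _; rewrite gee0_abs//.
  by apply: integral_ge0.
apply: aeS => w /(_ Logic.I) gw.
have mgw : measurable_fun setT (fun r : measurableTypeR R => g (w, r)).
  by apply: measurableT_comp mg _; exact: measurable_pair1.
have /(ae_eq_integral_abs leb measurableT mgw) : (\int[leb]_r `|g (w, r)| = 0)%E.
  rewrite -[RHS]/(cst 0%E w) -gw; apply: eq_integral => r _; by rewrite gee0_abs.
apply: aeS => r /(_ Logic.I) h Bwr; move: h; rewrite /g indicE mem_set//=.
by move=> [] /eqP; rewrite oner_eq0.
Qed.

End ae_swap.

Section gronwall.
Context (R : realType).
Local Notation leb := (@lebesgue_measure R).

(** The inequality holds only almost everywhere and [u] is merely integrable, so nothing is
    differentiated. On an interval with [C (b - a) <= 1/2], [U a = 0] forces [U b <= U b / 2], and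
    finitely many such intervals cover [[t, T]]. *)
Lemma gronwall_zero (t T C : R) (u : R -> R) : t <= T -> 0 <= C ->
  measurable_fun `[t, T] u -> (forall r, 0 <= u r) ->
  (\int[leb]_(r in `[t, T]) (u r)%:E < +oo)%E ->
  (\forall r \ae leb, t <= r <= T ->
    ((u r)%:E <= C%:E * \int[leb]_(q in `[t, r]) (u q)%:E)%E) ->
  (\int[leb]_(r in `[t, T]) (u r)%:E = 0)%E.
Proof.
move=> tT C0 mu u0 uoo hu.
pose U r : \bar R := (\int[leb]_(q in `[t, r]) (u q)%:E)%E.
have U0 r : (0 <= U r)%E by apply: integral_ge0 => q _; rewrite lee_fin.
have mur (D : set R) : measurable D -> D `<=` `[t, T]%classic ->
    measurable_fun D (fun q => (u q)%:E).
  by move=> mD sub; apply/measurable_EFinP; apply: measurable_funS mu.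
have itv_sub a b : t <= a -> b <= T -> `[a, b]%classic `<=` `[t, T]%classic.
  by move=> ta bT q /=; rewrite !in_itv /= => /andP[h1 h2];
    rewrite (le_trans ta h1) (le_trans h2 bT).
have Umono a b : a <= b -> b <= T -> (U a <= U b)%E.
  move=> ab bT; apply: ge0_subset_integral => //.
  - by apply: mur => //; exact: itv_sub.
  - by move=> q _; rewrite lee_fin.
  - by move=> q /=; rewrite !in_itv /= => /andP[-> h]; exact: le_trans ab.
have Ufin b : t <= b -> b <= T -> U b \is a fin_num.
  by move=> tb bT; rewrite ge0_fin_numE// (le_lt_trans (Umono b T bT (lexx _))).
have step a b : t <= a -> a <= b -> b <= T -> C * (b - a) <= 2^-1 -> U a = 0%E -> U b = 0%E.
  move=> ta ab bT Cab Ua.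
  have sub2 : `]a, b]%classic `<=` `[t, T]%classic.
    move=> q /=; rewrite !in_itv /= => /andP[h1 h2].
    by rewrite (le_trans ta (ltW h1)) (le_trans h2 bT).
  have Usplit : (U b = \int[leb]_(q in `]a, b]) (u q)%:E)%E.
    rewrite /U (_ : `[t, b]%classic = `[t, a]%classic `|` `]a, b]%classic); last first.
      by rewrite -itv_bndbnd_setU// ?bnd_simp.
    rewrite ge0_integral_setU//.
    - by rewrite -/(U a) Ua add0e.
    - apply: mur; first exact: measurableU.
      move=> q [|]; last exact: sub2.
      by apply: itv_sub => //; exact: le_trans bT.
    - by move=> q _; rewrite lee_fin.
    - rewrite disj_set2E; apply/eqP/seteqP; split=> q //=; rewrite !in_itv /=.
      by move=> [/andP[_ h1] /andP[h2 _]]; move: (lt_le_trans h2 h1); rewrite ltxx.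
  have bd : (\int[leb]_(q in `]a, b]) (u q)%:E <= \int[leb]_(q in `]a, b]) (C%:E * U b))%E.
    apply: (@ae_ge0_le_integral_lower _ (measurableTypeR R)) => //.
    - by apply: mur.
    - by move=> q _; rewrite lee_fin.
    - by move=> q _; rewrite mule_ge0// lee_fin.
    - move: hu; apply: aeS => q hq /=; rewrite in_itv /= => /andP[aq qb].
      have tq : t <= q <= T by rewrite (le_trans ta (ltW aq)) (le_trans qb bT).
      apply: le_trans (hq tq) _; apply: lee_wpmul2l; rewrite ?lee_fin//.
      exact: Umono.
  have tb : t <= b by exact: le_trans ab.
  have := Ufin b tb bT => fb.
  move: bd; rewrite -Usplit integral_cst//= lebesgue_measure_itv /= lte_fin.
  rewrite -(fineK fb); have ub : 0 <= fine (U b) by exact: fine_ge0.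
  case: ifPn => [ab'|_]; last first.
    by rewrite mule0 lee_fin => h; congr EFin; apply/eqP; rewrite eq_le h ub.
  rewrite -EFinB -!EFinM lee_fin => h; congr EFin; apply/eqP; rewrite eq_le ub andbT.
  have h2 : C * fine (U b) * (b - a) <= 2^-1 * fine (U b).
    by rewrite mulrAC ler_wpM2r.
  by move: (le_trans h h2); lra.
(* The successor makes [n] positive and larger than [2 C (T - t)], so that a mesh [(T - t) / n] is
   short enough. *)
pose n := (Num.truncn (2 * C * (T - t))).+1.
have n0 : 0 < n%:R :> R by [].
have hn : C * ((T - t) / n%:R) <= 2^-1.
  have := truncnS_gt (2 * C * (T - t)); rewrite -/n => h.
  by rewrite mulrA ler_pdivrMr//; move: (ltW h); lra.
have Tt : 0 <= (T - t) / n%:R by rewrite divr_ge0// subr_ge0.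
pose a k : R := t + k%:R * ((T - t) / n%:R).
have aS k : a k.+1 = a k + (T - t) / n%:R by rewrite /a -natr1 mulrDl mul1r addrA.
have aT k : (k <= n)%N -> a k <= T.
  move=> kn; rewrite /a -lerBrDl mulrCA ler_piMr ?subr_ge0//.
  by rewrite ler_pdivrMr// mul1r ler_nat.
have ta k : t <= a k by rewrite /a lerDl mulr_ge0.
have Uk k : (k <= n)%N -> U (a k) = 0%E.
  elim: k => [_|k IH kn].
    by rewrite /a mul0r addr0 /U set_itv1 integral_set1.
  apply: (step (a k)) (IH (ltnW kn)) => //; first by rewrite aS lerDl.
    exact: aT.
  by rewrite aS addrC addKr.
have := Uk n (leqnn n); rewrite /a mulrC divfK ?gt_eqF// addrC subrK.
exact.
Qed.

End gronwall.

(** * Comparison of mild solutions *)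

Section comparison.
Context d0 (T0 : measurableType d0) (R : realType) (mu : {measure set T0 -> \bar R}).
Local Notation H := (L2 mu).
Local Notation leb := (@lebesgue_measure R).
Context (S : R -> H -> H) (sgS : contraction_semigroup S)
  (posS : forall (s : R) x, 0 <= s -> L2_le 0 x -> L2_le 0 (S s x)).

Lemma ae_integral_ge0 (D : set R) (f : R -> R) : measurable D ->
  leb.-integrable D (EFin \o f) -> (\forall r \ae leb, D r -> 0 <= f r) ->
  (0 <= \int[leb]_(r in D) (f r)%:E)%E.
Proof.
move=> mD fi f0.
rewrite (@ae_eq_integral _ (measurableTypeR R) _ leb D (fun r => `|f r|%:E))//.
- by apply: integral_ge0 => r _; rewrite lee_fin.
- exact: measurable_int fi.
- by apply/measurable_EFinP; apply: measurableT_comp => //; apply/measurable_EFinP;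
  exact: measurable_int fi.
- by move: f0; apply: aeS => r h Dr; rewrite ger0_norm// h.
Qed.

(** The deterministic core, for one path, after the common stochastic term has cancelled: [d1], [d2]
    and [g1], [g2] are the drifts and forcings along the two solutions, and [k] majorizes the
    positive part of the drift difference. *)
Lemma mild_comparison (t s : R) (d1 d2 g1 g2 : R -> H) (y1 y2 I1 I2 : H) (k : R -> R) :
  t <= s ->
  is_bochner_integral t s (fun r => S (s - r) (d1 r + g1 r)) I1 ->
  is_bochner_integral t s (fun r => S (s - r) (d2 r + g2 r)) I2 ->
  leb.-integrable `[t, s] (EFin \o k) ->
  (forall r, t <= r <= s -> `|L2_pos (d2 r - d1 r)| <= k r) ->
  (\forall r \ae leb, t <= r <= s -> L2_le (g2 r) (g1 r)) ->
  L2_le y2 y1 ->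
  (`|L2_pos ((S (s - t) y2 + I2) - (S (s - t) y1 + I1))|%:E <=
    \int[leb]_(r in `[t, s]) (k r)%:E)%E.
Proof.
move=> ts bI1 bI2 ik hk hg hy.
set Delta := (_ - _); set h := L2_pos Delta.
have h_ge0 : L2_le 0 h by exact: L2_pos_ge0.
have mD : measurable (`[t, s]%classic : set R) by exact: measurable_itv.
have [G1 [iG1 aG1 eG1]] := bochner_dot h bI1.
have [G2 [iG2 aG2 eG2]] := bochner_dot h bI2.
have st0 : 0 <= s - t by rewrite subr_ge0.
have init : dot (S (s - t) y2 - S (s - t) y1) h <= 0.
  have pos : L2_le 0 (S (s - t) y1 - S (s - t) y2).
    by rewrite -semigroupB//; apply: posS => //; exact: (iffLR (L2_leB y2 y1) hy).
  by rewrite -opprB dotNl oppr_le0; exact: L2dot_ge0.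
have pw r : t <= r <= s -> L2_le (g2 r) (g1 r) ->
    dot (S (s - r) (d2 r + g2 r)) h - dot (S (s - r) (d1 r + g1 r)) h <= `|h| * k r.
  move=> /[dup] trs /andP[tr rs] hgr.
  have sr0 : 0 <= s - r by rewrite subr_ge0.
  rewrite -dotBl -semigroupB// opprD addrACA.
  set db := d2 r - d1 r; set df := g2 r - g1 r.
  apply: (@le_trans _ _ (dot (S (s - r) (L2_pos db)) h)).
    rewrite -subr_ge0 -dotBl -semigroupB//; apply: L2dot_ge0 => //; apply: posS => //.
    (* Both [L2_pos db - db] and [- df] are nonnegative, and the semigroup preserves this. *)
    rewrite opprD addrA; apply: L2_ge0D; first exact: L2_pos_subr_ge0.
    by rewrite /df opprB; exact: (iffLR (L2_leB _ _) hgr).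
  apply: le_trans (cauchy_schwarz _ _) _; rewrite mulrC ler_wpM2l//.
  exact: le_trans (semigroup_contraction sgS _ sr0) (hk r trs).
have ihk : leb.-integrable `[t, s] (EFin \o (fun r => `|h| * k r)).
  exact: (@integrableZl _ (measurableTypeR R) _ leb _ mD `|h| _ ik).
have iG : leb.-integrable `[t, s] (EFin \o (fun r => G2 r - G1 r)).
  exact: (@integrableB _ (measurableTypeR R) _ leb _ mD _ _ iG2 iG1).
have iK : leb.-integrable `[t, s] (EFin \o (fun r => `|h| * k r - (G2 r - G1 r))).
  exact: (@integrableB _ (measurableTypeR R) _ leb _ mD _ _ ihk iG).
have K0 : (0 <= \int[leb]_(r in `[t, s]) (`|h| * k r - (G2 r - G1 r))%:E)%E.
  apply: ae_integral_ge0 => //.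
  move: hg aG1 aG2; apply: aeS3 => r hgr h1 h2 rts.
  have trs : t <= r <= s by move: rts; rewrite /= in_itv.
  by rewrite subr_ge0 h1// h2//; apply: pw => //; exact: hgr.
have fk : (\int[leb]_(r in `[t, s]) (k r)%:E)%E \is a fin_num.
  exact: (@integrable_fin_num _ (measurableTypeR R) _ leb _ mD _ ik).
have E1 : \int[leb]_(r in `[t, s]) (`|h| * k r - (G2 r - G1 r)) =
    `|h| * \int[leb]_(r in `[t, s]) k r - (dot I2 h - dot I1 h).
  rewrite (@RintegralB _ (measurableTypeR R) _ leb _ _ _ mD ihk iG).
  rewrite (@RintegralB _ (measurableTypeR R) _ leb _ _ _ mD iG2 iG1).
  rewrite (@RintegralZl _ (measurableTypeR R) _ leb _ _ `|h| mD ik).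
  have r1 : \int[leb]_(r in `[t, s]) G1 r = dot I1 h by rewrite /Rintegral eG1.
  have r2 : \int[leb]_(r in `[t, s]) G2 r = dot I2 h by rewrite /Rintegral eG2.
  by rewrite r1 r2.
have K0' : 0 <= `|h| * \int[leb]_(r in `[t, s]) k r - (dot I2 h - dot I1 h).
  by rewrite -E1; exact: fine_ge0.
have hh : `|h| ^+ 2 = dot (S (s - t) y2 - S (s - t) y1) h + (dot I2 h - dot I1 h).
  by rewrite -L2dot_pos -/h /Delta opprD addrACA dotDl !dotBl.
have le2 : `|h| * `|h| <= `|h| * \int[leb]_(r in `[t, s]) k r.
  by rewrite -expr2 hh; move: init K0'; lra.
rewrite -(fineK fk) lee_fin.
(* The bound is divided by [|h|]; when [h = 0] the right-hand side only has to be nonnegative. *)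
have [->|hn0] := eqVneq h 0.
  rewrite normr0; apply: fine_ge0; apply: integral_ge0 => r /=; rewrite in_itv /= => /hk hr.
  by rewrite lee_fin (le_trans _ hr).
by move: le2; rewrite ler_pM2l// normr_gt0.
Qed.

End comparison.

(** * Progressive processes and their running integrals *)

Section prog_sections.
Context d0 (T0 : measurableType d0) (R : realType) (mu : {measure set T0 -> \bar R}).
Local Notation H := (L2 mu).
Context (D : nat -> H) (dD : forall x (e : R), 0 < e -> exists n, `|x - D n| < e).
Context d (Omega : measurableType d) (F : R -> set_system Omega) (t T : R).
Hypotheses (tT : t <= T) (FT : F T `<=` measurable).
Local Notation dom := ([set: Omega] `*` (`[t, T]%classic : set R)).

Lemma prog_preimage_measurable (X : Omega -> R -> H) (U : set H) :
  prog_measurable F t T (@borel H) X -> open U ->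
  measurable (dom `&` (fun p => X p.1 p.2) @^-1` U).
Proof.
move=> pX oU.
have bU : borel U by exact: sub_sigma_algebra.
have := prog_sub_measurable tT FT (pX _ bU); congr (measurable _).
apply/seteqP; split=> -[w r] /=.
  by move=> [h1 h2]; split=> //; split=> //; rewrite in_itv.
by move=> [[_ h1] h2]; split=> //; move: h1; rewrite in_itv.
Qed.

Lemma prog_section_measurable (X : Omega -> R -> H) (U : set H) w :
  prog_measurable F t T (@borel H) X -> open U ->
  measurable (`[t, T]%classic `&` (X w) @^-1` U).
Proof.
move=> pX oU; have := measurable_xsection w (prog_preimage_measurable pX oU).
congr (measurable _); apply/seteqP; split=> r; rewrite /xsection /= inE /=.
  by move=> [[_ h1] h2].
by move=> [h1 h2].
Qed.

Let lip (x x' y y' : H) :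
  `| `|L2_pos (x - y)| - `|L2_pos (x' - y')| | <= `|x - x'| + `|y - y'|.
Proof.
apply: le_trans (L2_pos_norm_dist _ _) _.
rewrite (_ : x - y - (x' - y') = (x - x') - (y - y')); first exact: ler_normB.
by rewrite !opprD !opprK addrACA.
Qed.

Lemma measurable_prog_pos (X Y : Omega -> R -> H) :
  prog_measurable F t T (@borel H) X -> prog_measurable F t T (@borel H) Y ->
  measurable_fun dom (fun p => `|L2_pos (X p.1 p.2 - Y p.1 p.2)|).
Proof.
move=> pX pY.
apply: (measurable_fun_lipschitz2 dD lip (X := fun p => X p.1 p.2) (Y := fun p => Y p.1 p.2)).
  by move=> U oU; exact: prog_preimage_measurable.
by move=> U oU; exact: prog_preimage_measurable.
Qed.

Lemma measurable_section_pos (X Y : Omega -> R -> H) w :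
  prog_measurable F t T (@borel H) X -> prog_measurable F t T (@borel H) Y ->
  measurable_fun `[t, T] (fun r => `|L2_pos (X w r - Y w r)|).
Proof.
move=> pX pY; apply: (measurable_fun_lipschitz2 dD lip (X := X w) (Y := Y w)).
  by move=> U oU; exact: prog_section_measurable.
by move=> U oU; exact: prog_section_measurable.
Qed.

Lemma measurable_section_norm (X : Omega -> R -> H) w :
  prog_measurable F t T (@borel H) X -> measurable_fun `[t, T] (fun r => `|X w r|).
Proof.
move=> pX; apply: (@measurable_fun_lipschitz2 _ _ D dD _ _ _ (X w) (X w) (fun x _ => `|x|)).
- by move=> x x' y y'; rewrite (le_trans (ler_dist_dist _ _))// lerDl.
- by move=> U oU; exact: prog_section_measurable.
- by move=> U oU; exact: prog_section_measurable.
Qed.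

End prog_sections.

Section process_gronwall.
Context d (Omega : measurableType d) (R : realType) (P : probability Omega R) (t T : R).
Local Notation leb := (@lebesgue_measure R).
Local Notation dom := ([set: Omega] `*` (`[t, T]%classic : set R)).

(** The upper limit is moved into the integrand as the indicator of [r <= s], jointly measurable in
    [(w, s)] and [r]; Tonelli then gives measurability in the pair. *)
Lemma measurable_running_integral (u : Omega -> R -> R) :
  measurable_fun dom (fun p => u p.1 p.2) -> (forall w r, 0 <= u w r) ->
  measurable_fun dom (fun p : Omega * R => \int[leb]_(r in `[t, p.2]) (u p.1 r)%:E)%E.
Proof.
move=> mu u0.
have mdom : measurable dom by exact: measurableX.
pose v : Omega * R -> \bar R := (fun p => (u p.1 p.2)%:E) \_ dom.
have mv : measurable_fun setT v.
  by apply: (iffLR (measurable_restrictT _ mdom)); exact/measurable_EFinP.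
have v0 p : (0 <= v p)%E by rewrite /v patchE; case: ifP => // _; rewrite lee_fin.
pose J : set ((Omega * R) * R) := [set q | q.2 <= q.1.2].
have mJ : measurable J.
  rewrite -[J]setTI; apply: measurable_fun_ler => //.
  by apply: measurableT_comp.
pose g (q : (Omega * R) * R) : \bar R := (v (q.1.1, q.2) * (\1_J q)%:E)%E.
have mg : measurable_fun setT g.
  apply: emeasurable_funM; last by apply/measurable_EFinP; exact: measurable_indic.
  apply: (measurableT_comp mv); apply: measurable_fun_pair => //.
  by apply: measurableT_comp.
have g0 q : (0 <= g q)%E by rewrite /g mule_ge0// lee_fin.
have mF : measurable_fun setT (fun p => \int[leb]_r g (p, r))%E.
  exact: (@measurable_fun_fubini_tonelli_F _ _ (Omega * R)%type (measurableTypeR R) R leb g mg g0).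
apply: (eq_measurable_fun (fun p => \int[leb]_r g (p, r))%E); last exact: measurable_funS mF.
move=> [w s]; rewrite inE /= in_itv /= => -[_ /andP[ts sT]].
rewrite [RHS]integral_mkcond; apply: eq_integral => r _.
rewrite patchE /g /v /J /= indicE patchE.
have [rts|rts] := boolP (r \in `[t, s]%classic).
  move: rts; rewrite inE /= in_itv /= => /andP[tr rs].
  have Dwr : dom (w, r) by split=> //=; rewrite in_itv /= tr (le_trans rs).
  by rewrite (mem_set Dwr) (mem_set (rs : [set q : Omega * R * R | q.2 <= q.1.2] (w, s, r))) mule1.
have [rs|rs] := leP r s; last first.
  have nJ : ~ [set q : Omega * R * R | q.2 <= q.1.2] (w, s, r).
    by apply/negP; rewrite -ltNge.
  by rewrite (memNset nJ) mule0.
rewrite memNset ?mul0e//= in_itv /= => -[_ /andP[tr _]].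
by move/negP: rts; apply; rewrite inE /= in_itv /= tr.
Qed.

Lemma process_gronwall (C : R) (u : Omega -> R -> R) : t <= T -> 0 <= C ->
  measurable_fun dom (fun p => u p.1 p.2) -> (forall w r, 0 <= u w r) ->
  (\forall w \ae P, \int[leb]_(r in `[t, T]) (u w r)%:E < +oo)%E ->
  (forall s, t <= s <= T -> \forall w \ae P,
    ((u w s)%:E <= C%:E * \int[leb]_(r in `[t, s]) (u w r)%:E)%E) ->
  forall s, t <= s <= T -> \forall w \ae P, u w s = 0.
Proof.
move=> tT C0 mu u0 uoo hu s /[dup] tsT /andP[ts sT].
have mdom : measurable dom by exact: measurableX.
pose U (p : Omega * R) := (C%:E * \int[leb]_(r in `[t, p.2]) (u p.1 r)%:E)%E.
have mU : measurable_fun dom U.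
  by apply: emeasurable_funM => //; exact: measurable_running_integral.
have mEu : measurable_fun dom (fun p => (u p.1 p.2)%:E) by exact/measurable_EFinP.
(* The set of [(w, r)] where the inequality fails is jointly measurable and null at each fixed
   time. *)
have /ae_swap hsw := measurable_lte mdom mU mEu.
have {}hsw : \forall w \ae P, \forall r \ae leb,
    ~ (dom `&` [set p | (U p < (u p.1 p.2)%:E)%E]) (w, r).
  apply: hsw => r; have [rtT|rtT] := boolP (t <= r <= T); last first.
    by apply: aeW => w [[_]] /=; rewrite in_itv /= (negbTE rtT).
  by move: (hu r rtT); apply: aeS => w hw [_ /=]; rewrite ltNge; move/negP; apply.
move: hsw uoo (hu s tsT); apply: aeS3 => w hw woo hws.
have mw : measurable_fun `[t, T] (u w).
  apply: (eq_measurable_fun ((fun p : Omega * R => u p.1 p.2) \o pair w)) => //.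
  by apply: (measurable_comp mdom) => //;
    [move=> _ [r h <-]|exact: measurable_funS (measurable_pair1 w)].
have z : (\int[leb]_(r in `[t, T]) (u w r)%:E = 0)%E.
  apply: (gronwall_zero tT C0) => //.
  move: hw; apply: aeS => r nB rtT.
  rewrite leNgt; apply/negP => h; apply: nB; split; last exact: h.
  by split; rewrite //= in_itv.
have z' : (\int[leb]_(r in `[t, s]) (u w r)%:E <= 0)%E.
  rewrite -z; apply: (@ge0_subset_integral _ (measurableTypeR R) R leb) => //=.
  - exact/measurable_EFinP.
  - by move=> r _; rewrite lee_fin.
  - by move=> r /=; rewrite !in_itv /= => /andP[-> rs]; exact: le_trans sT.
apply/eqP; rewrite eq_le u0 andbT -lee_fin (le_trans hws)//.
by rewrite mule_ge0_le0.
Qed.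

End process_gronwall.

(** * From mild solutions to the comparison principle *)

(** If [x] were nonzero, some [D n] would be closer to [x] than [|x|], and [|x|^2 = dot x (x - D n)]
    would be less than [|x|^2]. *)
Lemma separating_eq0 (R : realType) (H : innerProductType R) (D : nat -> H) (x : H) :
  (forall y (e : R), 0 < e -> exists n, `|y - D n| < e) ->
  (forall n, dot x (D n) = 0) -> x = 0.
Proof.
move=> dD x0; apply/eqP; rewrite -normr_eq0; apply/negPn/negP => xn0.
have xp : 0 < `|x| by rewrite lt_neqAle eq_sym xn0 normr_ge0.
have [n hn] := dD x _ xp.
have : `|x| * `|x| <= `|x| * `|x - D n|.
  by rewrite -expr2 -dotxx -[leLHS]subr0 -(x0 n) -dotBr; exact: cauchy_schwarz.
by rewrite ler_pM2l// leNgt hn.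
Qed.

Lemma mild_stochastic_integral_unique (R : realType) (Xi : hilbertType R)
    (H : innerProductType R) (D : nat -> H)
    d (Omega : measurableType d) (P : probability Omega R)
    (W : R -> Xi -> Omega -> R) (t T : R) (S : R -> H -> H)
    (sigma : Omega -> R -> hs_operator Xi H) (s : R) (Z1 Z2 : Omega -> H) :
  (forall y (e : R), 0 < e -> exists n, `|y - D n| < e) ->
  separable Xi -> measure_is_complete P -> cylindrical_wiener P W t T ->
  contraction_semigroup S ->
  prog_measurable (wiener_filtration P W t) t T (@hs_borel R Xi H) sigma ->
  t <= s <= T ->
  is_stochastic_integral P W t s (fun w r => S (s - r) \o sigma w r) Z1 ->
  is_stochastic_integral P W t s (fun w r => S (s - r) \o sigma w r) Z2 ->
  \forall w \ae P, Z1 w = Z2 w.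
Proof.
move=> dD sepXi cP wW sgS ms /andP[ts sT] iZ1 iZ2.
have tT : t <= T by exact: le_trans sT.
have FT : wiener_filtration P W t T `<=` measurable.
  by apply: wiener_filtration_sub_measurable => // u a; exact: (wiener_measurable wW).
have lin0 (f : Xi -> H) : linear f -> f 0 = 0.
  by move=> /(_ (-1) 0 0); rewrite scaler0 addr0 scaleN1r addNr.
have linS0 r : 0 <= r -> S r 0 = 0.
  by move=> r0; have := semigroup_linear sgS r0 (-1) 0 0; rewrite scaler0 addr0 scaleN1r addNr.
have Zn n : \forall w \ae P, dot (Z1 w - Z2 w) (D n) = 0.
  have c0 : 0 < `|D n| + 1 by rewrite ltr_wpDl.
  (* The test vector is scaled to norm at most [1], with [+ 1] to allow for [D n = 0]. *)
  have h1 : `|(`|D n| + 1)^-1 *: D n| <= 1.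
    by rewrite normrZ gtr0_norm ?invr_gt0// mulrC ler_pdivrMr// mul1r lerDl.
  have Phi0 w r : t <= r <= s -> (S (s - r) \o sigma w r) 0 = 0.
    move=> /andP[_ rs]; rewrite /= (lin0 _ (@hs_linear _ _ _ (sigma w r))).
    by rewrite linS0// subr_ge0.
  have mPhi w e : e = 0 \/ onb e -> measurable_fun `[t, s]
      (fun r => dot ((S (s - r) \o sigma w r) e) ((`|D n| + 1)^-1 *: D n)).
    move=> eb; apply: (measurable_semigroup_dot sgS) => c c0'.
    have m := @measurable_fun_hs_dot _ _ _ sgS _ sepXi _ _ _ _ _ _ e c
      ((`|D n| + 1)^-1 *: D n) w tT FT ms c0' eb.
    apply: measurable_funS m => //.
    by move=> r /=; rewrite !in_itv /= => /andP[-> rs]; exact: le_trans sT.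
  have := stochastic_integral_unique sepXi cP wW ts sT h1 Phi0 mPhi iZ1 iZ2.
  apply: aeS => w; rewrite dotZr => /eqP; rewrite mulf_eq0 invr_eq0 gt_eqF//= => /eqP.
  exact.
have := ae_foralln Zn; apply: aeS => w hw; apply/eqP; rewrite -subr_eq0.
by apply/eqP; exact: separating_eq0 dD hw.
Qed.

(** Read off the integrability clause at [s = T]. The remaining summands may be nonmeasurable, so
    they are dropped by comparing lower integrals. *)
Lemma mild_norm_integrable (R : realType) (Xi : hilbertType R) (H : innerProductType R)
    d (Omega : measurableType d) (P : probability Omega R)
    (W : R -> Xi -> Omega -> R) (t T : R) (S : R -> H -> H)
    (b : Omega -> R -> H -> H) (sigma : Omega -> R -> hs_operator Xi H)
    (f : Omega -> R -> H) (x : H) (X : Omega -> R -> H) :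
  t <= T -> mild_solution P W t T S b sigma f x X ->
  \forall w \ae P, (\int[lebesgue_measure]_(r in `[t, T]) `|X w r|%:E < +oo)%E.
Proof.
move=> tT [_ /(_ T)]; rewrite tT lexx => /(_ isT)[+ _].
apply: aeS => w; apply: le_lt_trans; apply: ge0_le_integral_lower => r _.
  by rewrite lee_fin.
rewrite EFinD -addeA leeDl// adde_ge0 ?lee_fin//.
by apply: esum_ge0 => e _; rewrite lee_fin sqr_ge0.
Qed.

Theorem theorem3p18 (R : realType) (d : nat) (O : set 'rV[R]_d)
  (oO : open O) (cO : connected O) (nO : O !=set0)
  (Xi : hilbertType R) (sepXi : separable Xi)
  (disp : measure_display) (Omega : measurableType disp)
  (P : probability Omega R) (cP : measure_is_complete P)
  (t T : R) (t0 : 0 <= t) (tT : t < T)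
  (W : R -> Xi -> Omega -> R) (wW : cylindrical_wiener P W t T)
  (DA : set (L2_domain oO)) (A : L2_domain oO -> L2_domain oO)
  (linA : linear_operator DA A) (densA : dense DA)
  (maxA : maximal_dissipative DA A)
  (S : R -> L2_domain oO -> L2_domain oO)
  (sgS : contraction_semigroup S) (genS : generator DA A S)
  (posS : forall (s : R) x, 0 <= s -> L2_le 0 x -> L2_le 0 (S s x))
  (b : Omega -> R -> L2_domain oO -> L2_domain oO)
  (mb : prog_borel_measurable (wiener_filtration P W t) t T b)
  (C : R)
  (lipb : forall w (s : R) x1 x2, t <= s <= T ->
    `|L2_pos (b w s x1 - b w s x2)| <= C * `|L2_pos (x1 - x2)|)
  (sigma : Omega -> R -> hs_operator Xi (L2_domain oO))
  (msigma : prog_measurable (wiener_filtration P W t) t T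
    (@hs_borel R Xi (L2_domain oO)) sigma)
  (f1 f2 : Omega -> R -> L2_domain oO)
  (mf1 : prog_measurable (wiener_filtration P W t) t T
    (@borel (L2_domain oO)) f1)
  (mf2 : prog_measurable (wiener_filtration P W t) t T
    (@borel (L2_domain oO)) f2)
  (if1 : \forall w \ae P,
    (\int[lebesgue_measure]_(r in `[t, T]) `|f1 w r|%:E < +oo)%E)
  (if2 : \forall w \ae P,
    (\int[lebesgue_measure]_(r in `[t, T]) `|f2 w r|%:E < +oo)%E)
  (x1 x2 : L2_domain oO)
  (X1 X2 : Omega -> R -> L2_domain oO)
  (mX1 : mild_solution P W t T S b sigma f1 x1 X1)
  (mX2 : mild_solution P W t T S b sigma f2 x2 X2)
  (x12 : L2_le x2 x1)
  (f12 : forall s : R, t <= s <= T ->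
    \forall w \ae P, L2_le (f2 w s) (f1 w s)) :
  forall s : R, t <= s <= T -> \forall w \ae P, L2_le (X2 w s) (X1 w s).
Proof.
have tT' := ltW tT.
have [D dD] := L2_domain_separable oO.
have FT : wiener_filtration P W t T `<=` measurable.
  by apply: wiener_filtration_sub_measurable => // u a; exact: (wiener_measurable wW).
have leP' (x y : L2_domain oO) : `|L2_pos (x - y)| = 0 <-> L2_le x y.
  split=> [/L2_pos_eq0|] h.
    by apply/L2_leB; rewrite -opprB; exact: (iffLR (L2_ge0N _) h).
  by apply/L2_pos_eq0/L2_ge0N; rewrite opprB; exact: (iffLR (L2_leB _ _) h).
pose u w r := `|L2_pos (X2 w r - X1 w r)|.
have mu := measurable_prog_pos dD tT' FT mX2.1 mX1.1.
(* The forcing terms are ordered almost surely at each time, whereas the pathwise comparison needs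
   one null set for almost all times. *)
have f_ae : \forall w \ae P, \forall r \ae lebesgue_measure,
    t <= r <= T -> L2_le (f2 w r) (f1 w r).
  pose B := [set: Omega] `*` `[t, T]
      `&` [set p | (0 < `|L2_pos (f2 p.1 p.2 - f1 p.1 p.2)|%:E)%E].
  have mB : measurable B.
    apply: measurable_lte => //; first exact: measurableX.
    have mf := measurable_prog_pos dD tT' FT mf2 mf1; apply/measurable_EFinP; exact: mf.
  have hB r : \forall w \ae P, ~ B (w, r).
    have [rtT|rtT] := boolP (t <= r <= T); last first.
      by apply: aeW => w [[_]] /=; rewrite in_itv /= (negbTE rtT).
    move: (f12 r rtT); apply: aeS => w /leP' h [_ /=].
    by rewrite h lte_fin ltxx.
  move: (ae_swap mB hB); apply: aeS => w; apply: aeS => r nB rtT; apply/leP'.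
  apply/eqP; rewrite eq_le normr_ge0 andbT leNgt; apply/negP => h; apply: nB.
  by split; [split; rewrite //= in_itv|rewrite /= lte_fin].
have u_fin : \forall w \ae P, (\int[lebesgue_measure]_(r in `[t, T]) (u w r)%:E < +oo)%E.
  move: (mild_norm_integrable tT' mX1) (mild_norm_integrable tT' mX2).
  apply: aeS2 => w h1 h2.
  have := lte_add_pinfty h1 h2; rewrite -ge0_integralD//; last 2 first.
  - by apply/measurable_EFinP; exact: (measurable_section_norm dD tT' FT w mX1.1).
  - by apply/measurable_EFinP; exact: (measurable_section_norm dD tT' FT w mX2.1).
  apply: le_lt_trans; apply: ge0_le_integral_lower => r _; rewrite /u ?lee_fin//.
  by rewrite addrC (le_trans (L2_pos_norm_le _))// ler_normB.
(* [|C|] is used because [C] may be negative, while Gronwall's lemma asks for a nonnegative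
   constant. *)
have u_gron s : t <= s <= T -> \forall w \ae P,
    ((u w s)%:E <= `|C|%:E * \int[lebesgue_measure]_(r in `[t, s]) (u w r)%:E)%E.
  move=> /[dup] tsT /andP[ts sT].
  have [_ [Z1 iZ1 aX1]] := mX1.2 s tsT.
  have [_ [Z2 iZ2 aX2]] := mX2.2 s tsT.
  have Z12 := mild_stochastic_integral_unique dD sepXi cP wW sgS msigma tsT iZ1 iZ2.
  have aX : \forall w \ae P, exists I1 I2, [/\
      is_bochner_integral t s (fun r => S (s - r) (b w r (X1 w r) + f1 w r)) I1,
      is_bochner_integral t s (fun r => S (s - r) (b w r (X2 w r) + f2 w r)) I2 &
      X2 w s - X1 w s = S (s - t) x2 + I2 - (S (s - t) x1 + I1)].
    move: aX1 aX2 Z12; apply: aeS3 => w [I1 bI1 ->] [I2 bI2 ->] ->.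
    by exists I1, I2; split=> //; rewrite opprD addrACA subrr addr0.
  move: u_fin f_ae aX; apply: aeS3 => w ufin hf [I1 [I2 [bI1 bI2 eX]]].
  have sub_ts : `[t, s]%classic `<=` `[t, T]%classic.
    by move=> r /=; rewrite !in_itv /= => /andP[-> rs]; exact: le_trans sT.
  have muw := measurable_section_pos dD tT' FT w mX2.1 mX1.1.
  have iu : lebesgue_measure.-integrable `[t, s] (EFin \o (fun r => `|C| * u w r)).
    apply: (@integrableZl _ (measurableTypeR R) _ _ _ (measurable_itv _) `|C| (EFin \o u w)).
    apply: (@integrableS _ (measurableTypeR R) R _ `[t, T]%classic) => //.
    apply/integrableP; split; first exact/measurable_EFinP.
    rewrite (_ : (\int[_]_(r in _) _)%E = (\int[lebesgue_measure]_(r in `[t, T]) (u w r)%:E)%E)//.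
    by apply: eq_integral => r _; rewrite gee0_abs// lee_fin normr_ge0.
  have -> : (`|C|%:E * \int[lebesgue_measure]_(r in `[t, s]) (u w r)%:E =
      \int[lebesgue_measure]_(r in `[t, s]) (`|C| * u w r)%:E)%E.
    rewrite -(@ge0_integralZl_EFin _ (measurableTypeR R) R (@lebesgue_measure R))//.
      by move=> r _; rewrite lee_fin normr_ge0.
    by apply/measurable_EFinP; exact: measurable_funS muw.
  rewrite /u eX; apply: (mild_comparison sgS posS ts bI1 bI2 iu) => //.
  - move=> r /andP[tr rs]; apply: (le_trans (lipb w r _ _ _)).
      by rewrite tr (le_trans rs).
    by rewrite ler_wpM2r// ler_norm.
  - move: hf; apply: aeS => r h /andP[tr rs]; apply: h.
    by rewrite tr (le_trans rs).
move=> s tsT; have := process_gronwall tT' (normr_ge0 C) mu _ u_fin u_gron tsT.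
by move=> /(_ (fun w r => normr_ge0 _)); apply: aeS => w /leP'.
Qed.
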